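(* Let $G=G_{12}$, $H=G\cap\mathrm{SL}(2,\mathbb{C})$, $A=G/H\simeq\mathbb{Z}/2$, and $Y=H\text{-}\mathrm{Hilb}(\mathbb{C}^2)$. The action of $A$ on the exceptional locus of $Y\to\mathbb{C}^2/H$: (a) exchanges $E(\rho_1')$ with $E(\rho_1'')$ and $E(\rho_2')$ with $E(\rho_2'')$; (b) restricts to an involution on $E(\rho_2)$ and on $E(\rho_3)$; (c) fixes each point on $E(\rho_2)$ and fixes one additional point on $E(\rho_3)$, namely the ideal $I$ given by \[ V(I)=\bigl(p_1(-\omega^2\varphi+\psi),\ p_3(-\varphi+\psi),\ p_2(-\omega\varphi+\psi)\bigr), \] where $\omega=e^{2\pi i/3}$, $p_1=x^2-y^2$, $p_2=x^2+y^2$, $p_3=xy$, $\varphi=p_2^2+4\omega p_3^2$, $\psi=p_2^2+4\omega^2p_3^2$.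
   Context: Set $\varepsilon=e^{2\pi i/8}$. $G_{12}\leq\mathrm{GL}(2,\mathbb{C})$ is generated by $\frac{1}{\sqrt2}\begin{pmatrix}1&-1\\-1&-1\end{pmatrix}$, $\frac{1}{\sqrt2}\begin{pmatrix}1&1\\1&-1\end{pmatrix}$, $\begin{pmatrix}0&\varepsilon\\\varepsilon^7&0\end{pmatrix}$. The subgroup $H=G\cap\mathrm{SL}(2,\mathbb{C})$ (index $2$, binary tetrahedral) is generated by $\begin{pmatrix}i&0\\0&-i\end{pmatrix}$, $\begin{pmatrix}0&1\\-1&0\end{pmatrix}$, $\frac{1}{\sqrt2}\begin{pmatrix}\varepsilon^7&\varepsilon^7\\\varepsilon^5&\varepsilon\end{pmatrix}$. The group $G$ acts on $\mathbb{C}[x,y]$ by linear substitutions: $\begin{pmatrix}a&b\\c&d\end{pmatrix}$ sends $x\mapsto ax+cy$, $y\mapsto bx+dy$. $Y=H\text{-}\mathrm{Hilb}(\mathbb{C}^2)$ is the unique component of $\mathrm{Hilb}^{|H|}(\mathbb{C}^2)^H$ dominating $\mathbb{C}^2/H$ via the Hilbert--Chow morphism; it is the minimal (crepant) resolution of $\mathbb{C}^2/H$. Its points are the $H$-invariant ideals $I\subset\mathbb{C}[x,y]$ with $\mathbb{C}[x,y]/I\cong\mathbb{C}[H]$ as $H$-modules. $G$ acts on $Y$ by $I\mapsto g\cdot I$, and this factors through $A=G/H$ (the nontrivial element is represented by $x\mapsto\varepsilon x$, $y\mapsto\varepsilon^3y$). The exceptional locus consists of the ideals supported at the origin. Let $\mathfrak{m}=(x,y)$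 and let $\mathfrak{n}\subset\mathbb{C}[x,y]$ be the ideal generated by the $H$-invariant polynomials vanishing at the origin. For $I$ in the exceptional locus, $\mathfrak{n}\subseteq I\subseteq\mathfrak{m}$ and $V(I):=I/(\mathfrak{m}I+\mathfrak{n})$. For a nontrivial irreducible representation $\rho$ of $H$ with module $V(\rho)$, $E(\rho):=\{I\text{ in the exceptional locus}: V(\rho)\subseteq V(I)\}\simeq\mathbb{P}^1$; these are the irreducible components of the exceptional locus, and $E(\rho)$, $E(\rho')$ with $\rho\ne\rho'$ meet iff $\rho,\rho'$ are adjacent in the McKay graph of $H$. The ideal ''given by'' generators of $V(I)$ is the ideal of $\mathbb{C}[x,y]$ generated by $\mathfrak{n}$ and those generators. Labeling of irreducible representations of $H$: the McKay graph (extended Dynkin diagram of type $E_6$) has vertices $\rho_0$ (trivial), $\rho_2,\rho_3,\rho_2',\rho_1',\rho_2'',\rho_1''$ with edges $\rho_0-\rho_2$, $\rho_2-\rho_3$, $\rho_3-\rho_2'$, $\rho_2'-\rho_1'$, $\rho_3-\rho_2''$, $\rho_2''-\rho_1''$; subscripts are dimensions. The primed and doubly primed branches are distinguished by: $\varphi$ spans a copy of $\rho_1'$ and $\psi$ spans a copy of $\rho_1''$. An involution is here an automorphism whose square is the identity (the identity being allowed). ''Additional'' means not lying on $E(\rho_2)$. *)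

(* Defs.v *)
From mathcomp Require Import all_boot all_order all_algebra.
From mathcomp Require Import classical_sets reals.
From mathcomp Require Import complex mxtens mpoly.
(* Not imported: the notations of the topology files clash with those of mpoly. *)
From mathcomp Require trigo.

Set Implicit Arguments.
Unset Strict Implicit.
Unset Printing Implicit Defensive.

Import Order.TTheory GRing.Theory Num.Theory.
Local Open Scope classical_set_scope.
Local Open Scope ring_scope.

(* The field of complex numbers is R[i] for R : realType, and C[x, y] is
   {mpoly R[i][2]}. Ideals and subgroups of GL(2, C) are extensional sets. *)

Section Polynomials.
Variable R : realType.
Local Notation C := R[i].
Local Notation S := {mpoly C[2]}.
Implicit Types (I J X : set S) (g : 'M[C]_2) (f p q : S).

(* exp (2 pi i / n) *)
Definition zeta (n : nat) : C :=
  let t : R := 2 * trigo.pi / n%:R in Complex (trigo.cos t) (trigo.sin t).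

Definition eps : C := zeta 8.
Definition omega : C := zeta 3.

Definition x : S := 'X_0.
Definition y : S := 'X_1.

(* The matrix (a b; c d) acts by x |-> a x + c y, y |-> b x + d y; this is a
   left action. *)
Definition poly_act g p : S :=
  p \mPo [tuple \sum_(i < 2) g i j *: 'X_i | j < 2].

Definition ideal_act g I : set S := poly_act g @` I.

Definition is_ideal I : Prop :=
  [/\ I 0, forall p q, I p -> I q -> I (p + q) & forall f p, I p -> I (f * p)].

Definition ideal_gen X : set S := smallest is_ideal X.

Definition ideal_add I J : set S := [set p + q | p in I & q in J].

Definition ideal_mul I J : set S := ideal_gen [set p * q | p in I & q in J].

Definition maxideal : set S := ideal_gen [set x; y].

Definition p1 : S := x ^+ 2 - y ^+ 2.
Definition p2 : S := x ^+ 2 + y ^+ 2.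
Definition p3 : S := x * y.
Definition phi : S := p2 ^+ 2 + (4 * omega) *: p3 ^+ 2.
Definition psi : S := p2 ^+ 2 + (4 * omega ^+ 2) *: p3 ^+ 2.

End Polynomials.

Arguments maxideal : clear implicits.

Section Groups.
Variable R : realType.
Local Notation C := R[i].

Definition mx22 (a b c d : C) : 'M[C]_2 :=
  \matrix_(i, j) if i == 0 then (if j == 0 then a else b)
                 else (if j == 0 then c else d).

Definition is_subgroup (K : set 'M[C]_2) : Prop :=
  [/\ forall g, K g -> g \in unitmx, K 1%:M,
      forall g h, K g -> K h -> K (g *m h) & forall g, K g -> K (invmx g)].

Definition G12 : set 'M[C]_2 :=
  let s : C := (Num.sqrt 2)%:C%C^-1 in
  smallest is_subgroup
    [set s *: mx22 1 (-1) (-1) (-1); s *: mx22 1 1 1 (-1);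
         mx22 0 (eps R) (eps R ^+ 7) 0].

Definition H : set 'M[C]_2 := [set g | G12 g /\ \det g = 1].

(* The quotient G / H, as the set of left cosets of H in G. *)
Definition A : set (set 'M[C]_2) :=
  [set a | exists2 g, G12 g & a = [set g *m h | h in H]].

(* The action of a coset on an ideal. On H-invariant ideals all the
   representatives g of a give the same ideal, so the union is that ideal. *)
Definition coset_act (a : set 'M[C]_2) (I : set {mpoly C[2]})
    : set {mpoly C[2]} :=
  \bigcup_(g in a) ideal_act g I.

Definition A_fixed : set (set {mpoly C[2]}) :=
  [set I | forall a, A a -> coset_act a I = I].

End Groups.

Arguments G12 : clear implicits.
Arguments H : clear implicits.
Arguments A : clear implicits.
Arguments A_fixed : clear implicits.

(* An n-dimensional representation of H is a map 'M_2 -> 'M_n of which only the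
   values on H matter; its module is 'cV_n, on which h acts by v |-> r h *m v. *)
Section Representations.
Variable R : realType.
Local Notation C := R[i].

Definition is_rep n (r : 'M[C]_2 -> 'M[C]_n) : Prop :=
  r 1%:M = 1%:M /\ forall g h, H R g -> H R h -> r (g *m h) = r g *m r h.

Definition is_irr n (r : 'M[C]_2 -> 'M[C]_n) : Prop :=
  [/\ is_rep r, (0 < n)%N
    & forall W : set 'cV[C]_n,
        W 0 -> (forall a u v, W u -> W v -> W (a *: u + v)) ->
        (forall h v, H R h -> W v -> W (r h *m v)) ->
        W = [set 0] \/ W = setT].

Definition rep_iso n m (r : 'M[C]_2 -> 'M[C]_n) (s : 'M[C]_2 -> 'M[C]_m) :=
  exists (M : 'M[C]_(m, n)) (N : 'M[C]_(n, m)),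
    [/\ M *m N = 1%:M, N *m M = 1%:M
      & forall h, H R h -> s h *m M = M *m r h].

Definition rep_sub n m (r : 'M[C]_2 -> 'M[C]_n) (s : 'M[C]_2 -> 'M[C]_m) :=
  exists2 M : 'M[C]_(m, n), \rank M = n
    & forall h, H R h -> s h *m M = M *m r h.

(* Edges of the McKay graph: s is a constituent of r tensored with the defining
   representation of H in SL(2, C). *)
Definition mckay_adjacent n m (r : 'M[C]_2 -> 'M[C]_n)
    (s : 'M[C]_2 -> 'M[C]_m) : Prop :=
  rep_sub s (fun h => r h *t h).

Definition spans_copy (p : {mpoly C[2]}) (r : 'M[C]_2 -> 'M[C]_1) : Prop :=
  p != 0 /\ forall h, H R h -> poly_act h p = r h 0 0 *: p.

End Representations.

(* Vertices of the extended Dynkin diagram E6; _' and _'' are the primed and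
   doubly primed branches. *)
Variant mckay_vertex : Set :=
  rho0 | rho2 | rho3 | rho2' | rho1' | rho2'' | rho1''.

Definition mckay_dim (v : mckay_vertex) : nat :=
  match v with
  | rho0 | rho1' | rho1'' => 1
  | rho2 | rho2' | rho2'' => 2
  | rho3 => 3
  end.

Definition mckay_arrow (v w : mckay_vertex) : bool :=
  match v, w with
  | rho0, rho2 | rho2, rho3 | rho3, rho2' | rho2', rho1'
  | rho3, rho2'' | rho2'', rho1'' => true
  | _, _ => false
  end.

Definition mckay_edge (v w : mckay_vertex) : bool :=
  mckay_arrow v w || mckay_arrow w v.

Definition mckay_labelling (R : realType)
    (rho : forall v, 'M[R[i]]_2 -> 'M[R[i]]_(mckay_dim v)) : Prop :=
  [/\ (forall v, is_irr (rho v)) /\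
      (forall n (r : 'M[R[i]]_2 -> 'M[R[i]]_n), is_irr r ->
         exists! v, rep_iso r (rho v)),
      forall h, H R h -> rho rho0 h = 1%:M,
      forall v w, mckay_adjacent (rho v) (rho w) <-> mckay_edge v w,
      spans_copy (phi R) (rho rho1')
    & spans_copy (psi R) (rho rho1'')].

Section HilbertScheme.
Variable R : realType.
Local Notation C := R[i].
Local Notation S := {mpoly C[2]}.
Implicit Types (I J : set S) (f p : S).

(* C[x, y] / I is isomorphic to C[H] as an H-module: there is a linear,
   H-equivariant surjection F of C[x, y] onto C[H] with kernel I. An element
   \sum_g u(g) g of C[H] is represented by its coefficient function u on H, so
   that left multiplication by h is (h u)(g) = u(h^-1 g). *)
Definition quotient_regular I : Prop :=
  exists F : S -> 'M[C]_2 -> C,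
    [/\ forall (a : C) p q g, H R g -> F (a *: p + q) g = a * F p g + F q g,
        forall h p g, H R h -> H R g ->
          F (poly_act h p) g = F p (invmx h *m g),
        forall u : 'M[C]_2 -> C, exists p, forall g, H R g -> F p g = u g
      & forall p, I p <-> (forall g, H R g -> F p g = 0)].

(* Points of H-Hilb(C^2). *)
Definition Y : set (set S) :=
  [set I | [/\ is_ideal I, forall h, H R h -> ideal_act h I = I
             & quotient_regular I]].

(* The ideals supported at the origin, i.e. with zero locus {(0, 0)}. *)
Definition exceptional : set (set S) :=
  [set I | Y I /\ forall v : 'I_2 -> C,
             (forall f, I f -> f.@[v] = 0) <-> (forall j, v j = 0)].

Definition nideal : set S :=
  ideal_gen [set f | (forall h, H R h -> poly_act h f = f)
                     /\ f.@[fun=> 0] = 0].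

(* The module V(r) of r embeds into I / J as an H-module. An H-linear map
   V(r) -> I / J is given by a linear lift f : V(r) -> I which is H-equivariant
   modulo J. *)
Definition embeds_in_quotient n (r : 'M[C]_2 -> 'M[C]_n) I J : Prop :=
  exists f : {linear 'cV[C]_n -> S},
    [/\ forall v, I (f v),
        forall h v, H R h -> J (f (r h *m v) - poly_act h (f v))
      & forall v, J (f v) -> v = 0].

(* The locus E(r), where V(I) = I / (m I + n). *)
Definition E n (r : 'M[C]_2 -> 'M[C]_n) : set (set S) :=
  [set I | exceptional I /\
     embeds_in_quotient r I
       (ideal_add (ideal_mul (maxideal R) I) nideal)].

(* The ideal given by the generators X of V(I). *)
Definition ideal_given_by (X : set S) : set S := ideal_gen (nideal `|` X).

Definition fixed_ideal : set S :=
  let phi := phi R in let psi := psi R in let omega := omega R in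
  ideal_given_by
    [set p1 R * (- omega ^+ 2 *: phi + psi); p3 R * (- phi + psi);
         p2 R * (- omega *: phi + psi)].

End HilbertScheme.

Arguments Y : clear implicits.
Arguments exceptional : clear implicits.
Arguments nideal : clear implicits.
Arguments fixed_ideal : clear implicits.

(* Regular maps between subvarieties of the Hilbert scheme of points of C^2.
   For a finite family b of polynomials, the ideals I such that b is a basis of
   C[x, y] / I form an affine open subscheme, whose coordinate ring is generated
   by the functions sending I to the coordinates of p modulo I in the basis b,
   for p in C[x, y]. *)
Section RegularMaps.
Variable R : realType.
Local Notation C := R[i].
Local Notation S := {mpoly C[2]}.
Implicit Types (I : set S) (Z : set (set S)).

Definition basis_mod I n (b : 'I_n -> S) : Prop :=
  forall p, exists! c : 'rV[C]_n, I (p - \sum_j c 0 j *: b j).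

(* Row k of c is the vector of coordinates of p k modulo I in the basis b. *)
Definition coords_mod I n (b : 'I_n -> S) m (p : 'I_m -> S) (c : 'M[C]_(m, n))
    : Prop :=
  forall k, I (p k - \sum_j c k j *: b j).

(* On a neighbourhood of I0 in Z, a quotient P / Q of polynomials in finitely
   many coordinates takes at each I a value z such that u I z. *)
Definition locally_rational Z (I0 : set S) (u : set S -> C -> Prop) : Prop :=
  exists n (b : 'I_n -> S) m (p : 'I_m -> S) (P Q : {mpoly C[(m * n)]}),
    [/\ basis_mod I0 b,
        forall c, coords_mod I0 b p c -> Q.@[mxvec c 0] != 0
      & forall I c, Z I -> basis_mod I b -> coords_mod I b p c ->
          Q.@[mxvec c 0] != 0 -> u I (P.@[mxvec c 0] / Q.@[mxvec c 0])].

Definition regular_map Z (F : set S -> set S) : Prop :=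
  forall I0, Z I0 ->
    exists n (b : 'I_n -> S), basis_mod (F I0) b /\
      forall (p : S) (j : 'I_n), locally_rational Z I0 (fun I z =>
        basis_mod (F I) b /\
        exists2 c : 'rV[C]_n, F I (p - \sum_k c 0 k *: b k) & z = c 0 j).

Definition is_automorphism Z (F : set S -> set S) : Prop :=
  [/\ forall I, Z I -> Z (F I), regular_map Z F
    & exists F', [/\ forall I, Z I -> Z (F' I), regular_map Z F',
                     forall I, Z I -> F' (F I) = I
                   & forall I, Z I -> F (F' I) = I]].

Definition is_involution Z (F : set S -> set S) : Prop :=
  is_automorphism Z F /\ forall I, Z I -> F (F I) = I.

End RegularMaps.

(* Main.v *)
From Pilot Require Import Defs.
From HB Require Import structures.
From mathcomp Require Import all_boot all_order all_algebra.
From mathcomp Require Import classical_sets boolp reals.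
From mathcomp Require Import complex mxtens mpoly.
From mathcomp Require Import ring lra zify.
From mathcomp Require trigo.

Set Implicit Arguments.
Unset Strict Implicit.
Unset Printing Implicit Defensive.

Import Order.TTheory GRing.Theory Num.Theory.
Local Open Scope classical_set_scope.
Local Open Scope ring_scope.

(** The group [H] consists of the 24 Hurwitz units, and [G12] is the union of [H]
    and [tau H], where the third generator [tau] is an involution. So the
    nontrivial element of [A] acts on an [H]-stable ideal as [tau] does, and it
    carries [E r] to [E] of the twist of [r] by conjugation by [tau] ([E_tau]).

    The branches. Twisting permutes the vertices of the McKay graph and respects
    its edges and the dimensions. It fixes the trivial vertex, hence [rho2] and
    [rho3]. Since [tau] maps [phi] to [- psi], it exchanges [rho1'] and [rho1''],
    and so their neighbours. The action is a morphism because the coordinates of a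
    polynomial modulo the image of [I], in the image of a basis, are coordinates
    of its transform modulo [I] ([regular_map_sigma]).

    The points of the exceptional locus. The ring of polynomials contains the
    covariant pairs [(x, y)], [(W5x, W5y)], [(W7x, W7y)] of the type of the natural
    representation, and triples of the type of its symmetric square in degrees
    2, 4 and twice 6, the last two being [U] and [K]. The quotient by [I] is the
    regular representation, so by Frobenius reciprocity some combination of the
    three pairs and some combination of the four triples belong to [I]
    ([covariant2_mem], [covariant3_mem]). An ideal of codimension 24 cannot contain
    a combination that starts in degree 1, 2 or 4. There remain two families
    ([exceptional_type]): in the first, [I] contains [W5 + c W7] for some scalar
    [c], or both [W7] and [U]; in the second, it contains [a U + b K] with [b]
    nonzero. Together with the invariants [F6] and [F8], the covariants
    [W5 + c W7], or [W7] and [U], or [K], generate an ideal of codimension at most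
    24; an exceptional ideal containing them is thereby determined.

    The fixed points. The involution permutes the members of [W5 + c W7], of [W7]
    and of [U] up to scalars, so that the ideals of the first family are fixed.
    But it takes [a U + b K] to [a U - b K]: a fixed ideal of the second family
    contains [K], and is the ideal of the statement, whose generators are
    multiples of [p1^3 = Kyy - Kxx], [p2^3 = Kyy + Kxx] and [p3^3 = - Kxy / 4].

    The components. By its adjacency to the trivial vertex, [rho2] is the natural
    representation. For the first family, the covariants found in [I] are nonzero
    modulo [m I + n], by inspection of leading forms ([E_typeAB]). For the second,
    an embedding of [rho2] in [V(I)] would lift, by averaging over [H], to a
    covariant pair contained in [I]; but such pairs lie in [m I + n]
    ([E_not_typeC]). So [E(rho2)] is the first family. Finally [rho3] is realised
    on symmetric matrices, and the triple [K] embeds it in [V] of the fixed ideal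
    ([fixed_E_rho3]). That this ideal is a point of [Y] follows from an explicit
    functional and an explicit polynomial whose translates are dual to those of
    the functional ([lam_dual]). *)

(** * Ideals of the polynomial ring *)

Section Ideals.
Variable R : realType.
Local Notation C := R[i].
Local Notation S := {mpoly C[2]}.
Implicit Types (I J X : set S) (p q f g : S) (c : C).

Section Closure.
Variables (I : set S) (idI : is_ideal I).

Lemma ideal0 : I 0. Proof. by case: idI. Qed.

Lemma idealD p q : I p -> I q -> I (p + q).
Proof. by case: idI => _ h _; exact: h. Qed.

Lemma idealM f p : I p -> I (f * p).
Proof. by case: idI => _ _; exact. Qed.

Lemma idealZ c p : I p -> I (c *: p).
Proof. by rewrite -mul_mpolyC; exact: idealM. Qed.

Lemma idealN p : I p -> I (- p).
Proof. by rewrite -mulN1r; exact: idealM. Qed.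

Lemma idealB p q : I p -> I q -> I (p - q).
Proof. by move=> Ip Iq; apply: idealD => //; exact: idealN. Qed.

Lemma ideal_sum (K : Type) (r : seq K) (P : pred K) (F : K -> S) :
  (forall k, P k -> I (F k)) -> I (\sum_(k <- r | P k) F k).
Proof. exact: (big_ind I ideal0 idealD). Qed.

Lemma idealZK c p : c != 0 -> I (c *: p) -> I p.
Proof. by move=> c0 /(idealZ c^-1); rewrite scalerA mulVf // scale1r. Qed.

Lemma ideal_natK n p : I (n.+1%:R * p) -> I p.
Proof.
by rewrite -[_%:R](rmorph_nat (@mpolyC 2 C)) mul_mpolyC; apply: idealZK; rewrite pnatr_eq0.
Qed.

Lemma ideal_congr p q : I (p - q) -> I q -> I p.
Proof. by move=> h /(idealD h); rewrite subrK. Qed.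

End Closure.

Lemma ideal_gen_ideal X : is_ideal (ideal_gen X).
Proof.
split=> [K [[]] //|p q gp gq K KP|f p gp K KP].
  by case: (KP) => -[_ h _] _; apply: h; [exact: gp|exact: gq].
by case: (KP) => -[_ _ h] _; apply: h; exact: gp.
Qed.

Lemma sub_ideal_gen X : X `<=` ideal_gen X.
Proof. by move=> p Xp K [_]; exact. Qed.

Lemma ideal_gen_min X I : is_ideal I -> X `<=` I -> ideal_gen X `<=` I.
Proof. by move=> idI XI p; apply. Qed.

Lemma ideal_add_ideal I J : is_ideal I -> is_ideal J -> is_ideal (ideal_add I J).
Proof.
move=> idI idJ; split.
- by exists 0; [exact: ideal0|exists 0; [exact: ideal0|rewrite addr0]].
- move=> _ _ [p Ip [q Jq <-]] [p' Ip' [q' Jq' <-]].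
  exists (p + p'); first exact: idealD.
  by exists (q + q'); [exact: idealD|rewrite addrACA].
- move=> f _ [p Ip [q Jq <-]]; exists (f * p); first exact: idealM.
  by exists (f * q); [exact: idealM|rewrite mulrDr].
Qed.

Lemma sub_ideal_addl I J : is_ideal J -> I `<=` ideal_add I J.
Proof. by move=> idJ p Ip; exists p => //; exists 0; [exact: ideal0|rewrite addr0]. Qed.

Lemma sub_ideal_addr I J : is_ideal I -> J `<=` ideal_add I J.
Proof. by move=> idI p Ip; exists 0; [exact: ideal0|exists p; rewrite ?add0r]. Qed.

Lemma ideal_add_min I J K : is_ideal K -> I `<=` K -> J `<=` K ->
  ideal_add I J `<=` K.
Proof. by move=> idK IK JK _ [p /IK Kp [q /JK Kq <-]]; exact: idealD. Qed.

Lemma setI_ideal I J : is_ideal I -> is_ideal J -> is_ideal (I `&` J).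
Proof.
move=> idI idJ; split=> [|p q [? ?] [? ?]|f p [? ?]].
- by split; exact: ideal0.
- by split; exact: idealD.
- by split; exact: idealM.
Qed.

Lemma ideal_mul_gen I J p q : I p -> J q -> ideal_mul I J (p * q).
Proof. by move=> Ip Jq; apply: sub_ideal_gen; exists p => //; exists q. Qed.

End Ideals.

(** * Monomials, homogeneous components and powers of the maximal ideal *)

(** The coordinates and the action are sealed: unification would otherwise
    unfold them down to the representation of polynomials. *)
HB.lock Definition vx (R : realType) : {mpoly R[i][2]} := Defs.x R.
HB.lock Definition vy (R : realType) : {mpoly R[i][2]} := Defs.y R.

Section Monomials.
Variable R : realType.
Local Notation C := R[i].
Local Notation S := {mpoly C[2]}.
Local Notation x := (vx R).
Local Notation y := (vy R).
Implicit Types (I J X : set S) (p q f : S) (c : C).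

Lemma vxE : x = Defs.x R. Proof. by rewrite vx.unlock. Qed.
Lemma vyE : y = Defs.y R. Proof. by rewrite vy.unlock. Qed.

Definition mnm2 (a b : nat) : 'X_{1..2} := [multinom [tuple a; b]].
Definition cf a b p : C := p@_(mnm2 a b).

Lemma mnm2E a b (i : 'I_2) : mnm2 a b i = if i == 0 then a else b.
Proof. by rewrite /mnm2 multinomE (tnth_nth 0%N); case: i => -[|[|]]. Qed.

Lemma mnm2_eta (m : 'X_{1..2}) : m = mnm2 (m 0) (m 1).
Proof. by apply/mnmP => i; rewrite mnm2E; case: i => -[|[|//]] h /=; congr (m _); exact: val_inj. Qed.

Lemma mdeg_mnm2 a b : mdeg (mnm2 a b) = (a + b)%N.
Proof. by rewrite mdegE !big_ord_recl big_ord0 !mnm2E /= addn0. Qed.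

Lemma mnm2_eq a b a' b' : (mnm2 a b == mnm2 a' b') = (a == a') && (b == b').
Proof.
apply/eqP/andP => [/mnmP h|[/eqP-> /eqP->]//].
by have := h 0; have := h 1; rewrite !mnm2E /= => -> ->.
Qed.

Lemma mpolyX_xy a b : 'X_[mnm2 a b] = x ^+ a * y ^+ b.
Proof. by rewrite vxE vyE mpolyXE_id !big_ord_recl big_ord0 mulr1 !mnm2E. Qed.

Lemma cf0 a b : cf a b 0 = 0. Proof. exact: mcoeff0. Qed.
Lemma cfD a b p q : cf a b (p + q) = cf a b p + cf a b q.
Proof. exact: mcoeffD. Qed.
Lemma cfN a b p : cf a b (- p) = - cf a b p. Proof. exact: mcoeffN. Qed.
Lemma cfB a b p q : cf a b (p - q) = cf a b p - cf a b q.
Proof. exact: mcoeffB. Qed.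
Lemma cfZ a b c p : cf a b (c *: p) = c * cf a b p.
Proof. exact: mcoeffZ. Qed.
Lemma cf_sum a b (K : Type) (r : seq K) (P : pred K) (F : K -> S) :
  cf a b (\sum_(k <- r | P k) F k) = \sum_(k <- r | P k) cf a b (F k).
Proof. exact: raddf_sum. Qed.

Lemma cf_mon a b a' b' : cf a b (x ^+ a' * y ^+ b') = ((a' == a) && (b' == b))%:R.
Proof. by rewrite -mpolyX_xy /cf mcoeffX mnm2_eq. Qed.

Lemma cf_C a b c p : cf a b (c%:MP * p) = c * cf a b p.
Proof. by rewrite mul_mpolyC cfZ. Qed.

Lemma cf_x a b : cf a b x = ((1 == a) && (0 == b))%N%:R.
Proof. by rewrite -cf_mon expr1 expr0 mulr1. Qed.
Lemma cf_y a b : cf a b y = ((0 == a) && (1 == b))%N%:R.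
Proof. by rewrite -cf_mon expr1 expr0 mul1r. Qed.
Lemma cf_1 a b : cf a b 1 = ((0 == a) && (0 == b))%N%:R.
Proof. by rewrite -cf_mon !expr0 mulr1. Qed.

(** The binary form of degree [d] with coefficients [cs], by increasing powers
    of [x]. *)
Definition bform d (cs : seq C) : S :=
  \sum_(n < d.+1) (cs`_n)%:MP * (x ^+ n * y ^+ (d - n)).

Lemma cf_bform a b d cs : cf a b (bform d cs) = if (a + b == d)%N then cs`_a else 0.
Proof.
rewrite /bform cf_sum; case: eqP => [<-|abd].
  have ad : (a < (a + b).+1)%N by rewrite ltnS leq_addr.
  rewrite (bigD1 (Ordinal ad)) //= cf_C cf_mon eqxx addKn eqxx mulr1.
  by rewrite big1 ?addr0 // => m; rewrite cf_C cf_mon -val_eqE /= => /negPf ->; rewrite mulr0.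
rewrite big1 // => -[n nd] _; rewrite cf_C cf_mon /=.
by case: eqP => [na|]; rewrite ?mulr0 //; case: eqP => [nb|]; rewrite ?mulr0 //; exfalso; lia.
Qed.

(** The [k]-th power of the maximal ideal. *)
Definition mpow k : set S := [set p | forall a b, (a + b < k)%N -> cf a b p = 0].

Lemma mpowP k p : mpow k p <-> forall m, (mdeg m < k)%N -> p@_m = 0.
Proof.
split=> h; last by move=> a b ab; apply: h; rewrite mdeg_mnm2.
by move=> m; rewrite (mnm2_eta m) mdeg_mnm2; exact: h.
Qed.

Lemma mpowM i j p q : mpow i p -> mpow j q -> mpow (i + j) (p * q).
Proof.
move=> /mpowP hp /mpowP hq; apply/mpowP => m hm.
rewrite mcoeffM big1 // => -[k1 k2] /= /eqP mE.
have [h1|h1] := ltnP (mdeg k1) i; first by rewrite hp // mul0r.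
by rewrite hq ?mulr0 //; move: hm; have /(congr1 mdeg) := mE; rewrite mdegD; lia.
Qed.

Lemma mpow_ideal k : is_ideal (mpow k).
Proof.
split=> [a b _|p q hp hq a b h|f p hp]; first by rewrite cf0.
  by rewrite cfD hp // hq // addr0.
by rewrite -[k]add0n; apply: mpowM.
Qed.

Lemma sub_mpow k l : (l <= k)%N -> mpow k `<=` mpow l.
Proof. by move=> lk p hp a b h; apply: hp; exact: leq_trans lk. Qed.

Lemma mpow_mon a b k : (k <= a + b)%N -> mpow k (x ^+ a * y ^+ b).
Proof.
move=> h a' b' h'; rewrite cf_mon; case: eqP => // ea; case: eqP => // eb; lia.
Qed.

Lemma mpow_x k a : (k <= a)%N -> mpow k (x ^+ a).
Proof. by move=> h; rewrite -[x ^+ a]mulr1 -(expr0 y); apply: mpow_mon; rewrite addn0. Qed.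
Lemma mpow_y k a : (k <= a)%N -> mpow k (y ^+ a).
Proof. by move=> h; rewrite -[y ^+ a]mul1r -(expr0 x); exact: mpow_mon. Qed.
Lemma mpow_nM k n a b : (k <= a + b)%N -> mpow k (n%:R * (x ^+ a * y ^+ b)).
Proof. by move=> h; apply: (idealM (mpow_ideal k)); exact: mpow_mon. Qed.

Lemma mpow1_x : mpow 1 x. Proof. by rewrite -[x]expr1; exact: mpow_x. Qed.
Lemma mpow1_y : mpow 1 y. Proof. by rewrite -[y]expr1; exact: mpow_y. Qed.

Lemma mpow1P p : mpow 1 p <-> p.@[fun=> 0] = 0.
Proof.
have E : p.@[fun=> 0] = cf 0 0 p.
  rewrite {1}[p]mpolyE raddf_sum /= /cf.
  have mE : mnm2 0 0 = 0%MM by apply/mnmP => i; rewrite mnm2E mnm0E; case: ifP.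
  have E m : (p@_m *: 'X_[m]).@[fun=> 0] = if m == 0%MM then p@_m else 0.
    rewrite mevalZ mevalX; case: eqP => [->|/eqP m0].
      by rewrite big1 ?mulr1 // => i _; rewrite mnm0E.
    have [i mi] : exists i, m i != 0%N.
      by apply/existsP; apply: contraNT m0; rewrite negb_exists => /forallP h;
        apply/eqP/mnmP => i; rewrite mnm0E; have := h i; rewrite negbK => /eqP.
    by rewrite (bigD1 i) //= expr0n (negPf mi) mul0r mulr0.
  rewrite (eq_bigr _ (fun m _ => E m)) mE -big_mkcond /=.
  have [h|h] := boolP (0%MM \in msupp p).
    by rewrite -big_filter (eq_filter (a2 := pred1 0%MM)) // filter_pred1_uniq ?msupp_uniq // big_seq1.
  rewrite (memN_msupp_eq0 h) big1_seq // => m /andP[/eqP -> hm].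
  by rewrite hm in h.
by rewrite E; split=> [h|h [|a] [|b] //=]; rewrite ?h.
Qed.

Lemma maxidealP p : maxideal R p <-> mpow 1 p.
Proof.
have idm := ideal_gen_ideal [set Defs.x R; Defs.y R] : is_ideal (maxideal R).
split; first apply: ideal_gen_min; first exact: mpow_ideal.
  move=> _ [->|->]; rewrite -?vxE -?vyE.
    exact: mpow1_x.
  exact: mpow1_y.
move=> hp; rewrite [p]mpolyE big_seq; apply: (ideal_sum idm) => m /=.
rewrite mcoeff_msupp (mnm2_eta m) mpolyX_xy => h. apply: (idealZ idm).
have mx : maxideal R x by apply: sub_ideal_gen; left; rewrite vxE.
have my : maxideal R y by apply: sub_ideal_gen; right; rewrite vyE.
case: (m 0) h => [|a] h; last first.
  by rewrite mulrC exprSr mulrA; apply: (idealM idm).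
case: (m 1) h => [|b] h; last by rewrite exprSr mulrA; apply: (idealM idm).
by have := hp 0%N 0%N isT; rewrite /cf => e; rewrite e eqxx in h.
Qed.

Definition hcomp d p : S := pihomog mdeg d p.

Lemma hcompD d p q : hcomp d (p + q) = hcomp d p + hcomp d q.
Proof. exact: linearD. Qed.
Lemma hcompZ d c p : hcomp d (c *: p) = c *: hcomp d p.
Proof. exact: linearZ. Qed.

Lemma mcoeff_hcomp d p m : (hcomp d p)@_m = if mdeg m == d then p@_m else 0.
Proof.
rewrite /hcomp pihomogE raddf_sum [in RHS](mpolyE p) raddf_sum big_mkcond /=.
case: ifP => h; last rewrite big1 //; last first.
  move=> k _; case: ifP => // hk; rewrite mcoeffZ mcoeffX.
  by case: eqP => [km|_]; [rewrite -km hk in h|rewrite mulr0].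
apply: eq_bigr => k _; rewrite mcoeffZ mcoeffX; case: ifP => // hk.
by case: eqP => [km|_]; [rewrite km h in hk|rewrite mulr0].
Qed.

Lemma cf_hcomp a b d p : cf a b (hcomp d p) = if (a + b == d)%N then cf a b p else 0.
Proof. by rewrite /cf mcoeff_hcomp mdeg_mnm2. Qed.

Lemma cf_inj p q : (forall a b, cf a b p = cf a b q) -> p = q.
Proof. by move=> h; apply/mpolyP => m; rewrite (mnm2_eta m); exact: h. Qed.

Lemma hcompE d p :
  hcomp d p = \sum_(a < d.+1) (cf a (d - a) p)%:MP * (x ^+ a * y ^+ (d - a)).
Proof.
apply: cf_inj => a b; rewrite cf_hcomp cf_sum.
under eq_bigr do rewrite cf_C cf_mon.
case: eqP => h.
  have ad : (a < d.+1)%N by lia.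
  rewrite (bigD1 (Ordinal ad)) //= big1 ?addr0.
    by rewrite eqxx (_ : d - a = b)%N ?eqxx ?mulr1 //; lia.
  by move=> i; rewrite -val_eqE /= => /negPf ->; rewrite mulr0.
rewrite big1 // => i _; case: eqP => [e1|]; last by rewrite mulr0.
case: eqP => [e2|]; last by rewrite mulr0.
by have := ltn_ord i; lia.
Qed.

Lemma mpow_hcomp k p : mpow k (p - \sum_(d < k) hcomp d p).
Proof.
move=> a b h; rewrite cfB cf_sum (bigD1 (Ordinal h)) //= big1.
  by rewrite cf_hcomp eqxx addr0 subrr.
by move=> i; rewrite -val_eqE /= eq_sym cf_hcomp => /negPf ->.
Qed.

Lemma hcomp_mpow k d p : mpow k p -> (d < k)%N -> hcomp d p = 0.
Proof.
move=> hp dk; apply: cf_inj => a b; rewrite cf_hcomp cf0.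
by case: eqP => // h; apply: hp; rewrite h.
Qed.

Lemma mpow_hcomp0 k p : (forall d, (d < k)%N -> hcomp d p = 0) -> mpow k p.
Proof.
by move=> h a b ab; have := cf_hcomp a b (a + b)%N p; rewrite eqxx h // cf0.
Qed.

(** If every monomial of degree [d] lies in [I] up to terms of higher degree,
    the error terms can be pushed to arbitrarily high degree. *)
Lemma mpow_sub_ideal I d N : is_ideal I -> mpow N `<=` I ->
  (forall a, (a <= d)%N ->
     ideal_add I (mpow d.+1) (x ^+ a * y ^+ (d - a))) ->
  mpow d `<=` I.
Proof.
move=> idI NI h.
have idIm k : is_ideal (ideal_add I (mpow k)) by apply: ideal_add_ideal => //; exact: mpow_ideal.
suff H k : mpow (d + k) `<=` I -> mpow d `<=` I.
  by apply: (H N) => p hp; apply: NI; apply: sub_mpow hp; lia.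
elim: k => [|k IH]; rewrite ?addn0 // => hk; apply: IH => p hp.
have -> : p = hcomp (d + k) p + (p - hcomp (d + k) p) by rewrite addrC subrK.
have hr : mpow (d + k.+1) (p - hcomp (d + k) p).
  rewrite addnS => a b; rewrite ltnS cfB cf_hcomp; case: eqP => [_|ne ab]; rewrite ?subrr //.
  by rewrite subr0; apply: hp; rewrite ltn_neqAle ab andbT; apply/eqP.
apply: idealD => //; last exact: hk.
rewrite hcompE; apply: ideal_sum => // -[a /= ha] _; apply: idealM => //.
set a1 := minn a d; have [l lE] : exists l, (a = a1 + l)%N by exists (a - a1)%N; lia.
have E : x ^+ a * y ^+ (d + k - a) = (x ^+ l * y ^+ (k - l)) * (x ^+ a1 * y ^+ (d - a1)).
  rewrite mulrACA -!exprD; congr (_ ^+ _ * _ ^+ _); lia.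
have a1d : (a1 <= d)%N by lia.
have [f If [g mg fgE]] := h _ a1d.
rewrite E -fgE mulrDr; apply: idealD => //; first exact: idealM.
apply: hk; rewrite addnS addnC -addnS; apply: mpowM => //; apply: mpow_mon; lia.
Qed.

End Monomials.

(** * The action on polynomials *)

HB.lock Definition act (R : realType) (g : 'M[R[i]]_2) (p : {mpoly R[i][2]}) :
  {mpoly R[i][2]} := poly_act g p.

Section Action.
Variable R : realType.
Local Notation C := R[i].
Local Notation S := {mpoly C[2]}.
Local Notation x := (vx R).
Local Notation y := (vy R).
Implicit Types (I J X : set S) (p q f : S) (c : C) (g h : 'M[C]_2).

Lemma mx22P (A B : 'M[C]_2) : A 0 0 = B 0 0 -> A 0 1 = B 0 1 ->
  A 1 0 = B 1 0 -> A 1 1 = B 1 1 -> A = B.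
Proof.
have e0 (i : 'I_2) : i = 0 \/ i = 1 by case: i => -[|[|//]] h; [left|right]; exact: val_inj.
by move=> h1 h2 h3 h4; apply/matrixP => i j; case: (e0 i) => ->; case: (e0 j) => ->.
Qed.

Lemma mulmx_col2 m (A : 'M[C]_(m, 2)) n (B : 'M[C]_(2, n)) i j :
  (A *m B) i j = A i 0 * B 0 j + A i 1 * B 1 j.
Proof.
by rewrite mxE !big_ord_recl big_ord0 addr0; congr (_ + A _ _ * B _ _); exact: val_inj.
Qed.

Section Morphism.
Variable g : 'M[C]_2.
Local Notation act := (act g).

Lemma actD p q : act (p + q) = act p + act q. Proof. by rewrite act.unlock; exact: comp_mpolyD. Qed.
Lemma actB p q : act (p - q) = act p - act q. Proof. by rewrite act.unlock; exact: comp_mpolyB. Qed.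
Lemma act0 : act 0 = 0. Proof. by rewrite act.unlock; exact: comp_mpoly0. Qed.
Lemma act1 : act 1 = 1. Proof. by rewrite act.unlock; exact: comp_mpoly1. Qed.
Lemma actM p q : act (p * q) = act p * act q.
Proof. by rewrite act.unlock; exact: rmorphM (comp_mpoly _) p q. Qed.
Lemma actX p n : act (p ^+ n) = act p ^+ n.
Proof. by rewrite act.unlock; exact: rmorphXn (comp_mpoly _) n p. Qed.
Lemma actC c : act c%:MP = c%:MP. Proof. by rewrite act.unlock; exact: comp_mpolyC. Qed.
Lemma actZ c p : act (c *: p) = c *: act p. Proof. by rewrite act.unlock; exact: comp_mpolyZ. Qed.
Lemma act_sum (K : Type) (r : seq K) (P : pred K) (F : K -> S) :
  act (\sum_(k <- r | P k) F k) = \sum_(k <- r | P k) act (F k).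
Proof. by rewrite act.unlock; exact: raddf_sum. Qed.

Lemma act_is_additive : additive act. Proof. exact: actB. Qed.
Lemma act_is_multiplicative : multiplicative act.
Proof. by split; [exact: actM|exact: act1]. Qed.
HB.instance Definition _ := GRing.isAdditive.Build S S act act_is_additive.
HB.instance Definition _ := GRing.isMultiplicative.Build S S act act_is_multiplicative.

Lemma act_var (j : 'I_2) : act 'X_j = \sum_(i < 2) g i j *: 'X_i.
Proof. by rewrite act.unlock /poly_act comp_mpolyXU -tnth_nth tnth_mktuple. Qed.

Lemma actx : act x = (g 0 0)%:MP * x + (g 1 0)%:MP * y.
Proof. by rewrite vxE vyE act_var !big_ord_recl big_ord0 addr0 -!mul_mpolyC; congr (_ + (g _ _)%:MP * 'X_ _); exact: val_inj. Qed.
Lemma acty : act y = (g 0 1)%:MP * x + (g 1 1)%:MP * y.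
Proof. by rewrite vxE vyE act_var !big_ord_recl big_ord0 addr0 -!mul_mpolyC; congr (_ + (g _ _)%:MP * 'X_ _); exact: val_inj. Qed.

Lemma act_meval p (v : 'I_2 -> C) :
  (act p).@[v] = p.@[fun j => \sum_(i < 2) g i j * v i].
Proof.
rewrite act.unlock comp_mpoly_meval; apply: meval_eq => j; rewrite tnth_mktuple.
by rewrite raddf_sum; apply: eq_bigr => i _; rewrite /= mevalZ mevalXU.
Qed.

End Morphism.

Lemma act_monomial g p q a b :
  act g (p ^+ a * q ^+ b) = act g p ^+ a * act g q ^+ b.
Proof. by rewrite actM; congr (_ * _); exact: actX. Qed.

Lemma poly_actE : @poly_act R = @act R.
Proof. by rewrite act.unlock. Qed.

Lemma act_mpolyE g p :
  act g p = \sum_(m <- msupp p) p@_m *: (act g x ^+ m 0 * act g y ^+ m 1).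
Proof.
rewrite {1}[p]mpolyE act_sum; apply: eq_bigr => m _.
by rewrite actZ {2}(mnm2_eta m) mpolyX_xy act_monomial.
Qed.

Lemma act_lin g c c' p q :
  act g (c%:MP * p + c'%:MP * q) = c%:MP * act g p + c'%:MP * act g q.
Proof. by rewrite actD !actM !actC. Qed.

Lemma act_mul g h p : act (g *m h) p = act g (act h p).
Proof.
have Ex : act (g *m h) x = act g (act h x).
  rewrite (actx h) act_lin !actx acty !mulmx_col2 !mpolyCD !mpolyCM; ring.
have Ey : act (g *m h) y = act g (act h y).
  rewrite (acty h) act_lin !acty actx !mulmx_col2 !mpolyCD !mpolyCM; ring.
rewrite (act_mpolyE h) act_sum act_mpolyE; apply: eq_bigr => m _.
by rewrite actZ [in RHS]act_monomial Ex Ey.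
Qed.

Lemma act_id p : act 1%:M p = p.
Proof.
rewrite act_mpolyE [RHS]mpolyE; apply: eq_bigr => m _.
have -> : 'X_[m] = x ^+ m 0 * y ^+ m 1 by rewrite {1}(mnm2_eta m) mpolyX_xy.
by rewrite actx acty !mxE /= !mpolyC1 !mpolyC0 !mul1r !mul0r addr0 add0r.
Qed.

Lemma actK g p : g \in unitmx -> act (invmx g) (act g p) = p.
Proof. by move=> gu; rewrite -act_mul mulVmx // act_id. Qed.

Lemma actVK g p : g \in unitmx -> act g (act (invmx g) p) = p.
Proof. by move=> gu; rewrite -act_mul mulmxV // act_id. Qed.

Lemma act_homog g (m : 'X_{1..2}) : act g 'X_[m] \is (mdeg m).-homog.
Proof.
have hvar (j : 'I_2) : act g 'X_j \is 1.-homog.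
  rewrite act_var; apply: rpred_sum => i _; apply: dhomogZ.
  by rewrite dhomogX /= mdeg1.
rewrite (mnm2_eta m) mpolyX_xy act_monomial mdeg_mnm2 -[X in (X + _)%N]mul1n -[X in (_ + X)%N]mul1n.
by rewrite vxE vyE; apply: dhomogM; apply: dhomogMn; exact: hvar.
Qed.

Lemma hcomp_act g d p : hcomp d (act g p) = act g (hcomp d p).
Proof.
have E (m : 'X_{1..2}) : hcomp d (act g 'X_[m]) = if mdeg m == d then act g 'X_[m] else 0.
  case: eqP => [<-|/eqP h]; first by apply: pihomog_dE; exact: act_homog.
  by apply: pihomog_ne0 h _; exact: act_homog.
rewrite {1}[p]mpolyE act_sum /hcomp (raddf_sum (pihomog mdeg d)) pihomogE act_sum.
rewrite [RHS]big_mkcond; apply: eq_bigr => m _ /=.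
by rewrite !actZ -/(hcomp d _) hcompZ E; case: ifP => //; rewrite scaler0.
Qed.

Lemma mpow_act g k p : mpow k p -> mpow k (act g p).
Proof.
by move=> hp; apply: mpow_hcomp0 => d dk; rewrite hcomp_act (hcomp_mpow hp dk) act0.
Qed.

End Action.

(** * The groups as Hurwitz units *)

(** The quadruple [(a, b, c, d)] stands for the quaternion
    [(a + b i + c j + d k) / 2]; the doubled coordinates of the Hurwitz units
    are integers, so that computations with them are decided by evaluation. *)
Definition quad : Type := (int * int * int * int)%type.

Definition qmul2 (q r : quad) : quad :=
  let: (a, b, c, d) := q in let: (a', b', c', d') := r in
  (a * a' - b * b' - c * c' - d * d', a * b' + b * a' - d * c' + c * d',
   a * c' - b * d' + c * a' + d * b', a * d' + b * c' + d * a' - c * b').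

Definition qhalf (q : quad) : quad :=
  let: (a, b, c, d) := q in ((a %/ 2)%Z, (b %/ 2)%Z, (c %/ 2)%Z, (d %/ 2)%Z).

Definition qdouble (q : quad) : quad :=
  let: (a, b, c, d) := q in (2 * a, 2 * b, 2 * c, 2 * d).

Definition qmul q r := qhalf (qmul2 q r).
Definition qconj (q : quad) : quad := let: (a, b, c, d) := q in (a, - b, - c, - d).
(** Conjugation by [tau]; see [tau_twist]. *)
Definition qtwist (q : quad) : quad := let: (a, b, c, d) := q in (a, - b, - d, - c).
Definition qone : quad := (2, 0, 0, 0).

Definition hurwitz : seq quad :=
  [:: qone; (-2, 0, 0, 0); (0, 2, 0, 0); (0, -2, 0, 0);
      (0, 0, 2, 0); (0, 0, -2, 0); (0, 0, 0, 2); (0, 0, 0, -2)] ++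
  [seq (q, d) | q <- [seq (q, c) | q <- [seq (a, b) | a <- [:: 1; -1], b <- [:: 1; -1]],
                                   c <- [:: 1; -1]], d <- [:: 1; -1]].

(** Halving is exact on these products, so that [qmul] is the multiplication of
    quaternions. *)
Lemma hurwitz_mul :
  all (fun q => all (fun r => (qmul q r \in hurwitz) && (qmul2 q r == qdouble (qmul q r))) hurwitz) hurwitz.
Proof. by vm_compute. Qed.

Lemma hurwitz_conj : all (fun q => (qconj q \in hurwitz) && (qmul q (qconj q) == qone)) hurwitz.
Proof. by vm_compute. Qed.

Lemma hurwitz_twist : all (fun q => qtwist q \in hurwitz) hurwitz.
Proof. by vm_compute. Qed.

(** Products of two elements; three iterations give all products of eight. *)
Definition qproducts (s : seq quad) := undup [seq qmul q r | q <- s, r <- s].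

Definition qgen_i : quad := (0, 2, 0, 0).
Definition qgen_j : quad := (0, 0, 2, 0).
Definition qgen_s : quad := (1, -1, 1, -1).
Definition hurwitz_gens := [:: qone; qgen_i; qgen_j; qgen_s].

Lemma hurwitz_gens_sub : all (mem hurwitz) hurwitz_gens.
Proof. by vm_compute. Qed.

Lemma hurwitz_gens_span : all (mem (qproducts (qproducts (qproducts hurwitz_gens)))) hurwitz.
Proof. by vm_compute. Qed.

(** The products of [tau] with the two other generators of [G12]. *)
Definition refl_gens : seq quad := [:: qone; (-1, -1, -1, -1); (1, 1, -1, -1)].

Lemma refl_gens_sub : all (mem hurwitz) refl_gens.
Proof. by vm_compute. Qed.

Lemma refl_gens_span : all (mem (qproducts (qproducts (qproducts refl_gens)))) hurwitz.
Proof. by vm_compute. Qed.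

Section Groups.
Variable R : realType.
Local Notation C := R[i].
Local Notation iota := ('i%C : C).
Implicit Types (g h : 'M[C]_2) (q r : quad).

Lemma sqr_iota : iota ^+ 2 = -1. Proof. exact: sqr_i. Qed.

Definition qmx (q : quad) : 'M[C]_2 :=
  let: (a, b, c, d) := q in
  2^-1 *: mx22 (a%:~R + b%:~R * iota) (c%:~R + d%:~R * iota)
               (- c%:~R + d%:~R * iota) (a%:~R - b%:~R * iota).

Lemma qmx_mul2 q r : qmx (qdouble (qmul q r)) = qmx (qmul2 q r) ->
  qmx q *m qmx r = qmx (qmul q r).
Proof.
have H u : qmx (qdouble u) = 2 *: qmx u.
  case: u => -[[a b] c] d /=; apply: mx22P; rewrite !mxE /= ?intrM; ring.
have H2 : qmx (qmul2 q r) = 2 *: (qmx q *m qmx r).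
  case: q r => [[[a b] c] d] [[[a' b'] c'] d'] /=.
  have i2 := sqr_iota.
  by apply: mx22P; rewrite [RHS]mxE mulmx_col2 !mxE /= !(intrD, intrM, intrN); field: i2.
rewrite H H2 => e; apply: (@scalerI C _ 2); rewrite ?pnatr_eq0 //.
Qed.

Lemma qmx_mul q r : q \in hurwitz -> r \in hurwitz ->
  qmul q r \in hurwitz /\ qmx q *m qmx r = qmx (qmul q r).
Proof.
move=> hq hr; have /allP/(_ q hq)/allP/(_ r hr)/andP[h /eqP e] := hurwitz_mul.
by split=> //; apply: qmx_mul2; rewrite -e.
Qed.

Lemma qmx_one : qmx qone = 1%:M.
Proof. by apply: mx22P; rewrite !mxE /= ; field. Qed.

Lemma qmx_inj : injective qmx.
Proof.
move=> [[[a b] c] d] [[[a' b'] c'] d'] /= /(scalerI (_ : 2^-1 != 0)).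
rewrite invr_eq0 pnatr_eq0 => /(_ isT) /matrixP E.
have cE (u v : int) : u%:~R + v%:~R * iota = Complex (u%:~R : R) (v%:~R : R).
  by rewrite [RHS]complexE /= [iota * _]mulrC !rmorph_int.
have H (u v u' v' : int) : u%:~R + v%:~R * iota = u'%:~R + v'%:~R * iota -> u = u' /\ v = v'.
  by rewrite !cE => -[/intr_inj -> /intr_inj ->].
have := E 0 0; rewrite !mxE /= => /H[-> ->].
by have := E 0 1; rewrite !mxE /= => /H[-> ->].
Qed.

Definition hurwitz_mx : seq 'M[C]_2 := map qmx hurwitz.

Lemma hurwitz_mxM g h : g \in hurwitz_mx -> h \in hurwitz_mx -> g *m h \in hurwitz_mx.
Proof.
by move=> /mapP[q hq ->] /mapP[r hr ->]; have [qr ->] := qmx_mul hq hr; exact: map_f.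
Qed.

Lemma hurwitz_mxV g : g \in hurwitz_mx -> g \in unitmx /\ invmx g \in hurwitz_mx.
Proof.
move=> /mapP[q hq ->]; have /allP/(_ q hq)/andP[hc /eqP e] := hurwitz_conj.
have [_ m1] := qmx_mul hq hc; rewrite e qmx_one in m1.
have [u _] := mulmx1_unit m1; split=> //.
by rewrite -[invmx _]mulmx1 -m1 mulmxA mulVmx // mul1mx map_f.
Qed.

Lemma hurwitz_mx_uniq : uniq hurwitz_mx.
Proof. by rewrite map_inj_uniq //; exact: qmx_inj. Qed.

Lemma hurwitz_mx1 : 1%:M \in hurwitz_mx.
Proof. by rewrite -qmx_one map_f. Qed.

(** Each Hurwitz unit is a product of at most eight of the given generators. *)
Lemma hurwitz_ind (P : 'M[C]_2 -> Prop) (s : seq quad) :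
  all (mem hurwitz) s -> all (mem (qproducts (qproducts (qproducts s)))) hurwitz ->
  (forall g h, P g -> P h -> P (g *m h)) -> (forall q, q \in s -> P (qmx q)) ->
  forall g, g \in hurwitz_mx -> P g.
Proof.
move=> /allP sH /allP Hs PM Ps _ /mapP[q /Hs/= hq ->].
have step (s' : seq quad) : (forall r, r \in s' -> r \in hurwitz /\ P (qmx r)) ->
    forall r, r \in qproducts s' -> r \in hurwitz /\ P (qmx r).
  move=> hs' r; rewrite mem_undup => /allpairsP[[u v] /= [/hs'[hu Pu] /hs'[hv Pv] ->]].
  by have [h <-] := qmx_mul hu hv; split=> //; exact: PM.
suff : q \in hurwitz /\ P (qmx q) by case.
apply: (step _ _ _ hq); apply: (step _); apply: (step _) => r rs.
by split; [exact: sH|exact: Ps].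
Qed.

Lemma hurwitz_gen (P : 'M[C]_2 -> Prop) :
  (forall g h, P g -> P h -> P (g *m h)) -> P 1%:M ->
  P (qmx qgen_i) -> P (qmx qgen_j) -> P (qmx qgen_s) ->
  forall g, g \in hurwitz_mx -> P g.
Proof.
move=> PM P1 Pi Pj Ps; apply: (hurwitz_ind hurwitz_gens_sub hurwitz_gens_span PM).
by move=> q; rewrite !inE => /or4P[] /eqP -> //; rewrite qmx_one.
Qed.

End Groups.

(** * The reflection group *)

(** The third generator of the reflection group. It is an involution, and
    conjugation by it acts on quaternions by a signed permutation of
    coordinates. *)
HB.lock Definition tau (R : realType) : 'M[R[i]]_2 := mx22 0 (eps R) (eps R ^+ 7) 0.
Arguments tau.body : clear implicits.

Section ReflectionGroup.
Variable R : realType.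
Local Notation C := R[i].
Local Notation iota := ('i%C : C).
Local Notation rt2 := ((Num.sqrt 2 : R)%:C%C^-1 : C).
Local Notation tau := (tau R).
Implicit Types (g h : 'M[C]_2) (q r : quad).

Definition cis (t : R) : C := Complex (trigo.cos t) (trigo.sin t).

Lemma cisD t u : cis (t + u) = cis t * cis u.
Proof. by rewrite /cis trigo.cosD trigo.sinD /= [X in Complex _ X]addrC. Qed.

Lemma rt2_sqr : rt2 ^+ 2 = 2^-1.
Proof. by rewrite exprVn -rmorphXn /= sqr_sqrtr // rmorph_nat. Qed.

(** The angle [pi / 4] is handled by doubling it, and by the sign of its cosine. *)
Lemma epsE : eps R = rt2 * (1 + iota).
Proof.
have pi4 : 2 * trigo.pi / 8%:R = trigo.pi / 4 :> R by field.
have c_gt0 : 0 < trigo.cos (trigo.pi / 4 : R).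
  by apply: trigo.cos_gt0_pihalf; have := trigo.pi_gt0 R; lra.
have e2 : cis (trigo.pi / 4) * cis (trigo.pi / 4) = iota.
  by rewrite -cisD (_ : _ + _ = trigo.pi / 2); [rewrite /cis trigo.cos_pihalf trigo.sin_pihalf|field].
have [cc ss] : trigo.cos (trigo.pi / 4 : R) = trigo.sin (trigo.pi / 4)
    /\ (trigo.cos (trigo.pi / 4 : R)) ^+ 2 = 2^-1.
  move: e2 c_gt0; rewrite /cis; set c := trigo.cos _; set s := trigo.sin _.
  case=> h1 h2 c0; have h3 : (c - s) * (c + s) = 0 by lra.
  have h4 : c * s = 2^-1 by lra.
  have s0 : 0 < s by nra.
  have cs : c = s by nra.
  by split=> //; rewrite expr2 {2}cs.
have cE : trigo.cos (trigo.pi / 4 : R) = (Num.sqrt 2)^-1.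
  apply/eqP; rewrite -(@eqrXn2 _ 2) ?ltW ?invr_gt0 ?sqrtr_gt0 //.
  by rewrite ss exprVn sqr_sqrtr.
by rewrite /eps /zeta pi4 -cc cE -fmorphV; apply/eqP; rewrite eq_complex /=; apply/andP; split; apply/eqP; ring.
Qed.

Lemma eps_sqr : eps R ^+ 2 = iota.
Proof. by rewrite epsE exprMn rt2_sqr; field: (sqr_iota R). Qed.

Lemma eps4 : eps R ^+ 4 = -1.
Proof. by rewrite (exprM _ 2 2) eps_sqr sqr_iota. Qed.

Lemma eps8 : eps R ^+ 8 = 1.
Proof. by rewrite (exprM _ 4 2) eps4 sqrrN expr1n. Qed.

Lemma eps_neq0 : eps R != 0.
Proof. by apply: contraTneq isT => e0; have := eps8; rewrite e0 expr0n => /esym/eqP; rewrite oner_eq0. Qed.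

Lemma omega_sqr : omega R ^+ 2 = - 1 - omega R.
Proof.
have w3 : cis (2 * trigo.pi / 3) * cis (2 * trigo.pi / 3) * cis (2 * trigo.pi / 3) = 1.
  rewrite -!cisD (_ : _ + _ = 0 + trigo.pi *+ 2); last by field.
  by rewrite /cis trigo.cosD2pi trigo.sinD2pi trigo.cos0 trigo.sin0.
have w1 : cis (2 * trigo.pi / 3) != 1.
  apply: contraTneq isT => -[_ s0].
  have : 0 < trigo.sin (2 * trigo.pi / 3 : R).
    by apply: trigo.sin_gt0_pi; have := trigo.pi_gt0 R; lra.
  by rewrite s0 ltxx.
rewrite /omega /zeta -/(cis _); set w := cis _ in w3 w1 *.
have : (w - 1) * (w ^+ 2 + w + 1) = 0.
  by rewrite (_ : _ * _ = w * w * w - 1); [rewrite w3 subrr|ring].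
move/eqP; rewrite mulf_eq0 subr_eq0 (negPf w1) /= => /eqP e.
by apply/eqP; rewrite -subr_eq0 -e; apply/eqP; ring.
Qed.

Lemma tauE : tau = mx22 0 (eps R) (eps R ^+ 7) 0.
Proof. by rewrite tau.unlock. Qed.

Lemma tau_sqr : tau *m tau = 1%:M.
Proof.
by rewrite tauE; apply: mx22P; rewrite mulmx_col2 !mxE /= ?(mul0r, mulr0, addr0, add0r) // ?mulr0n -?exprS -?exprSr ?eps8.
Qed.

Lemma tau_unit : tau \in unitmx.
Proof. by have [] := mulmx1_unit tau_sqr. Qed.

Lemma tauK n (h : 'M[C]_(2, n)) : tau *m (tau *m h) = h.
Proof. by rewrite mulmxA tau_sqr mul1mx. Qed.

Lemma eps7 : eps R ^+ 7 = rt2 * (1 - iota).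
Proof.
have e6 : eps R ^+ 6 = - iota by rewrite (exprM _ 2 3) eps_sqr; ring: (sqr_iota R).
by rewrite exprSr e6 epsE; ring: (sqr_iota R).
Qed.

Lemma tau_twist q : tau *m qmx R q *m tau = qmx R (qtwist q).
Proof.
case: q => [[[a b] c] d]; have i2 := sqr_iota R; have e2 := eps_sqr.
have e8 := eps8.
by rewrite tauE; apply: mx22P; rewrite !mulmx_col2 !mxE /= ?rmorphN /=; ring: i2 e2 e8.
Qed.

Lemma det22 (g : 'M[C]_2) : \det g = g 0 0 * g 1 1 - g 0 1 * g 1 0.
Proof.
rewrite (expand_det_row g 0) !big_ord_recl big_ord0 /cofactor !det_mx11 !mxE /=.
rewrite (_ : lift 0 0 = 1 :> 'I_2); last exact: val_inj.
rewrite (_ : lift 1 0 = 0 :> 'I_2); last exact: val_inj.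
by rewrite expr0 expr1; ring.
Qed.

Lemma det_tau : \det tau = -1.
Proof. by rewrite tauE det22 !mxE /= mul0r sub0r -exprS eps8. Qed.

Lemma det_hurwitz g : g \in hurwitz_mx R -> \det g = 1.
Proof.
move: g; apply: hurwitz_gen => [g h dg dh||||].
- by rewrite det_mulmx dg dh mulr1.
- by rewrite det1.
- by rewrite det22 !mxE /=; field: (sqr_iota R).
- by rewrite det22 !mxE /=; field: (sqr_iota R).
- by rewrite det22 !mxE /=; field: (sqr_iota R).
Qed.

Lemma hurwitz_tau g : g \in hurwitz_mx R -> tau *m g *m tau \in hurwitz_mx R.
Proof.
move=> /mapP[q hq ->]; rewrite tau_twist map_f //.
exact: (allP hurwitz_twist).
Qed.

Lemma eps_rt2 : eps R * rt2 = 2^-1 * (1 + iota).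
Proof. by rewrite epsE mulrAC -expr2 rt2_sqr. Qed.

Lemma eps7_rt2 : eps R ^+ 7 * rt2 = 2^-1 * (1 - iota).
Proof. by rewrite eps7 mulrAC -expr2 rt2_sqr. Qed.

Lemma tau_gen1 : tau *m (rt2 *: mx22 1 (-1) (-1) (-1)) = qmx R (-1, -1, -1, -1).
Proof.
have e1 := eps_rt2; have e7 := eps7_rt2; set w := rt2 in e1 e7 *.
by rewrite tauE; apply: mx22P; rewrite !mulmx_col2 !mxE /=; first [ring: e1|ring: e7].
Qed.

Lemma tau_gen2 : tau *m (rt2 *: mx22 1 1 1 (-1)) = qmx R (1, 1, -1, -1).
Proof.
have e1 := eps_rt2; have e7 := eps7_rt2; set w := rt2 in e1 e7 *.
by rewrite tauE; apply: mx22P; rewrite !mulmx_col2 !mxE /=; first [ring: e1|ring: e7].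
Qed.
End ReflectionGroup.

Section GroupsAreHurwitz.
Variable R : realType.
Local Notation C := R[i].
Local Notation hs := (hurwitz_mx R).
Local Notation tau := (tau R).
Implicit Types (g h : 'M[C]_2).

Lemma G12_subgroup : is_subgroup (G12 R).
Proof.
split=> [g||g h|g] => [/(_ [set g | g \in unitmx])|K [[]]//|Gg Gh K KP|Gg K KP].
- apply; split=> [|_ [[->|->]|->]] /=.
  + split=> //=; [exact: unitmx1|by move=> g1 h1 u1 u2; rewrite unitmx_mul u1|by move=> g1; rewrite unitmx_inv].
  + by have := congr1 (fun M => M \in unitmx) (tau_gen1 R); rewrite unitmx_mul => /esym; rewrite (hurwitz_mxV (map_f _ _)).1 // => /esym/andP[].
  + by have := congr1 (fun M => M \in unitmx) (tau_gen2 R); rewrite unitmx_mul => /esym; rewrite (hurwitz_mxV (map_f _ _)).1 // => /esym/andP[].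
  + by rewrite -tauE; exact: tau_unit.
- by case: (KP) => -[_ _ KM _] _; apply: KM; [exact: Gg|exact: Gh].
- by case: (KP) => -[_ _ _ KV] _; apply: KV; exact: Gg.
Qed.

Let G12M g h : G12 R g -> G12 R h -> G12 R (g *m h).
Proof. by case: G12_subgroup => _ _ GM _; exact: GM. Qed.

Lemma G12_tau : G12 R tau.
Proof. by move=> K [_]; apply; right; rewrite tauE. Qed.

Lemma G12_hurwitz g : g \in hs -> G12 R g.
Proof.
have G1 : G12 R ((Num.sqrt 2)%:C%C^-1 *: mx22 1 (-1) (-1) (-1)) by move=> K [_]; apply; left; left.
have G2 : G12 R ((Num.sqrt 2)%:C%C^-1 *: mx22 1 1 1 (-1)) by move=> K [_]; apply; left; right.
move: g; apply: (hurwitz_ind refl_gens_sub refl_gens_span) => [|q]; first exact: G12M.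
rewrite !inE => /or3P[] /eqP ->.
- by rewrite qmx_one; case: G12_subgroup.
- by rewrite -tau_gen1; apply: G12M => //; exact: G12_tau.
- by rewrite -tau_gen2; apply: G12M => //; exact: G12_tau.
Qed.

(** Each generator of [G12] is a Hurwitz unit or [tau] times one, and [tau]
    normalises the Hurwitz units. *)
Lemma G12P g : G12 R g <-> (g \in hs \/ tau *m g \in hs).
Proof.
split; last first.
  case=> [|/G12_hurwitz Gg]; first exact: G12_hurwitz.
  by rewrite -[g](tauK); apply: G12M => //; exact: G12_tau.
apply: (_ : G12 R `<=` [set g | g \in hs \/ tau *m g \in hs]).
move=> g'; apply; split; last first.
  move=> _ [[->|->]|->] /=.
  - by right; rewrite tau_gen1 map_f.
  - by right; rewrite tau_gen2 map_f.
  - by right; rewrite -tauE tau_sqr hurwitz_mx1.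
have tht h : tau *m h \in hs -> h *m tau \in hs.
  by move/hurwitz_tau; rewrite tauK.
split=> /=.
- move=> h [/hurwitz_mxV[]//|/hurwitz_mxV[]]; rewrite unitmx_mul => /andP[] //.
- by left; exact: hurwitz_mx1.
- move=> h k [hh|hh] [hk|hk].
  + by left; exact: hurwitz_mxM.
  + right; rewrite (_ : _ *m _ = tau *m h *m tau *m (tau *m k)).
      by apply: hurwitz_mxM => //; exact: hurwitz_tau.
    by rewrite -!mulmxA (mulmxA tau tau) tau_sqr mul1mx.
  + by right; rewrite mulmxA; exact: hurwitz_mxM.
  + left; rewrite (_ : _ *m _ = h *m tau *m (tau *m k)).
      by apply: hurwitz_mxM => //; exact: tht.
    by rewrite -!mulmxA (mulmxA tau tau) tau_sqr mul1mx.
- move=> h [hh|hh]; first by left; have [] := hurwitz_mxV hh.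
  right; have [u hV] := hurwitz_mxV hh.
  suff -> : invmx h = invmx (tau *m h) *m tau by rewrite mulmxA; exact: hurwitz_tau.
  have hu : h \in unitmx by move: u; rewrite unitmx_mul => /andP[].
  by rewrite -[RHS]mulmx1 -(mulmxV hu) -!mulmxA (mulmxA tau) mulmxA mulVmx // mul1mx.
Qed.

(** The determinant is [1] on the Hurwitz units and [-1] on [tau]. *)
Lemma HP g : H R g <-> g \in hs.
Proof.
split=> [[/G12P[//|h] d]|h]; last by split; [exact: G12_hurwitz|exact: det_hurwitz].
have := det_hurwitz h; rewrite det_mulmx d det_tau mulr1 => /eqP.
by rewrite eq_sym -subr_eq0 opprK -mulr2n pnatr_eq0.
Qed.

Lemma H1 : H R 1%:M. Proof. by apply/HP; exact: hurwitz_mx1. Qed.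
Lemma HM g h : H R g -> H R h -> H R (g *m h).
Proof. by rewrite !HP; exact: hurwitz_mxM. Qed.
Lemma HV g : H R g -> H R (invmx g).
Proof. by rewrite !HP => /hurwitz_mxV[]. Qed.
Lemma H_unit g : H R g -> g \in unitmx.
Proof. by rewrite !HP => /hurwitz_mxV[]. Qed.
Lemma H_tau g : H R g -> H R (tau *m g *m tau).
Proof. by rewrite !HP; exact: hurwitz_tau. Qed.
Lemma H_gen (P : 'M[C]_2 -> Prop) :
  (forall g h, P g -> P h -> P (g *m h)) -> P 1%:M ->
  P (qmx R qgen_i) -> P (qmx R qgen_j) -> P (qmx R qgen_s) -> forall g, H R g -> P g.
Proof. by move=> PM P1 Pi Pj Ps g /HP; exact: hurwitz_gen. Qed.

Lemma H_qmx q : q \in hurwitz -> H R (qmx R q).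
Proof. by move=> hq; apply/HP; exact: map_f. Qed.

(** * The two cosets and their action on ideals *)

Definition sigma : set 'M[C]_2 := [set tau *m h | h in H R].

Lemma A_cosets : A R = [set H R; sigma].
Proof.
have lH g : H R g -> [set g *m h | h in H R] = H R.
  move=> Hg; apply/seteqP; split=> [_ [h Hh <-]|h Hh]; first exact: HM.
  by exists (invmx g *m h); [apply: HM => //; exact: HV|rewrite mulmxA mulmxV ?mul1mx //; exact: H_unit].
apply/seteqP; split=> [_ [g /G12P[/HP Hg|/HP Hg] ->]|_ [->|->]].
- by left; exact: lH.
- right; rewrite /sigma; apply/seteqP; split=> _ [h Hh <-].
    by exists (tau *m g *m h); [exact: HM|rewrite -mulmxA tauK].
  exists (invmx (tau *m g) *m h); first by apply: HM => //; exact: HV.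
  have gE : g = tau *m (tau *m g) by rewrite tauK.
  by rewrite {1}gE -mulmxA (mulmxA (tau *m g)) mulmxV ?mul1mx // H_unit.
- by exists 1%:M; [apply: G12_hurwitz; exact: hurwitz_mx1|rewrite lH //; exact: H1].
- by exists tau; [exact: G12_tau|].
Qed.

Lemma sigma_tau : sigma tau.
Proof. by exists 1%:M; [exact: H1|rewrite mulmx1]. Qed.

Lemma sigma_neqH : sigma <> H R.
Proof.
move=> e; have := sigma_tau; rewrite e => /HP/det_hurwitz/eqP.
by rewrite det_tau eq_sym -subr_eq0 opprK -mulr2n pnatr_eq0.
Qed.
End GroupsAreHurwitz.

Arguments sigma : clear implicits.

(** * Transport of ideals along the involution *)

Section Transport.
Variable R : realType.
Local Notation C := R[i].
Local Notation S := {mpoly C[2]}.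
Local Notation tau := (tau R).
Local Notation sigma := (sigma R).
Local Notation x := (vx R).
Local Notation y := (vy R).
Implicit Types (I J K X : set S) (p q f : S) (c : C) (g h : 'M[C]_2).

Definition H_stable I := forall h, H R h -> ideal_act h I = I.

Lemma ideal_actE g I : ideal_act g I = act g @` I.
Proof. by rewrite /ideal_act poly_actE. Qed.

Lemma stable_act I h p : H_stable I -> H R h -> I p -> I (act h p).
Proof. by move=> st Hh Ip; rewrite -(st h Hh) ideal_actE; exists p. Qed.

Lemma stable_intro I : (forall h p, H R h -> I p -> I (act h p)) -> H_stable I.
Proof.
move=> st h Hh; rewrite ideal_actE; apply/seteqP.
split=> [_ [p Ip <-]|p Ip]; first exact: st.
by exists (act (invmx h) p); [apply: st => //; exact: HV|rewrite actVK ?H_unit].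
Qed.

Definition tau_ideal I : set S := act tau @` I.

Lemma act_tauK p : act tau (act tau p) = p.
Proof. by rewrite -act_mul tau_sqr act_id. Qed.

Lemma tau_idealP I p : tau_ideal I p <-> I (act tau p).
Proof.
split=> [[q Iq <-]|Ip]; first by rewrite act_tauK.
by exists (act tau p); rewrite ?act_tauK.
Qed.

Lemma tau_idealK I : tau_ideal (tau_ideal I) = I.
Proof. by apply/seteqP; split=> p; rewrite !tau_idealP act_tauK. Qed.

Lemma coset_act_H I : H_stable I -> coset_act (H R) I = I.
Proof.
move=> st; apply/seteqP; split=> [p [h Hh]|p Ip]; first by rewrite st.
by exists 1%:M; [exact: H1|rewrite st //; exact: H1].
Qed.

(** The elements of the coset [tau H] differ by elements of [H], which preserve
    [I]. *)
Lemma coset_act_sigma I : H_stable I -> coset_act sigma I = tau_ideal I.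
Proof.
move=> st; rewrite /coset_act /ideal_act poly_actE.
apply/seteqP; split=> [_ [_ [h Hh <-] [q Iq <-]]|p Ip].
  by exists (act h q); [exact: stable_act|rewrite act_mul].
by exists tau => //; exact: sigma_tau.
Qed.

Lemma A_fixedP I : H_stable I -> (A_fixed R I <-> tau_ideal I = I).
Proof.
move=> st; rewrite /A_fixed /= A_cosets; split=> [fI|tI a [->|->]].
- by rewrite -coset_act_sigma // fI //; right.
- exact: coset_act_H.
- by rewrite coset_act_sigma.
Qed.

Lemma ideal_gen_act g X K : is_ideal K -> (forall p, X p -> K (act g p)) ->
  forall p, ideal_gen X p -> K (act g p).
Proof.
move=> idK XK p gp; apply: (gp [set q | K (act g q)]).
split=> [|q /XK//]; split=> [|q r|f q] /=.
- by rewrite act0; exact: ideal0.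
- by rewrite actD; exact: idealD.
- by rewrite actM; exact: idealM.
Qed.

Lemma tau_ideal_ideal I : is_ideal I -> is_ideal (tau_ideal I).
Proof.
move=> idI; split=> [|p q|f p]; rewrite !tau_idealP.
- by rewrite act0; exact: ideal0.
- by rewrite actD; exact: idealD.
- by rewrite actM; exact: idealM.
Qed.

Lemma nideal_ideal : is_ideal (nideal R).
Proof. exact: ideal_gen_ideal. Qed.

Lemma act_at0 g p : (act g p).@[fun=> 0] = p.@[fun=> 0].
Proof.
by rewrite act_meval; apply: meval_eq => j; rewrite big1 // => i _; rewrite mulr0.
Qed.

Lemma H_comp_tau h : H R h -> h *m tau = tau *m (tau *m h *m tau).
Proof. by move=> _; rewrite -mulmxA tauK. Qed.

Lemma nideal_tau p : nideal R p -> nideal R (act tau p).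
Proof.
apply: ideal_gen_act; first exact: nideal_ideal.
move=> f []; rewrite poly_actE => inv f0.
apply: sub_ideal_gen; rewrite /= poly_actE; split=> [h Hh|]; last by rewrite act_at0.
by rewrite -act_mul (H_comp_tau Hh) act_mul (inv _ (H_tau Hh)).
Qed.

Lemma nideal_H h p : H R h -> nideal R p -> nideal R (act h p).
Proof.
move=> Hh; apply: ideal_gen_act; first exact: nideal_ideal.
by move=> f finv; case: (finv); rewrite poly_actE => inv _; rewrite inv //; exact: sub_ideal_gen.
Qed.

(** The kernel of the projection from [I] onto [V(I)]. *)
Definition mIn I : set S := ideal_add (ideal_mul (maxideal R) I) (nideal R).

Lemma mIn_ideal I : is_ideal (mIn I).
Proof. by apply: ideal_add_ideal; [exact: ideal_gen_ideal|exact: nideal_ideal]. Qed.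

Lemma mIn_nideal I : nideal R `<=` mIn I.
Proof. apply: sub_ideal_addr; exact: ideal_gen_ideal. Qed.

Lemma mIn_mul I p q : mpow 1 p -> I q -> mIn I (p * q).
Proof.
move=> mp Iq; apply: (sub_ideal_addl nideal_ideal); apply: ideal_mul_gen => //.
exact/maxidealP.
Qed.

Lemma mIn_sub I K : is_ideal K -> (forall p q, mpow 1 p -> I q -> K (p * q)) ->
  nideal R `<=` K -> mIn I `<=` K.
Proof.
move=> idK IK nK; apply: ideal_add_min => //; apply: ideal_gen_min => //.
by move=> _ [p /maxidealP mp [q Iq <-]]; exact: IK.
Qed.

Lemma mIn_act g I J : (forall p, nideal R p -> nideal R (act g p)) ->
  (forall p, I p -> J (act g p)) -> forall p, mIn I p -> mIn J (act g p).
Proof.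
move=> gn gIJ p [q Iq [r nr <-]]; rewrite actD.
have idJ := mIn_ideal J.
apply: idealD => //; last by apply: mIn_nideal; exact: gn.
apply: ideal_gen_act Iq => // _ [a /maxidealP ma [b Ib <-]].
by rewrite actM; apply: mIn_mul; [exact: mpow_act|exact: gIJ].
Qed.

Lemma mIn_tau I p : mIn (tau_ideal I) p <-> mIn I (act tau p).
Proof.
split.
  by apply: mIn_act nideal_tau _ p => p; rewrite tau_idealP.
rewrite -{2}[p]act_tauK; apply: mIn_act nideal_tau _ _ => q.
by rewrite tau_idealP act_tauK.
Qed.

Lemma mIn_H I h p : H_stable I -> H R h -> mIn I p -> mIn I (act h p).
Proof.
move=> st Hh; apply: mIn_act => q; first exact: nideal_H.
exact: stable_act.
Qed.

(** Conjugation by [tau] is an automorphism of [H], and transports the functions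
    on [H] that realise the regular representation. *)
Lemma exceptional_tau I : exceptional R I -> exceptional R (tau_ideal I).
Proof.
move=> [[idI st [F []]]]; rewrite poly_actE => Flin Fact Fsurj Fker supp; split; last first.
  move=> v; set w := fun j : 'I_2 => \sum_(i < 2) tau i j * v i.
  have wv : (forall j, w j = 0) <-> (forall j, v j = 0).
    split=> h j; last by rewrite /w big1 // => i _; rewrite h mulr0.
    have w0 := h 0; have w1 := h 1; move: w0 w1.
    rewrite /w tauE !big_ord_recl !big_ord0 !mxE /= !mul0r !addr0 !add0r => /eqP.
    rewrite mulf_eq0 expf_eq0 (negPf (eps_neq0 R)) /= => /eqP v1 /eqP.
    rewrite mulf_eq0 (negPf (eps_neq0 R)) /= => /eqP v0.
    by case: j => -[|[|//]] hj; [rewrite -[RHS]v0|rewrite -[RHS]v1]; congr v; exact: val_inj.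
  rewrite -wv -supp; split=> vI f.
    by move=> If; rewrite -(act_meval tau f v); apply: vI; exists f.
  by rewrite tau_idealP => /vI; rewrite -(act_meval tau) act_tauK.
split; first exact: tau_ideal_ideal.
  apply: stable_intro => h p Hh; rewrite !tau_idealP -act_mul.
  rewrite (_ : tau *m h = (tau *m h *m tau) *m tau); last by rewrite -mulmxA tau_sqr mulmx1.
  by rewrite act_mul; apply: stable_act => //; exact: H_tau.
exists (fun p g => F (act tau p) (tau *m g *m tau)); rewrite poly_actE; split.
- by move=> a p q g Hg; rewrite actD actZ Flin //; exact: H_tau.
- move=> h p g Hh Hg; rewrite -act_mul.
  rewrite (_ : tau *m h = (tau *m h *m tau) *m tau); last by rewrite -mulmxA tau_sqr mulmx1.
  rewrite act_mul.
  apply: etrans (Fact _ (act tau p) _ (H_tau Hh) (H_tau Hg)) _.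
  have -> // : invmx (tau *m h *m tau) *m (tau *m g *m tau) = tau *m (invmx h *m g) *m tau.
  have hV : tau *m invmx h *m tau *m (tau *m h *m tau) = 1%:M.
    by rewrite -!mulmxA tauK (mulmxA (invmx h)) mulVmx ?H_unit // mul1mx tau_sqr.
  have u := H_unit (H_tau Hh).
  have -> : invmx (tau *m h *m tau) = tau *m invmx h *m tau.
    by rewrite -[RHS]mulmx1 -(mulmxV u) mulmxA hV mul1mx.
  by rewrite -!mulmxA tauK.
- move=> u; have [p pE] := Fsurj (fun g => u (tau *m g *m tau)).
  exists (act tau p) => g Hg; rewrite act_tauK pE; last exact: H_tau.
  by rewrite -!mulmxA tau_sqr mulmx1 tauK.
- move=> p; rewrite tau_idealP Fker; split=> h g Hg; first by apply: h; exact: H_tau.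
  by have := h _ (H_tau Hg); rewrite -!mulmxA tau_sqr mulmx1 tauK.
Qed.

Lemma exceptional_ideal I : exceptional R I -> is_ideal I.
Proof. by case=> -[]. Qed.

Lemma exceptional_stable I : exceptional R I -> H_stable I.
Proof. by case=> -[]. Qed.

Lemma exceptional_sub1 I : exceptional R I -> I `<=` mpow 1.
Proof.
move=> [_ supp] p Ip; apply/mpow1P.
exact: (proj2 (supp (fun=> 0)) (fun=> erefl)).
Qed.

(** The constants are the only invariants of the regular representation, so an
    invariant polynomial is constant modulo [I]; the constant is its value at
    the origin. *)
Lemma exceptional_nideal I : exceptional R I -> nideal R `<=` I.
Proof.
move=> excI; have [[idI st [F []]]] := excI.
rewrite poly_actE => Flin Fact Fsurj Fker supp.
apply: ideal_gen_min => // p []; rewrite poly_actE => inv p0.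
have cst q : (forall h, H R h -> act h q = q) ->
    forall g, H R g -> F q g = F q 1%:M.
  move=> qinv g Hg; rewrite -{1}(qinv g Hg) Fact // mulVmx //; exact: H_unit.
have c1 := cst 1 (fun h _ => act1 h); have cp := cst p inv.
have F10 : F 1 1%:M != 0.
  apply/eqP => F10; have : I 1 by apply/Fker => g Hg; rewrite c1.
  by move/(exceptional_sub1 excI) => /mpow1P; rewrite meval1 => /eqP; rewrite oner_eq0.
set k := F p 1%:M / F 1 1%:M.
have Ik : I (- k *: 1 + p).
  by apply/Fker => g Hg; rewrite Flin // c1 // cp // mulNr divfK // addNr.
have := exceptional_sub1 excI Ik; move/mpow1P.
rewrite mevalD mevalZ meval1 p0 addr0 mulr1 => /eqP; rewrite oppr_eq0 => /eqP k0.
by move: Ik; rewrite k0 oppr0 scale0r add0r.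
Qed.

(** An enumeration of [H] identifies [C[H]] with row vectors. *)
Lemma regular_coords I : quotient_regular I -> exists L : S -> 'rV[C]_24,
  [/\ L 0 = 0, {morph L : p q / p + q}, forall a, {morph L : p / a *: p},
      forall u, exists p, L p = u & forall p, I p <-> L p = 0].
Proof.
move=> [F [Flin Fact Fsurj Fker]].
have F0 g : H R g -> F 0 g = 0.
  by move=> Hg; have := Flin (-1) 0 0 g Hg; rewrite scaler0 addr0 mulN1r addNr.
pose hn (k : nat) := nth 1%:M (hurwitz_mx R) k.
have Hhn (k : 'I_24) : H R (hn k) by apply/HP/mem_nth; rewrite size_map.
exists (fun p => \row_k F p (hn k)); split.
- by apply/rowP => k; rewrite !mxE F0.
- by move=> p q; apply/rowP => k; rewrite !mxE -{1}[p]scale1r Flin // mul1r.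
- by move=> a p; apply/rowP => k; rewrite !mxE -[X in F X _]addr0 Flin // F0 // addr0.
- move=> u; have [p pE] := Fsurj (fun g => u 0 (inord (index g (hurwitz_mx R)))).
  exists p; apply/rowP => k; rewrite !mxE pE // /hn index_uniq ?hurwitz_mx_uniq ?size_map //.
  by congr (u 0 _); apply: val_inj; rewrite /= inordK.
- move=> p; rewrite Fker; split=> [h|/rowP h g /HP hg].
    by apply/rowP => k; rewrite !mxE h.
  have ik : (index g (hurwitz_mx R) < 24)%N by rewrite -index_mem size_map in hg.
  by have := h (Ordinal ik); rewrite !mxE /hn /= nth_index.
Qed.

(** * Counting the codimension of ideals *)

Definition spanned I n (b : 'I_n -> S) p : Prop :=
  exists c : 'rV[C]_n, I (p - \sum_k c 0 k *: b k).

Section Spanned.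
Variables (I : set S) (n : nat) (b : 'I_n -> S) (idI : is_ideal I).

Lemma spannedD p q : spanned I b p -> spanned I b q -> spanned I b (p + q).
Proof.
move=> [c cp] [d dq]; exists (c + d).
have -> : p + q - \sum_k (c + d) 0 k *: b k =
    (p - \sum_k c 0 k *: b k) + (q - \sum_k d 0 k *: b k).
  rewrite addrACA -opprD -big_split /=; congr (_ - _).
  by apply: eq_bigr => k _; rewrite mxE scalerDl.
exact: idealD.
Qed.

Lemma spannedZ a p : spanned I b p -> spanned I b (a *: p).
Proof.
move=> [c cp]; exists (a *: c).
have -> : a *: p - \sum_k (a *: c) 0 k *: b k = a *: (p - \sum_k c 0 k *: b k).
  rewrite scalerBr scaler_sumr; congr (_ - _).
  by apply: eq_bigr => k _; rewrite mxE scalerA.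
exact: idealZ.
Qed.

Lemma spanned_ideal p : I p -> spanned I b p.
Proof.
move=> Ip; exists 0; rewrite big1 ?subr0 // => k _; by rewrite mxE scale0r.
Qed.

Lemma spanned_mem k : spanned I b (b k).
Proof.
exists (delta_mx 0 k); rewrite (bigD1 k) //= big1 => [|l lk].
  by rewrite mxE !eqxx scale1r addr0 subrr; exact: ideal0.
by rewrite mxE (negPf lk) andbF scale0r.
Qed.

Lemma spanned_sum (K : Type) (r : seq K) (P : pred K) (F : K -> S) :
  (forall k, P k -> spanned I b (F k)) -> spanned I b (\sum_(k <- r | P k) F k).
Proof.
move=> h; apply: (big_ind (spanned I b)) => //; last exact: spannedD.
by apply: spanned_ideal; exact: ideal0.
Qed.
End Spanned.

(** The quotient by [I] has dimension at most [n]. *)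
Definition codim_le I n := exists b : 'I_n -> S, forall p, spanned I b p.

Section Codim24.
Variables (I J : set S) (n : nat).
Hypotheses (regI : quotient_regular I) (JI : J `<=` I) (Jn : codim_le J n).

(** The projections of the [b k] onto the quotient by [I] span it; when they are
    a basis, the coordinates of [p] decide both [I p] and [J p]. *)
Lemma codim_matrix : exists (L : S -> 'rV[C]_24) (M : 'M[C]_(n, 24)),
  [/\ forall p, I p <-> L p = 0, row_full M
    & forall p, exists2 c, L p = c *m M & (c = 0 -> J p)].
Proof.
have [L [L0 LD LZ Lsurj Lker]] := regular_coords regI.
have [b bP] := Jn.
have key p : exists2 c, L p = c *m (\matrix_k L (b k)) & (c = 0 -> J p).
  have [c cp] := bP p; exists c => [|c0]; last first.
    by move: cp; rewrite c0 big1 ?subr0 // => k _; rewrite mxE scale0r.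
  have /Lker := JI cp; rewrite LD -scaleN1r LZ scaleN1r => /eqP.
  rewrite subr_eq0 => /eqP ->; rewrite (big_morph L LD L0) mulmx_sum_row.
  by apply: eq_bigr => k _; rewrite LZ rowK.
exists L, (\matrix_k L (b k)); split=> //.
rewrite -sub1mx; apply/row_subP => k.
have [p <-] := Lsurj (row k 1%:M); have [c -> _] := key p; exact: submxMl.
Qed.

Lemma codim_ge24 : (24 <= n)%N.
Proof.
by have [L [M [_ /eqP Mf _]]] := codim_matrix; rewrite -Mf; exact: rank_leq_row.
Qed.

Lemma codim24_sub : n = 24 -> I `<=` J.
Proof.
move=> n24; have [L [M [Lker Mf key]]] := codim_matrix; move=> p /Lker Lp.
have [c cE] := key p; apply; move: cE; rewrite Lp => /esym/eqP.
have Mfree : row_free M by rewrite /row_free (eqP Mf) n24.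
by rewrite mulmx_free_eq0 // => /eqP.
Qed.
End Codim24.

Definition monomial (m : nat * nat) : S := x ^+ m.1 * y ^+ m.2.

Lemma codim_monomials I k (ms : seq (nat * nat)) : is_ideal I -> mpow k `<=` I ->
  (forall a b, (a + b < k)%N ->
     spanned I (fun l : 'I_(size ms) => monomial (nth (0, 0)%N ms l)) (x ^+ a * y ^+ b)) ->
  codim_le I (size ms).
Proof.
move=> idI kI h; eexists => p.
rewrite -(subrK (\sum_(d < k) hcomp d p) p); apply: spannedD => //.
  by apply: spanned_ideal; apply: kI; exact: mpow_hcomp.
apply: spanned_sum => // d _; rewrite hcompE; apply: spanned_sum => // a _.
by rewrite mul_mpolyC; apply: spannedZ => //; apply: h; have := ltn_ord d; have := ltn_ord a; lia.
Qed.

Lemma spanned_monomial I (ms : seq (nat * nat)) a b : is_ideal I -> (a, b) \in ms ->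
  spanned I (fun l : 'I_(size ms) => monomial (nth (0, 0)%N ms l)) (x ^+ a * y ^+ b).
Proof.
move=> idI; rewrite -index_mem => h.
have := spanned_mem (fun l : 'I_(size ms) => monomial (nth (0, 0)%N ms l)) idI (Ordinal h).
by rewrite /= nth_index // -index_mem.
Qed.

Definition exponents k : seq (nat * nat) :=
  [seq (a, d - a)%N | d <- iota 0 k, a <- iota 0 d.+1].

Lemma mem_exponents k a b : ((a, b) \in exponents k) = (a + b < k)%N.
Proof.
apply/allpairsPdep/idP => [[d [a' []]]|h].
  by rewrite !mem_iota => ? ? [-> ->]; lia.
by exists (a + b)%N, a; rewrite !mem_iota; split; [lia|lia|congr (_, _); lia].
Qed.

(** There are only 21 monomials of degree less than six. *)
Lemma exceptional_mpow6 I : exceptional R I -> ~ (mpow 6 `<=` I).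
Proof.
move=> excI h; have [[idI _ regI] _] := excI.
suff : (24 <= size (exponents 6))%N by [].
apply: (codim_ge24 regI (@subset_refl _ I)); apply: codim_monomials h _ => // a b ab.
by apply: spanned_monomial => //; rewrite mem_exponents.
Qed.

Lemma exceptional_basis I : exceptional R I -> exists b : 'I_24 -> S, basis_mod I b.
Proof.
move=> [[idI _ /regular_coords[L [L0 LD LZ Lsurj Lker]]] _].
have [b bE] := choice (fun k : 'I_24 => Lsurj (delta_mx 0 k)).
exists b => p; exists (L p).
have LB (c : 'rV_24) : L (p - \sum_k c 0 k *: b k) = L p - c.
  rewrite LD -scaleN1r LZ scaleN1r (big_morph L LD L0); congr (_ - _).
  rewrite [RHS]row_sum_delta; apply: eq_bigr => k _; by rewrite LZ bE.
split=> [|c]; first by apply/Lker; rewrite LB subrr.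
by move/Lker; rewrite LB => /eqP; rewrite subr_eq0 => /eqP.
Qed.

(** * Regularity of the involution *)

(** In the basis transported by [tau], the coordinates of [p] modulo the image
    of [I] are those of the image of [p] modulo [I]: the involution is given by
    coordinate functions. *)
Lemma regular_map_sigma (Z : set (set S)) : Z `<=` exceptional R ->
  regular_map Z (coset_act sigma).
Proof.
move=> Zexc I0 ZI0; have exc0 := Zexc _ ZI0.
have [b bI0] := exceptional_basis exc0.
pose b' k := act tau (b k).
have tr I p (c : 'rV[C]_24) : coset_act sigma I = tau_ideal I ->
    coset_act sigma I (p - \sum_k c 0 k *: b' k) <->
    I (act tau p - \sum_k c 0 k *: b k).
  move=> ->; rewrite tau_idealP actB act_sum.
  by rewrite (eq_bigr (fun k => c 0 k *: b k)) // => k _; rewrite actZ act_tauK.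
have basis I : Z I -> basis_mod I b -> basis_mod (coset_act sigma I) b'.
  move=> ZI bI p; have [c [cP cu]] := bI (act tau p); exists c.
  have sI := coset_act_sigma (exceptional_stable (Zexc _ ZI)).
  by split=> [|c']; rewrite tr //; exact: cu.
exists 24, b'; split; first exact: basis.
move=> p j.
exists 24, b, 1%N, (fun=> act tau p), 'X_(mxvec_index 0 j), 1; split=> //.
  by move=> c _; rewrite meval1 oner_neq0.
move=> I c ZI bI cI _; split; first exact: basis.
have sI := coset_act_sigma (exceptional_stable (Zexc _ ZI)).
exists (row 0 c); first by rewrite tr //; under eq_bigr do rewrite mxE; exact: cI.
by rewrite meval1 divr1 mevalXU mxvecE mxE.
Qed.

Lemma involution_sigma (Z : set (set S)) : Z `<=` exceptional R ->
  (forall I, Z I -> Z (tau_ideal I)) -> is_involution Z (coset_act sigma).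
Proof.
move=> Zexc Zt.
have sE I : Z I -> coset_act sigma I = tau_ideal I.
  by move=> /Zexc/exceptional_stable/coset_act_sigma.
have sZ I : Z I -> Z (coset_act sigma I) by move=> ZI; rewrite sE //; exact: Zt.
have sK I : Z I -> coset_act sigma (coset_act sigma I) = I.
  by move=> ZI; rewrite sE ?sE ?tau_idealK //; exact: Zt.
split=> //; split=> //; first exact: regular_map_sigma.
by exists (coset_act sigma); split=> //; exact: regular_map_sigma.
Qed.

End Transport.

(** * The twist by the involution flips the McKay graph *)

Section Twist.
Variable R : realType.
Local Notation C := R[i].
Local Notation S := {mpoly C[2]}.
Local Notation tau := (tau R).
Implicit Types (I J : set S) (h : 'M[C]_2).

Definition twist n (r : 'M[C]_2 -> 'M[C]_n) : 'M[C]_2 -> 'M[C]_n :=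
  fun h => r (tau *m h *m tau).

Lemma tau_conjK h : tau *m (tau *m h *m tau) *m tau = h.
Proof. by rewrite -!mulmxA tau_sqr mulmx1 tauK. Qed.

Lemma tau_conjM g h :
  tau *m (g *m h) *m tau = (tau *m g *m tau) *m (tau *m h *m tau).
Proof. by rewrite -!mulmxA tauK. Qed.

Lemma irr_twist n (r : 'M[C]_2 -> 'M[C]_n) : is_irr r -> is_irr (twist r).
Proof.
move=> [[r1 rM] n0 rW]; split=> //.
  split; first by rewrite /twist mulmx1 tau_sqr.
  by move=> g h Hg Hh; rewrite /twist tau_conjM rM //; exact: H_tau.
move=> W W0 Wl Wr; apply: rW => // h v Hh Wv.
by rewrite -[h]tau_conjK; apply: Wr => //; exact: H_tau.
Qed.

Lemma embeds_intro n (r : 'M[C]_2 -> 'M[C]_n) I J (f : 'cV[C]_n -> S) : linear f -> (forall v, I (f v)) ->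
  (forall h v, H R h -> J (f (r h *m v) - act h (f v))) ->
  (forall v, J (f v) -> v = 0) -> embeds_in_quotient r I J.
Proof.
move=> flin fI fH fJ.
pose f' : {linear 'cV[C]_n -> S} :=
  HB.pack_for {linear 'cV[C]_n -> S} f (GRing.isLinear.Build _ _ _ _ f flin).
by exists f'; rewrite poly_actE.
Qed.

Lemma act_tau_sub (p q : S) h :
  act tau (act tau p - act h (act tau q)) =
  p - act (tau *m h *m tau) q.
Proof.
by rewrite actB act_tauK (act_mul (tau *m h)) (act_mul tau h).
Qed.

(** The involution maps [V(I)] to [V] of the image of [I], and turns the action of
    [h] into that of [tau h tau]. *)
Lemma E_tau n (r : 'M[C]_2 -> 'M[C]_n) I : E r I -> E (twist r) (tau_ideal I).
Proof.
move=> [excI [f []]]; rewrite poly_actE => fI fH fJ; split; first exact: exceptional_tau.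
apply: (@embeds_intro _ (twist r) _ _ (fun v => act tau (f v))).
- by move=> a u v; rewrite linearP actD actZ.
- by move=> v; rewrite tau_idealP act_tauK.
- move=> h v Hh; apply/(mIn_tau I); rewrite act_tau_sub.
  by apply: fH; exact: H_tau.
- by move=> v /(mIn_tau I); rewrite act_tauK; exact: fJ.
Qed.

Lemma E_iso n m (r : 'M[C]_2 -> 'M[C]_n) (s : 'M[C]_2 -> 'M[C]_m) I : rep_iso r s -> E r I -> E s I.
Proof.
move=> [M [N [MN NM Ms]]] [excI [f []]]; rewrite poly_actE => fI fH fJ; split=> //.
apply: (@embeds_intro _ s _ _ (fun v => f (N *m v))).
- by move=> a u v; rewrite mulmxDr -scalemxAr linearP.
- by move=> v.
- move=> h v Hh; have -> : N *m (s h *m v) = r h *m (N *m v).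
    by rewrite -[s h]mulmx1 -MN (mulmxA (s h)) Ms // !mulmxA NM mul1mx.
  exact: fH.
- by move=> v /fJ Nv; rewrite -[v]mul1mx -MN -mulmxA Nv mulmx0.
Qed.

Lemma rep_iso_dim n m (r : 'M[C]_2 -> 'M[C]_n) (s : 'M[C]_2 -> 'M[C]_m) :
  rep_iso r s -> n = m.
Proof.
by move=> [M [N [MN NM _]]]; apply/eqP; rewrite eqn_leq (mulmx1_min MN) (mulmx1_min NM).
Qed.

Lemma rep_subP n m (r : 'M[C]_2 -> 'M[C]_n) (s : 'M[C]_2 -> 'M[C]_m) :
  rep_sub r s <-> exists (M : 'M[C]_(m, n)) (L : 'M[C]_(n, m)),
    L *m M = 1%:M /\ forall h, H R h -> s h *m M = M *m r h.
Proof.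
split=> [[M rM MH]|[M [L [LM MH]]]].
  have /row_fullP[L LM] : row_full M by rewrite /row_full rM.
  by exists M, L.
by exists M => //; apply/eqP; change (row_full M); apply/row_fullP; exists L.
Qed.

Lemma tens_id m n : (1%:M : 'M[C]_m) *t (1%:M : 'M[C]_n) = 1%:M.
Proof.
apply/matrixP => k l; case: (mxtens_indexP k) => i j; case: (mxtens_indexP l) => i' j'.
rewrite tensmxE !mxE (can_eq (@mxtens_indexK m n)) xpair_eqE.
by case: eqP; case: eqP; rewrite ?(mulr1, mulr0).
Qed.

(** The defining representation is isomorphic to its twist, by [tau] itself. *)
Lemma adjacent_twist n m (r : 'M[C]_2 -> 'M[C]_n) (s : 'M[C]_2 -> 'M[C]_m) :
  mckay_adjacent r s -> mckay_adjacent (twist r) (twist s).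
Proof.
move=> /rep_subP[M [L [LM MH]]]; apply/rep_subP.
pose T : 'M[C]_(n * 2) := 1%:M *t tau.
have TT : T *m T = 1%:M by rewrite tensmx_mul tau_sqr mulmx1 tens_id.
exists (T *m M), (L *m T); split.
  by rewrite -mulmxA (mulmxA T) TT mul1mx.
move=> h Hh; rewrite -mulmxA -(MH _ (H_tau Hh)) !mulmxA.
by rewrite /twist !tensmx_mul mul1mx mulmx1 -!mulmxA tauK.
Qed.

Lemma adjacent_iso n m n' m' (r : 'M[C]_2 -> 'M[C]_n) (s : 'M[C]_2 -> 'M[C]_m)
    (r' : 'M[C]_2 -> 'M[C]_n') (s' : 'M[C]_2 -> 'M[C]_m') :
  rep_iso r r' -> rep_iso s s' -> mckay_adjacent r s -> mckay_adjacent r' s'.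
Proof.
move=> [A [A' [AA' A'A AH]]] [B [B' [BB' B'B BH]]] /rep_subP[M [L [LM MH]]].
have B'H h : H R h -> B' *m s' h = s h *m B'.
  by move=> Hh; rewrite -[s' h]mulmx1 -BB' (mulmxA (s' h)) BH // !mulmxA B'B mul1mx.
pose A1 : 'M[C]_(n' * 2, n * 2) := A *t 1%:M.
pose A1' : 'M[C]_(n * 2, n' * 2) := A' *t 1%:M.
have A1K : A1' *m A1 = 1%:M by rewrite tensmx_mul A'A mulmx1 tens_id.
have A1H h : H R h -> (r' h *t h) *m A1 = A1 *m (r h *t h).
  by move=> Hh; rewrite !tensmx_mul AH // mul1mx mulmx1.
apply/rep_subP; exists (A1 *m M *m B'), (B *m L *m A1'); split.
  by rewrite -!mulmxA (mulmxA A1') A1K mul1mx (mulmxA L) LM mul1mx.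
move=> h Hh; rewrite !mulmxA A1H // -(mulmxA A1 (r h *t h)) MH //.
by rewrite -[RHS]mulmxA B'H // !mulmxA.
Qed.

Section Vertices.
Variable rho : forall v, 'M[C]_2 -> 'M[C]_(mckay_dim v).
Hypothesis rhoP : mckay_labelling rho.

Definition twists_to v w := rep_iso (twist (rho v)) (rho w).

Lemma twists_exists v : exists w, twists_to v w.
Proof.
have [[irr cl] _ _ _ _] := rhoP.
by have [w [vw _]] := cl _ _ (irr_twist (irr v)); exists w.
Qed.

Lemma twists_dim v w : twists_to v w -> mckay_dim v = mckay_dim w.
Proof. exact: rep_iso_dim. Qed.

Lemma twists_edge v w v' w' : twists_to v v' -> twists_to w w' ->
  mckay_edge v w -> mckay_edge v' w'.
Proof.
have [_ _ adj _ _] := rhoP.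
move=> vv ww /adj vw; apply/adj; exact: adjacent_iso vv ww (adjacent_twist vw).
Qed.

Lemma twists_neighbour v v' w : twists_to v v' -> mckay_edge v w ->
  exists w', [/\ twists_to w w', mckay_edge v' w' & mckay_dim w = mckay_dim w'].
Proof.
move=> vv vw; have [w' ww] := twists_exists w; exists w'; split=> //.
  exact: twists_edge vv ww vw.
exact: twists_dim.
Qed.

Lemma rep_iso_refl n (r s : 'M[C]_2 -> 'M[C]_n) :
  (forall h, H R h -> r h = s h) -> rep_iso r s.
Proof.
move=> rs; exists 1%:M, 1%:M; rewrite !mulmx1; split=> // h Hh.
by rewrite mulmx1 mul1mx rs.
Qed.

Lemma twists_rho0 : twists_to rho0 rho0.
Proof.
have [_ triv _ _ _] := rhoP.
by apply: rep_iso_refl => h Hh; rewrite /twist !triv //; exact: H_tau.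
Qed.

(** [rho2] is the only neighbour of [rho0], and [rho3] the only one of [rho2] of
    its dimension. *)
Lemma twists_rho2 : twists_to rho2 rho2.
Proof. by have [w' [ww]] := twists_neighbour (w := rho2) twists_rho0 isT; case: w' ww. Qed.

Lemma twists_rho3 : twists_to rho3 rho3.
Proof. by have [w' [ww]] := twists_neighbour (w := rho3) twists_rho2 isT; case: w' ww. Qed.

(** [tau] carries a semi-invariant [p] to a semi-invariant for the twisted
    character. *)
Lemma spans_copy_twist (p q : S) (c : C) (r s : 'M[C]_2 -> 'M[C]_1) :
  spans_copy p r -> spans_copy q s -> act tau p = c *: q -> c != 0 ->
  rep_iso (twist r) s.
Proof.
rewrite /spans_copy poly_actE => -[p0 pr] [q0 qs] pq c0; apply: rep_iso_refl => h Hh.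
apply/matrixP => i j; rewrite !ord1 /twist; apply/eqP; rewrite -subr_eq0.
have := congr1 (act tau) (pr _ (H_tau Hh)).
rewrite actZ -act_mul -!mulmxA tauK act_mul mulmxA pq actZ qs // => e.
have /(scalerI c0)/eqP : c *: (s h 0 0 *: q) = c *: (r (tau *m h *m tau) 0 0 *: q).
  by rewrite e scalerA mulrC -scalerA.
by rewrite eq_sym -subr_eq0 -scalerBl scaler_eq0 (negPf q0) orbF.
Qed.

End Vertices.
End Twist.

(** * Invariants and covariants *)

Section Forms.
Variable S : comNzRingType.
Variables X Y : S.

(** Digits are degrees. The forms [f6] and [f8] are invariants of [H]; the pairs
    [w5] and [w7] transform as [(X, Y)], and the triples [r4], [u] and [k], the
    last two of degree six, as [(X^2, X Y, Y^2)]. *)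
Definition f6 := X ^+ 5 * Y - X * Y ^+ 5.
Definition f8 := X ^+ 8 + 14 * (X ^+ 4 * Y ^+ 4) + Y ^+ 8.

Definition w5x := X ^+ 5 - 5 * (X * Y ^+ 4).
Definition w5y := Y ^+ 5 - 5 * (X ^+ 4 * Y).
Definition w7x := Y ^+ 7 + 7 * (X ^+ 4 * Y ^+ 3).
Definition w7y := - (X ^+ 7 + 7 * (X ^+ 3 * Y ^+ 4)).

Definition r4xx := 4 * (X * Y ^+ 3).
Definition r4yy := - (4 * (X ^+ 3 * Y)).
Definition r4xy := X ^+ 4 - Y ^+ 4.
Definition uxx := X ^+ 6 - 5 * (X ^+ 2 * Y ^+ 4).
Definition uyy := Y ^+ 6 - 5 * (X ^+ 4 * Y ^+ 2).
Definition uxy := - (2 * (X ^+ 5 * Y + X * Y ^+ 5)).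
Definition kxx := Y ^+ 6 + 3 * (X ^+ 4 * Y ^+ 2).
Definition kyy := X ^+ 6 + 3 * (X ^+ 2 * Y ^+ 4).
Definition kxy := - (4 * (X ^+ 3 * Y ^+ 3)).
End Forms.

Ltac ring_forms :=
  rewrite /f6 /f8 /w5x /w5y /w7x /w7y /r4xx /r4xy /r4yy /uxx /uxy /uyy /kxx /kxy /kyy; ring.

(** The substitution [s] maps [X], [Y] to [u (X - i Y)], [u (X + i Y)] with
    [2 u^2 = - i]; a form of degree [d] is multiplied by [u^d] when its
    arguments are, and the remaining identities have integral coefficients. *)
Section Substitution.
Variables (S : comNzRingType) (X Y I U : S).
Hypotheses (I2 : I ^+ 2 = -1) (U2 : 2 * U ^+ 2 = - I).
Let X' := U * (X - I * Y).
Let Y' := U * (X + I * Y).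

Let U4 : 4 * U ^+ 4 = -1.
Proof. by rewrite (_ : 4 * _ = (2 * U ^+ 2) ^+ 2); [rewrite U2 sqrrN|ring]. Qed.
Let U6 : 8 * U ^+ 6 = I.
Proof. by rewrite (_ : 8 * _ = (2 * U ^+ 2) ^+ 3); [rewrite U2; ring: I2|ring]. Qed.
Let U8 : 16 * U ^+ 8 = 1.
Proof. by rewrite (_ : 16 * _ = (4 * U ^+ 4) ^+ 2); [rewrite U4 sqrrN expr1n|ring]. Qed.

Let scale k l (a b c : S) : a = U ^+ (k + l) * (c * b) -> c * U ^+ l = 1 -> a = U ^+ k * b.
Proof. by move=> -> e; rewrite exprD -mulrA (mulrA _ c) (mulrC _ c) e mul1r. Qed.

Let sc2 : 2 * I * U ^+ 2 = 1. Proof. by rewrite mulrAC U2; ring: I2. Qed.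
Let sc4 : -4 * U ^+ 4 = 1. Proof. by rewrite mulNr U4 opprK. Qed.
Let sc6 : -8 * I * U ^+ 6 = 1. Proof. by rewrite mulrAC mulNr U6; ring: I2. Qed.

Lemma f6_s : f6 X' Y' = f6 X Y.
Proof.
by rewrite -[RHS]mul1r; apply: (scale (k := 0) (l := 6) (c := -8 * I)) sc6; rewrite /f6 /X' /Y'; ring: I2.
Qed.
Lemma f8_s : f8 X' Y' = f8 X Y.
Proof.
by rewrite -[RHS]mul1r; apply: (scale (k := 0) (l := 8) (c := 16)) U8; rewrite /f8 /X' /Y'; ring: I2.
Qed.

Lemma w5x_s : w5x X' Y' = U ^+ 1 * (w5x X Y - I * w5y X Y).
Proof. by apply: (scale (l := 4) (c := -4)) sc4; rewrite /w5x /w5y /X' /Y'; ring: I2. Qed.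
Lemma w5y_s : w5y X' Y' = U ^+ 1 * (w5x X Y + I * w5y X Y).
Proof. by apply: (scale (l := 4) (c := -4)) sc4; rewrite /w5x /w5y /X' /Y'; ring: I2. Qed.
Lemma w7x_s : w7x X' Y' = U ^+ 1 * (w7x X Y - I * w7y X Y).
Proof. by apply: (scale (l := 6) (c := -8 * I)) sc6; rewrite /w7x /w7y /X' /Y'; ring: I2. Qed.
Lemma w7y_s : w7y X' Y' = U ^+ 1 * (w7x X Y + I * w7y X Y).
Proof. by apply: (scale (l := 6) (c := -8 * I)) sc6; rewrite /w7x /w7y /X' /Y'; ring: I2. Qed.

Definition equiv_s (Fxx Fxy Fyy : S -> S -> S) :=
  [/\ Fxx X' Y' = U ^+ 2 * (Fxx X Y - 2 * I * Fxy X Y - Fyy X Y),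
      Fxy X' Y' = U ^+ 2 * (Fxx X Y + Fyy X Y)
    & Fyy X' Y' = U ^+ 2 * (Fxx X Y + 2 * I * Fxy X Y - Fyy X Y)].

Lemma r4_s : equiv_s (@r4xx S) (@r4xy S) (@r4yy S).
Proof.
by split; apply: (scale (l := 2) (c := 2 * I)) sc2; rewrite /r4xx /r4xy /r4yy /X' /Y'; ring: I2.
Qed.
Lemma u_s : equiv_s (@uxx S) (@uxy S) (@uyy S).
Proof.
by split; apply: (scale (l := 4) (c := -4)) sc4; rewrite /uxx /uxy /uyy /X' /Y'; ring: I2.
Qed.
Lemma k_s : equiv_s (@kxx S) (@kxy S) (@kyy S).
Proof.
by split; apply: (scale (l := 4) (c := -4)) sc4; rewrite /kxx /kxy /kyy /X' /Y'; ring: I2.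
Qed.
End Substitution.

(** The scalar by which [qgen_s] is a matrix with entries among [1], [i], [- i]. *)
HB.lock Definition us (R : realType) : R[i] := 2^-1 * (1 - 'i%C).

Section Covariants.
Variable R : realType.
Local Notation C := R[i].
Local Notation S := {mpoly C[2]}.
Local Notation x := (vx R).
Local Notation y := (vy R).
Local Notation iota := ('i%C : C).
Local Notation us := (us R).
Implicit Types (p q F G K : S) (g h : 'M[C]_2) (v : 'cV[C]_2) (V : 'M[C]_2).

(** The linear families of polynomials spanned by a pair and by a triple; an
    antisymmetric matrix goes to zero, so that [cov3] lives on symmetric ones. *)
Definition cov2 F G v : S := (v 0 0)%:MP * F + (v 1 0)%:MP * G.
Definition cov3 F K G V : S :=
  (V 0 0)%:MP * F + (V 0 1 + V 1 0)%:MP * K + (V 1 1)%:MP * G.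

Lemma cov2_linear F G : linear (cov2 F G).
Proof.
by move=> a u v; rewrite /cov2 !mxE -mul_mpolyC !mpolyCD !mpolyCM; ring.
Qed.

Lemma cov3_linear F K G : linear (cov3 F K G).
Proof.
by move=> a u v; rewrite /cov3 !mxE -mul_mpolyC !mpolyCD !mpolyCM; ring.
Qed.

Definition equiv2 F G := forall h, H R h -> forall v, cov2 F G (h *m v) = act h (cov2 F G v).
Definition equiv3 F K G := forall h, H R h ->
  forall V, cov3 F K G (h *m V *m h^T) = act h (cov3 F K G V).

(** Equivariance under one element, in terms of the members of the family. *)
Definition equiv2_at F G g :=
  act g F = (g 0 0)%:MP * F + (g 1 0)%:MP * G /\
  act g G = (g 0 1)%:MP * F + (g 1 1)%:MP * G.
Definition equiv3_at F K G g :=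
  [/\ act g F = (g 0 0 ^+ 2)%:MP * F + (2 * (g 0 0 * g 1 0))%:MP * K + (g 1 0 ^+ 2)%:MP * G,
      act g K = (g 0 0 * g 0 1)%:MP * F + (g 0 0 * g 1 1 + g 1 0 * g 0 1)%:MP * K
                + (g 1 0 * g 1 1)%:MP * G
    & act g G = (g 0 1 ^+ 2)%:MP * F + (2 * (g 0 1 * g 1 1))%:MP * K + (g 1 1 ^+ 2)%:MP * G].

Lemma equiv2_atP F G g v : equiv2_at F G g -> cov2 F G (g *m v) = act g (cov2 F G v).
Proof.
move=> [eF eG]; rewrite /cov2 actD !actM !actC eF eG.
rewrite !mxE !big_ord_recl !big_ord0 !addr0 (_ : lift _ _ = 1); last exact: val_inj.
by rewrite !mpolyCD !mpolyCM; ring.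
Qed.

Lemma equiv3_atP F K G g V : equiv3_at F K G g -> cov3 F K G (g *m V *m g^T) = act g (cov3 F K G V).
Proof.
move=> [eF eK eG]; rewrite /cov3 !actD !actM !actC eF eK eG.
rewrite !mulmx_col2 !mxE !mpolyCD !mpolyCM !(mpolyCD, mpolyCM, rmorphXn, rmorph_nat) /=.
ring.
Qed.

Lemma qmx_i : qmx R qgen_i = mx22 iota 0 0 (- iota).
Proof. by apply: mx22P; rewrite !mxE /=; field. Qed.
Lemma qmx_j : qmx R qgen_j = mx22 0 1 (-1) 0.
Proof. by apply: mx22P; rewrite !mxE /=; field. Qed.

Lemma qmx_s : qmx R qgen_s = mx22 us us (- iota * us) (iota * us).
Proof. by apply: mx22P; rewrite !mxE us.unlock /=; field: (sqr_iota R). Qed.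

Lemma us_sqr : 2 * us ^+ 2 = - iota.
Proof. by rewrite us.unlock; field: (sqr_iota R). Qed.

Lemma equiv2_gen F G : equiv2_at F G (qmx R qgen_i) -> equiv2_at F G (qmx R qgen_j) ->
  equiv2_at F G (qmx R qgen_s) -> equiv2 F G.
Proof.
move=> ei ej es h; move: h; apply: H_gen.
- by move=> g h eg eh v; rewrite -mulmxA eg eh act_mul.
- by move=> v; rewrite mul1mx act_id.
- by move=> v; exact: equiv2_atP.
- by move=> v; exact: equiv2_atP.
- by move=> v; exact: equiv2_atP.
Qed.

Lemma equiv3_gen F K G : equiv3_at F K G (qmx R qgen_i) -> equiv3_at F K G (qmx R qgen_j) ->
  equiv3_at F K G (qmx R qgen_s) -> equiv3 F K G.
Proof.
move=> ei ej es h; move: h; apply: H_gen.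
- move=> g h eg eh V; rewrite trmx_mul act_mul -eh -eg; congr cov3.
  by rewrite !mulmxA.
- by move=> V; rewrite trmx1 mulmx1 mul1mx act_id.
- by move=> V; exact: equiv3_atP.
- by move=> V; exact: equiv3_atP.
- by move=> V; exact: equiv3_atP.
Qed.

Let I : S := iota%:MP.
Let U : S := us%:MP.
Lemma I_sqr : I ^+ 2 = -1. Proof. by rewrite /I -rmorphXn /= sqr_iota rmorphN rmorph1. Qed.
Lemma U_sqr : 2 * U ^+ 2 = - I.
Proof. by rewrite /I /U -mpolyCN -us_sqr !expr2 !mpolyCM mpolyC_nat. Qed.

Lemma act_ix : act (qmx R qgen_i) x = I * x.
Proof. by rewrite actx qmx_i !mxE /= mpolyC0 mul0r addr0. Qed.
Lemma act_iy : act (qmx R qgen_i) y = - (I * y).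
Proof. by rewrite acty qmx_i !mxE /= mpolyC0 mul0r add0r mpolyCN mulNr. Qed.
Lemma act_jx : act (qmx R qgen_j) x = - y.
Proof. by rewrite actx qmx_j !mxE /= mpolyC0 mul0r add0r mpolyCN mpolyC1 mulN1r. Qed.
Lemma act_jy : act (qmx R qgen_j) y = x.
Proof. by rewrite acty qmx_j !mxE /= mpolyC0 mul0r addr0 mpolyC1 mul1r. Qed.
Lemma act_sx : act (qmx R qgen_s) x = U * (x - I * y).
Proof. by rewrite actx qmx_s !mxE /= mpolyCM mpolyCN /I /U; ring. Qed.
Lemma act_sy : act (qmx R qgen_s) y = U * (x + I * y).
Proof. by rewrite acty qmx_s !mxE /= mpolyCM /I /U; ring. Qed.

Lemma act_f6 g p q : act g (f6 p q) = f6 (act g p) (act g q).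
Proof. by rewrite /f6; ring. Qed.
Lemma act_f8 g p q : act g (f8 p q) = f8 (act g p) (act g q).
Proof. by rewrite /f8; ring. Qed.
Lemma act_w5x g p q : act g (w5x p q) = w5x (act g p) (act g q).
Proof. by rewrite /w5x; ring. Qed.
Lemma act_w5y g p q : act g (w5y p q) = w5y (act g p) (act g q).
Proof. by rewrite /w5y; ring. Qed.
Lemma act_w7x g p q : act g (w7x p q) = w7x (act g p) (act g q).
Proof. by rewrite /w7x; ring. Qed.
Lemma act_w7y g p q : act g (w7y p q) = w7y (act g p) (act g q).
Proof. by rewrite /w7y; ring. Qed.
Lemma act_r4xx g p q : act g (r4xx p q) = r4xx (act g p) (act g q).
Proof. by rewrite /r4xx; ring. Qed.
Lemma act_r4yy g p q : act g (r4yy p q) = r4yy (act g p) (act g q).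
Proof. by rewrite /r4yy; ring. Qed.
Lemma act_r4xy g p q : act g (r4xy p q) = r4xy (act g p) (act g q).
Proof. by rewrite /r4xy; ring. Qed.
Lemma act_uxx g p q : act g (uxx p q) = uxx (act g p) (act g q).
Proof. by rewrite /uxx; ring. Qed.
Lemma act_uyy g p q : act g (uyy p q) = uyy (act g p) (act g q).
Proof. by rewrite /uyy; ring. Qed.
Lemma act_uxy g p q : act g (uxy p q) = uxy (act g p) (act g q).
Proof. by rewrite /uxy; ring. Qed.
Lemma act_kxx g p q : act g (kxx p q) = kxx (act g p) (act g q).
Proof. by rewrite /kxx; ring. Qed.
Lemma act_kyy g p q : act g (kyy p q) = kyy (act g p) (act g q).
Proof. by rewrite /kyy; ring. Qed.
Lemma act_kxy g p q : act g (kxy p q) = kxy (act g p) (act g q).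
Proof. by rewrite /kxy; ring. Qed.

Definition act_forms := (act_f6, act_f8, act_w5x, act_w5y, act_w7x, act_w7y,
  act_r4xx, act_r4yy, act_r4xy, act_uxx, act_uyy, act_uxy, act_kxx, act_kyy, act_kxy).

Lemma invariant_gen p : act (qmx R qgen_i) p = p -> act (qmx R qgen_j) p = p ->
  act (qmx R qgen_s) p = p -> forall h, H R h -> act h p = p.
Proof.
move=> ei ej es; apply: H_gen => // [g h eg eh|]; last exact: act_id.
by rewrite act_mul eh eg.
Qed.

Lemma f6_inv h : H R h -> act h (f6 x y) = f6 x y.
Proof.
move: h; apply: invariant_gen.
- by rewrite act_f6 act_ix act_iy /f6; ring: I_sqr.
- by rewrite act_f6 act_jx act_jy /f6; ring.
- by rewrite act_f6 act_sx act_sy (f6_s _ _ I_sqr U_sqr).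
Qed.

Lemma f8_inv h : H R h -> act h (f8 x y) = f8 x y.
Proof.
move: h; apply: invariant_gen.
- by rewrite act_f8 act_ix act_iy /f8; ring: I_sqr.
- by rewrite act_f8 act_jx act_jy /f8; ring.
- by rewrite act_f8 act_sx act_sy (f8_s _ _ I_sqr U_sqr).
Qed.

Lemma equiv2_at_i F G : act (qmx R qgen_i) F = I * F -> act (qmx R qgen_i) G = - (I * G) ->
  equiv2_at F G (qmx R qgen_i).
Proof. by move=> eF eG; split; rewrite ?eF ?eG qmx_i !mxE /= /I ?mpolyC0 ?mpolyCN; ring. Qed.
Lemma equiv2_at_j F G : act (qmx R qgen_j) F = - G -> act (qmx R qgen_j) G = F ->
  equiv2_at F G (qmx R qgen_j).
Proof. by move=> eF eG; split; rewrite ?eF ?eG qmx_j !mxE /= ?mpolyC0 ?mpolyCN ?mpolyC1; ring. Qed.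
Lemma equiv2_at_s F G : act (qmx R qgen_s) F = U ^+ 1 * (F - I * G) ->
  act (qmx R qgen_s) G = U ^+ 1 * (F + I * G) -> equiv2_at F G (qmx R qgen_s).
Proof. by move=> eF eG; split; rewrite ?eF ?eG qmx_s !mxE /= /I /U ?mpolyCM ?mpolyCN; ring. Qed.

Lemma equiv3_at_i F K G : act (qmx R qgen_i) F = - F -> act (qmx R qgen_i) K = K ->
  act (qmx R qgen_i) G = - G -> equiv3_at F K G (qmx R qgen_i).
Proof.
move=> eF eK eG; split; rewrite ?eF ?eG ?eK qmx_i !mxE /= ?expr0n ?mulr0 ?mul0r ?mpolyC0 ?sqrrN ?sqr_iota ?mulrN ?mulNr -?expr2 ?sqr_iota ?addr0 ?mpolyCN ?mpolyC1 ?mpolyCM ?mpolyC1; try ring.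
Qed.
Lemma equiv3_at_j F K G : act (qmx R qgen_j) F = G -> act (qmx R qgen_j) K = - K ->
  act (qmx R qgen_j) G = F -> equiv3_at F K G (qmx R qgen_j).
Proof.
move=> eF eK eG; split; rewrite ?eF ?eG ?eK qmx_j !mxE /= ?expr0n ?mulr0 ?mul0r ?mpolyC0 ?sqrrN ?mulrN ?mulNr ?mulr1 ?expr1n ?addr0 ?add0r ?mpolyCN ?mpolyC1; ring.
Qed.
Lemma equiv3_at_s F K G : act (qmx R qgen_s) F = U ^+ 2 * (F - 2 * I * K - G) ->
  act (qmx R qgen_s) K = U ^+ 2 * (F + G) ->
  act (qmx R qgen_s) G = U ^+ 2 * (F + 2 * I * K - G) -> equiv3_at F K G (qmx R qgen_s).
Proof.
move=> eF eK eG; split; rewrite ?eF ?eG ?eK qmx_s !mxE /= /I /U !(mpolyCD, mpolyCM, mpolyCN, rmorphXn, rmorph_nat) /=; ring: I_sqr.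
Qed.

Lemma w1_equiv : equiv2 x y.
Proof.
apply: equiv2_gen.
- by apply: equiv2_at_i; rewrite ?act_ix ?act_iy.
- by apply: equiv2_at_j; rewrite ?act_jx ?act_jy.
- by apply: equiv2_at_s; rewrite ?act_sx ?act_sy expr1.
Qed.

Lemma w5_equiv : equiv2 (w5x x y) (w5y x y).
Proof.
apply: equiv2_gen.
- by apply: equiv2_at_i; rewrite act_forms act_ix act_iy /w5x /w5y; ring: I_sqr.
- by apply: equiv2_at_j; rewrite act_forms act_jx act_jy /w5x /w5y; ring.
- by apply: equiv2_at_s; rewrite act_forms act_sx act_sy ?(w5x_s _ _ I_sqr U_sqr) ?(w5y_s _ _ I_sqr U_sqr).
Qed.

Lemma w7_equiv : equiv2 (w7x x y) (w7y x y).
Proof.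
apply: equiv2_gen.
- by apply: equiv2_at_i; rewrite act_forms act_ix act_iy /w7x /w7y; ring: I_sqr.
- by apply: equiv2_at_j; rewrite act_forms act_jx act_jy /w7x /w7y; ring.
- by apply: equiv2_at_s; rewrite act_forms act_sx act_sy ?(w7x_s _ _ I_sqr U_sqr) ?(w7y_s _ _ I_sqr U_sqr).
Qed.

Lemma r2_equiv : equiv3 (x ^+ 2) (x * y) (y ^+ 2).
Proof.
apply: equiv3_gen.
- by apply: equiv3_at_i; rewrite ?actM ?actX ?act_ix ?act_iy; ring: I_sqr.
- by apply: equiv3_at_j; rewrite ?actM ?actX ?act_jx ?act_jy; ring.
- by apply: equiv3_at_s; rewrite ?actM ?actX ?act_sx ?act_sy; ring: I_sqr.
Qed.

Lemma r4_equiv : equiv3 (r4xx x y) (r4xy x y) (r4yy x y).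
Proof.
have [exx exy eyy] := r4_s x y I_sqr U_sqr.
apply: equiv3_gen.
- by apply: equiv3_at_i; rewrite act_forms act_ix act_iy /r4xx /r4xy /r4yy; ring: I_sqr.
- by apply: equiv3_at_j; rewrite act_forms act_jx act_jy /r4xx /r4xy /r4yy; ring.
- by apply: equiv3_at_s; rewrite act_forms act_sx act_sy.
Qed.

Lemma u_equiv : equiv3 (uxx x y) (uxy x y) (uyy x y).
Proof.
have [exx exy eyy] := u_s x y I_sqr U_sqr.
apply: equiv3_gen.
- by apply: equiv3_at_i; rewrite act_forms act_ix act_iy /uxx /uxy /uyy; ring: I_sqr.
- by apply: equiv3_at_j; rewrite act_forms act_jx act_jy /uxx /uxy /uyy; ring.
- by apply: equiv3_at_s; rewrite act_forms act_sx act_sy.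
Qed.

Lemma k_equiv : equiv3 (kxx x y) (kxy x y) (kyy x y).
Proof.
have [exx exy eyy] := k_s x y I_sqr U_sqr.
apply: equiv3_gen.
- by apply: equiv3_at_i; rewrite act_forms act_ix act_iy /kxx /kxy /kyy; ring: I_sqr.
- by apply: equiv3_at_j; rewrite act_forms act_jx act_jy /kxx /kxy /kyy; ring.
- by apply: equiv3_at_s; rewrite act_forms act_sx act_sy.
Qed.
End Covariants.

(** * Monomials in ideals containing the basic invariants *)

Section Membership.
Variable R : realType.
Local Notation C := R[i].
Local Notation S := {mpoly C[2]}.
Local Notation x := (vx R).
Local Notation y := (vy R).
Local Notation M a b := (x ^+ a * y ^+ b).
Local Notation F6 := (f6 x y).
Local Notation F8 := (f8 x y).
Local Notation W5x := (w5x x y).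
Local Notation W5y := (w5y x y).
Local Notation W7x := (w7x x y).
Local Notation W7y := (w7y x y).
Local Notation Uxx := (uxx x y).
Local Notation Uxy := (uxy x y).
Local Notation Uyy := (uyy x y).
Local Notation Kxx := (kxx x y).
Local Notation Kxy := (kxy x y).
Local Notation Kyy := (kyy x y).

Implicit Types (I J K : set S) (p q g : S).

Lemma ideal_lin2 I p q1 q2 g1 g2 : is_ideal I -> I g1 -> I g2 ->
  p = q1 * g1 + q2 * g2 -> I p.
Proof. by move=> idI I1 I2 ->; apply: idealD => //; exact: idealM. Qed.

(** Membership by an explicit combination of two elements; [n] clears a
    denominator. *)
Lemma ideal_comb n I p q1 q2 g1 g2 : is_ideal I -> I g1 -> I g2 ->
  n.+1%:R * p = q1 * g1 + q2 * g2 -> I p.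
Proof. by move=> idI I1 I2 /(ideal_lin2 idI I1 I2); exact: ideal_natK. Qed.

Lemma ideal_lin3 I p q1 q2 q3 g1 g2 g3 : is_ideal I -> I g1 -> I g2 -> I g3 ->
  p = q1 * g1 + q2 * g2 + q3 * g3 -> I p.
Proof.
move=> idI I1 I2 I3 ->; apply: idealD => //; last exact: idealM.
exact: ideal_lin2 I1 I2 _.
Qed.

Lemma ideal_mul_cancel I q g g' (c : C) : is_ideal I -> I (g + c%:MP * g') ->
  I (q * g') -> I (q * g).
Proof.
move=> idI Ig Ig'; rewrite (_ : q * g = q * (g + c%:MP * g') - c%:MP * (q * g')); last by ring.
by apply: idealB => //; exact: idealM.
Qed.

Lemma ideal_mon_le I (a b a' b' : nat) : is_ideal I -> (a <= a')%N -> (b <= b')%N ->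
  I (x ^+ a * y ^+ b) -> I (x ^+ a' * y ^+ b').
Proof.
move=> idI aa bb h; rewrite -(subnK aa) -(subnK bb) !exprD mulrACA.
exact: idealM.
Qed.

Lemma mpow_sub_mon I d : is_ideal I ->
  (forall a, (a <= d)%N -> I (M a (d - a))) -> mpow d `<=` I.
Proof.
move=> idI h p hp; rewrite [p]mpolyE big_seq; apply: (ideal_sum idI) => m hm.
apply: (idealZ idI); rewrite (mnm2_eta m) mpolyX_xy.
have dm : (d <= m 0%R + m 1%R)%N.
  rewrite leqNgt; apply: contraTN hm => lt.
  by rewrite -mcoeff_eq0 (mnm2_eta m); apply/eqP; exact: hp.
by apply: (ideal_mon_le idI _ _ (h (minn (m 0%R) d) _)); lia.
Qed.

Arguments ideal_lin2 {I p} q1 q2 {g1 g2}.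
Arguments ideal_comb n {I p} q1 q2 {g1 g2}.

Section Invariants68.
Variables (I : set S) (idI : is_ideal I) (I6 : I F6).

Lemma f6_shift a b : I (x ^+ a.+1 * y ^+ b.+4.+1) <-> I (x ^+ a.+4.+1 * y ^+ b.+1).
Proof.
have E : x ^+ a.+4.+1 * y ^+ b.+1 - x ^+ a.+1 * y ^+ b.+4.+1 = x ^+ a * y ^+ b * F6.
  rewrite /f6 -(addn4 a.+1) -(addn4 b.+1) -(addn1 a) -(addn1 b) !exprD; ring.
have h : I (x ^+ a.+4.+1 * y ^+ b.+1 - x ^+ a.+1 * y ^+ b.+4.+1) by rewrite E; exact: idealM.
split=> h'; first exact: ideal_congr h h'.
by apply: ideal_congr h' => //; rewrite -opprB; exact: idealN.
Qed.

Hypothesis I8 : I F8.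

(** [F6] exchanges [x^5 y] and [x y^5], so that a mixed monomial of high degree is
    congruent to a multiple of [x^5 y^5], 16 times which is in [I]; then [F8]
    takes care of the powers of [x] and [y]. *)
Lemma mpow13_sub : mpow 13 `<=` I.
Proof.
have A : I (M 5 5).
  apply: (ideal_natK idI (n := 15)).
  apply: (ideal_lin2 (x * y) (y ^+ 4 - x ^+ 4) idI I8 I6).
  by rewrite /f8 /f6; ring.
have B a b : (13 <= a.+1 + b.+1)%N -> I (x ^+ a.+1 * y ^+ b.+1).
  move=> ab; have [a5|a5] := leqP 4 a; have [b5|b5] := leqP 4 b.
  - by apply: ideal_mon_le A.
  - rewrite -(subnK a5) addn4; apply: (f6_shift (a - 4) b).1.
    by apply: ideal_mon_le A => //; lia.
  - rewrite -(subnK b5) addn4; apply: (f6_shift a (b - 4)).2.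
    by apply: ideal_mon_le A => //; lia.
  - lia.
apply: mpow_sub_mon => // -[|a] ha.
  rewrite subn0; apply: (ideal_lin3 (q1 := y ^+ 5) (q2 := - 14) (q3 := -1) idI I8 (B 3 8 isT) (B 7 4 isT)).
  by rewrite /f8; ring.
have [->|a12] := eqVneq a 12.
  rewrite subnn; apply: (ideal_lin3 (q1 := x ^+ 5) (q2 := - 14) (q3 := -1) idI I8 (B 8 3 isT) (B 4 7 isT)).
  by rewrite /f8; ring.
by rewrite (_ : 13 - a.+1 = (11 - a).+1)%N; [apply: B|]; lia.
Qed.
End Invariants68.

(** Covariants that an ideal may contain; [c] and the ratio of [a] and [b] are
    the parameters on which the ideal depends. *)
Definition has_w5 I (c : C) := I (W5x + c%:MP * W7x) /\ I (W5y + c%:MP * W7y).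
Definition has_w7 I := I W7x /\ I W7y.
Definition has_r6 I (a b : C) :=
  [/\ I (a%:MP * Uxx + b%:MP * Kxx), I (a%:MP * Uxy + b%:MP * Kxy)
    & I (a%:MP * Uyy + b%:MP * Kyy)].

Lemma W7x_mpow : mpow 7 W7x.
Proof.
rewrite /w7x; apply: (idealD (mpow_ideal R 7)).
  exact: mpow_y.
exact: mpow_nM.
Qed.

Lemma W7y_mpow : mpow 7 W7y.
Proof.
rewrite /w7y; apply: (idealN (mpow_ideal R 7)); apply: (idealD (mpow_ideal R 7)).
  exact: mpow_x.
exact: mpow_nM.
Qed.

Lemma has_r6_10 I : has_r6 I 1 0 <-> [/\ I Uxx, I Uxy & I Uyy].
Proof.
have e (p q : S) : I (1%:MP * p + 0%:MP * q) <-> I p by rewrite mpolyC1 mpolyC0 mul1r mul0r addr0.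
split=> -[h1 h2 h3].
  by split; [exact: (e Uxx Kxx).1 h1|exact: (e Uxy Kxy).1 h2|exact: (e Uyy Kyy).1 h3].
by split; [exact: (e Uxx Kxx).2 h1|exact: (e Uxy Kxy).2 h2|exact: (e Uyy Kyy).2 h3].
Qed.

Lemma has_r6_01 I : has_r6 I 0 1 <-> [/\ I Kxx, I Kxy & I Kyy].
Proof.
have e (p q : S) : I (0%:MP * p + 1%:MP * q) <-> I q by rewrite mpolyC1 mpolyC0 mul1r mul0r add0r.
split=> -[h1 h2 h3].
  by split; [exact: (e Uxx Kxx).1 h1|exact: (e Uxy Kxy).1 h2|exact: (e Uyy Kyy).1 h3].
by split; [exact: (e Uxx Kxx).2 h1|exact: (e Uxy Kxy).2 h2|exact: (e Uyy Kyy).2 h3].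
Qed.

(** A finite conjunction, to collect the monomials of one degree. *)
Fixpoint upto (P : nat -> Prop) n : Prop :=
  if n is n'.+1 then upto P n' /\ P n else P 0%N.

Lemma uptoP P n : upto P n -> forall a, (a <= n)%N -> P a.
Proof.
elim: n => [|n IH] /=; first by move=> h a; rewrite leqn0 => /eqP ->.
by move=> [h1 h2] a; rewrite leq_eqVlt => /orP[/eqP ->//|]; exact: IH.
Qed.

Section TypeA.
Variables (I : set S) (c : C) (idI : is_ideal I) (I6 : I F6) (I8 : I F8).
Hypothesis Ic : has_w5 I c.

(** Multiplication by [q] pushes the [W7] part into [I]. *)
Lemma w5_mul k q : mpow (k + 7) `<=` I -> mpow k q -> I (q * W5x) /\ I (q * W5y).
Proof.
move=> kI kq; have [Ix Iy] := Ic.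
by split; [apply: ideal_mul_cancel Ix _|apply: ideal_mul_cancel Iy _] => //;
  apply: kI; apply: mpowM => //; [exact: W7x_mpow|exact: W7y_mpow].
Qed.
End TypeA.

Lemma typeA_mpow8 I c : is_ideal I -> I F6 -> I F8 -> has_w5 I c -> mpow 8 `<=` I.
Proof.
move=> idI I6 I8 Ic; apply: (mpow_sub_ideal idI (mpow13_sub idI I6 I8)).
set K := ideal_add I (mpow 9).
have idK : is_ideal K by apply: ideal_add_ideal => //; exact: mpow_ideal.
have IK : I `<=` K by apply: sub_ideal_addl; exact: mpow_ideal.
have K6 := IK _ I6; have K8 := IK _ I8.
have Kc : has_w5 K c by case: Ic => h1 h2; split; exact: IK.
have w5K a b : (a + b = 3)%N -> K (x ^+ a * y ^+ b * W5x) /\ K (x ^+ a * y ^+ b * W5y).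
  move=> ab; apply: (w5_mul (k := 3) idK Kc); last by apply: mpow_mon; rewrite ab.
  by move=> p hp; apply: (sub_ideal_addr idI); apply: sub_mpow hp.
have [x30 y30] := w5K 3 0 erefl; have [x21 y21] := w5K 2 1 erefl.
have [x12 y12] := w5K 1 2 erefl; have [x03 y03] := w5K 0 3 erefl.
have K44 : K (M 4 4).
  apply: (ideal_natK idK (n := 23)).
  apply: (ideal_lin3 (q1 := 1) (q2 := -1) (q3 := -1) idK K8 x30 y03); rewrite /f8 /w5x /w5y; ring.
have K71 : K (M 7 1)
  by apply: (ideal_comb 3 (-1) (- (x ^+ 2)) idK y30 K6); ring_forms.
have K62 : K (M 6 2)
  by apply: (ideal_comb 3 (-1) (- (x * y)) idK y21 K6); ring_forms.
have K53 : K (M 5 3)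
  by apply: (ideal_comb 3 (-1) (- (y ^+ 2)) idK y12 K6); ring_forms.
have K17 : K (M 1 7)
  by apply: (ideal_comb 3 (-1) (y ^+ 2) idK x03 K6); ring_forms.
have K26 : K (M 2 6)
  by apply: (ideal_comb 3 (-1) (x * y) idK x12 K6); ring_forms.
have K35 : K (M 3 5)
  by apply: (ideal_comb 3 (-1) (x ^+ 2) idK x21 K6); ring_forms.
have K80 : K (M 8 0)
  by apply: (ideal_lin2 1 5 idK x30 K44); ring_forms.
have K08 : K (M 0 8)
  by apply: (ideal_lin2 1 5 idK y03 K44); ring_forms.
have Sd : upto (fun a => K (M a (8 - a))) 8
  := conj (conj (conj (conj (conj (conj (conj (conj K08 K17) K26) K35) K44) K53) K62) K71) K80.
by move=> a; exact: (uptoP Sd).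
Qed.

(** * The three types of ideals *)

Lemma spanned_congr I n (b : 'I_n -> S) (c : C) p r : is_ideal I ->
  I (p - c%:MP * r) -> spanned I b r -> spanned I b p.
Proof.
move=> idI Ip sr; rewrite -(subrK (c%:MP * r) p); apply: spannedD => //.
  exact: spanned_ideal.
by rewrite mul_mpolyC; exact: spannedZ.
Qed.

Lemma typeA_mul I c q : is_ideal I -> I F6 -> I F8 -> has_w5 I c -> mpow 1 q ->
  I (q * W5x) /\ I (q * W5y).
Proof.
by move=> idI I6 I8 Ic; apply: (w5_mul idI Ic); exact: typeA_mpow8 Ic.
Qed.

(** Beside the 15 monomials of degree less than five, nine monomials suffice. *)
Lemma typeA_codim I c : is_ideal I -> I F6 -> I F8 -> has_w5 I c -> codim_le I 24.
Proof.
move=> idI I6 I8 Ic; have I_8 := typeA_mpow8 idI I6 I8 Ic.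
have [hxx hxy] := typeA_mul idI I6 I8 Ic (mpow1_x R).
have [hyx hyy] := typeA_mul idI I6 I8 Ic (mpow1_y R).
pose ms := exponents 5 ++ [:: (1, 4); (2, 3); (3, 2); (4, 1); (4, 2); (3, 3); (2, 4); (4, 3); (3, 4)]%N.
apply: (@codim_monomials R I 8 ms idI I_8).
set Sp := spanned _ _.
have m51 : I (M 5 1)
  by apply: (ideal_comb 3 (-1) (-1) idI hxy I6); ring_forms.
have m15 : I (M 1 5)
  by apply: (ideal_comb 3 (-1) 1 idI hyx I6); ring_forms.
have m61 : I (M 6 1) by apply: ideal_mon_le m51.
have m52 : I (M 5 2) by apply: ideal_mon_le m51.
have m25 : I (M 2 5) by apply: ideal_mon_le m15.
have m16 : I (M 1 6) by apply: ideal_mon_le m15.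
have hxxx : I (x * (x * W5x)) := idealM idI _ hxx.
have hyyy : I (y * (y * W5y)) := idealM idI _ hyy.
have sM a b : (a, b) \in ms -> Sp (M a b) := spanned_monomial idI.
have s51 : Sp (M 5 1) := spanned_ideal _ m51.
have s15 : Sp (M 1 5) := spanned_ideal _ m15.
have s61 : Sp (M 6 1) := spanned_ideal _ m61.
have s52 : Sp (M 5 2) := spanned_ideal _ m52.
have s25 : Sp (M 2 5) := spanned_ideal _ m25.
have s16 : Sp (M 1 6) := spanned_ideal _ m16.
have s70 : Sp (M 7 0).
  apply: (spanned_congr (c := 5) (r := x ^+ 3 * y ^+ 4) idI _ (sM 3 4 isT)).
  by rewrite (_ : _ - _ = x * (x * W5x)); [exact: hxxx|rewrite ?rmorph_nat ?mpolyC1; ring_forms].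
have s07 : Sp (M 0 7).
  apply: (spanned_congr (c := 5) (r := x ^+ 4 * y ^+ 3) idI _ (sM 4 3 isT)).
  by rewrite (_ : _ - _ = y * (y * W5y)); [exact: hyyy|rewrite ?rmorph_nat ?mpolyC1; ring_forms].
have s60 : Sp (M 6 0).
  apply: (spanned_congr (c := 5) (r := x ^+ 2 * y ^+ 4) idI _ (sM 2 4 isT)).
  by rewrite (_ : _ - _ = x * W5x); [exact: hxx|rewrite ?rmorph_nat ?mpolyC1; ring_forms].
have s06 : Sp (M 0 6).
  apply: (spanned_congr (c := 5) (r := x ^+ 4 * y ^+ 2) idI _ (sM 4 2 isT)).
  by rewrite (_ : _ - _ = y * W5y); [exact: hyy|rewrite ?rmorph_nat ?mpolyC1; ring_forms].
have spC (k : C) p : Sp p -> Sp (k%:MP * p) by move=> h; rewrite mul_mpolyC; exact: spannedZ.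
have spD p q : Sp p -> Sp q -> Sp (p + q) by move=> hp hq; exact: spannedD.
have s50 : Sp (M 5 0).
  rewrite (_ : _ * _ = (W5x + c%:MP * W7x) + (5%:MP * (M 1 4) +
    ((- c)%:MP * (M 0 7) + (- 7 * c)%:MP * (M 4 3)))).
    apply: (spD _ _ (spanned_ideal _ Ic.1)); apply: (spD _ _ (spC _ _ (sM 1 4 isT))).
    exact: (spD _ _ (spC _ _ s07) (spC _ _ (sM 4 3 isT))).
  by rewrite /w5x /w7x; ring.
have s05 : Sp (M 0 5).
  rewrite (_ : _ * _ = (W5y + c%:MP * W7y) + (5%:MP * (M 4 1) +
    (c%:MP * (M 7 0) + (7 * c)%:MP * (M 3 4)))).
    apply: (spD _ _ (spanned_ideal _ Ic.2)); apply: (spD _ _ (spC _ _ (sM 4 1 isT))).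
    exact: (spD _ _ (spC _ _ s70) (spC _ _ (sM 3 4 isT))).
  by rewrite /w5y /w7y; ring.
move=> a b ab; have [lt|ge] := ltnP (a + b) 5.
  by apply: spanned_monomial => //; rewrite mem_cat mem_exponents lt.
have S5 : upto (fun a => Sp (M a (5 - a))) 5
  := (conj (conj (conj (conj (conj s05 (sM 1 4 isT)) (sM 2 3 isT)) (sM 3 2 isT)) (sM 4 1 isT)) s50).
have S6 : upto (fun a => Sp (M a (6 - a))) 6
  := (conj (conj (conj (conj (conj (conj s06 s15) (sM 2 4 isT)) (sM 3 3 isT)) (sM 4 2 isT)) s51) s60).
have S7 : upto (fun a => Sp (M a (7 - a))) 7
  := (conj (conj (conj (conj (conj (conj (conj s07 s16) s25) (sM 3 4 isT)) (sM 4 3 isT)) s52) s61) s70).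
have {ge ab} : (a + b \in [:: 5; 6; 7])%N by rewrite !inE; lia.
rewrite !inE => /or3P[].
- by move=> /eqP e; rewrite (_ : b = 5 - a)%N; [apply: (uptoP S5)|]; lia.
- by move=> /eqP e; rewrite (_ : b = 6 - a)%N; [apply: (uptoP S6)|]; lia.
- by move=> /eqP e; rewrite (_ : b = 7 - a)%N; [apply: (uptoP S7)|]; lia.
Qed.

Lemma typeB_mpow7 I : is_ideal I -> I F6 -> I F8 -> has_w7 I -> has_r6 I 1 0 -> mpow 7 `<=` I.
Proof.
move=> idI I6 I8 [h7x h7y] /has_r6_10[Ixx Ixy Iyy]; apply: (mpow_sub_ideal idI (mpow13_sub idI I6 I8)).
have m61 : I (M 6 1)
  by apply: (ideal_comb 3 (2 * x) (- x) idI I6 Ixy); ring_forms.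
have m25 : I (M 2 5)
  by apply: (ideal_comb 3 (- (2 * x)) (- x) idI I6 Ixy); ring_forms.
have m52 : I (M 5 2)
  by apply: (ideal_comb 3 (2 * y) (- y) idI I6 Ixy); ring_forms.
have m16 : I (M 1 6)
  by apply: (ideal_comb 3 (- (2 * y)) (- y) idI I6 Ixy); ring_forms.
have m43 : I (M 4 3)
  by apply: (ideal_comb 11 1 (- y) idI h7x Iyy); ring_forms.
have m34 : I (M 3 4)
  by apply: (ideal_comb 11 (-1) (- x) idI h7y Ixx); ring_forms.
have m07 : I (M 0 7)
  by apply: (ideal_lin2 y 5 idI Iyy m43); ring_forms.
have m70 : I (M 7 0)
  by apply: (ideal_lin2 x 5 idI Ixx m34); ring_forms.
have Sd : upto (fun a => I (M a (7 - a))) 7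
  := (conj (conj (conj (conj (conj (conj (conj m07 m16) m25) m34) m43) m52) m61) m70).
by move=> a ha; apply: (sub_ideal_addl (mpow_ideal R 8)); exact: (uptoP Sd).
Qed.

(** Beside the 21 monomials of degree less than six, three monomials suffice. *)
Lemma typeB_codim I : is_ideal I -> I F6 -> I F8 -> has_w7 I -> has_r6 I 1 0 -> codim_le I 24.
Proof.
move=> idI I6 I8 I7 Iu; have I_7 := typeB_mpow7 idI I6 I8 I7 Iu.
have [Ixx Ixy Iyy] := (has_r6_10 I).1 Iu.
pose ms := exponents 6 ++ [:: (4, 2); (3, 3); (2, 4)]%N.
apply: (@codim_monomials R I 7 ms idI I_7).
set Sp := spanned _ _.
have m51 : I (M 5 1)
  by apply: (ideal_comb 3 2 (- 1) idI I6 Ixy); ring_forms.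
have m15 : I (M 1 5)
  by apply: (ideal_comb 3 (- 2) (- 1) idI I6 Ixy); ring_forms.
have sM a b : (a, b) \in ms -> Sp (M a b) := spanned_monomial idI.
have s51 : Sp (M 5 1) := spanned_ideal _ m51.
have s15 : Sp (M 1 5) := spanned_ideal _ m15.
have s60 : Sp (M 6 0).
  apply: (spanned_congr (c := 5) (r := x ^+ 2 * y ^+ 4) idI _ (sM 2 4 isT)).
  by rewrite (_ : _ - _ = Uxx); [exact: Ixx|rewrite ?rmorph_nat ?mpolyC1; ring_forms].
have s06 : Sp (M 0 6).
  apply: (spanned_congr (c := 5) (r := x ^+ 4 * y ^+ 2) idI _ (sM 4 2 isT)).
  by rewrite (_ : _ - _ = Uyy); [exact: Iyy|rewrite ?rmorph_nat ?mpolyC1; ring_forms].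
move=> a b ab; have [lt|ge] := ltnP (a + b) 6.
  by apply: spanned_monomial => //; rewrite mem_cat mem_exponents lt.
have Sd : upto (fun a => Sp (M a (6 - a))) 6
  := (conj (conj (conj (conj (conj (conj s06 s15) (sM 2 4 isT)) (sM 3 3 isT)) (sM 4 2 isT)) s51) s60).
by rewrite (_ : b = 6 - a)%N; [apply: (uptoP Sd)|]; lia.
Qed.

Lemma typeC_mpow7 I : is_ideal I -> I F6 -> I F8 -> has_r6 I 0 1 -> mpow 7 `<=` I.
Proof.
move=> idI I6 I8 /has_r6_01[Ixx Ixy Iyy]; apply: (mpow_sub_ideal idI (mpow13_sub idI I6 I8)).
have m43 : I (M 4 3)
  by apply: (ideal_comb 3 (- x) 0 idI Ixy I6); ring_forms.
have m34 : I (M 3 4)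
  by apply: (ideal_comb 3 (- y) 0 idI Ixy I6); ring_forms.
have m07 : I (M 0 7)
  by apply: (ideal_lin2 y (- 3) idI Ixx m43); ring_forms.
have m70 : I (M 7 0)
  by apply: (ideal_lin2 x (- 3) idI Iyy m34); ring_forms.
have m52 : I (M 5 2)
  by apply: (ideal_comb 3 x y idI Ixx I6); ring_forms.
have m16 : I (M 1 6)
  by apply: (ideal_lin2 1 (- y) idI m52 I6); ring_forms.
have m61 : I (M 6 1)
  by apply: (ideal_comb 3 y (3 * x) idI Iyy I6); ring_forms.
have m25 : I (M 2 5)
  by apply: (ideal_lin2 1 (- x) idI m61 I6); ring_forms.
have Sd : upto (fun a => I (M a (7 - a))) 7
  := (conj (conj (conj (conj (conj (conj (conj m07 m16) m25) m34) m43) m52) m61) m70).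
by move=> a ha; apply: (sub_ideal_addl (mpow_ideal R 8)); exact: (uptoP Sd).
Qed.

(** As for [typeB_codim], with other sextic monomials. *)
Lemma typeC_codim I : is_ideal I -> I F6 -> I F8 -> has_r6 I 0 1 -> codim_le I 24.
Proof.
move=> idI I6 I8 Ik; have I_7 := typeC_mpow7 idI I6 I8 Ik.
have [Ixx Ixy Iyy] := (has_r6_01 I).1 Ik.
pose ms := exponents 6 ++ [:: (4, 2); (1, 5); (2, 4)]%N.
apply: (@codim_monomials R I 7 ms idI I_7).
set Sp := spanned _ _.
have m33 : I (M 3 3)
  by apply: (ideal_comb 3 (- 1) 0 idI Ixy I6); ring_forms.
have sM a b : (a, b) \in ms -> Sp (M a b) := spanned_monomial idI.
have s33 : Sp (M 3 3) := spanned_ideal _ m33.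
have s51 : Sp (M 5 1).
  apply: (spanned_congr (c := 1) (r := x ^+ 1 * y ^+ 5) idI _ (sM 1 5 isT)).
  by rewrite (_ : _ - _ = F6); [exact: I6|rewrite ?rmorph_nat ?mpolyC1; ring_forms].
have s60 : Sp (M 6 0).
  apply: (spanned_congr (c := - 3) (r := x ^+ 2 * y ^+ 4) idI _ (sM 2 4 isT)).
  by rewrite (_ : _ - _ = Kyy); [exact: Iyy|rewrite ?rmorph_nat ?mpolyC1; ring_forms].
have s06 : Sp (M 0 6).
  apply: (spanned_congr (c := - 3) (r := x ^+ 4 * y ^+ 2) idI _ (sM 4 2 isT)).
  by rewrite (_ : _ - _ = Kxx); [exact: Ixx|rewrite ?rmorph_nat ?mpolyC1; ring_forms].
move=> a b ab; have [lt|ge] := ltnP (a + b) 6.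
  by apply: spanned_monomial => //; rewrite mem_cat mem_exponents lt.
have Sd : upto (fun a => Sp (M a (6 - a))) 6
  := (conj (conj (conj (conj (conj (conj s06 (sM 1 5 isT)) (sM 2 4 isT)) s33) (sM 4 2 isT)) s51) s60).
by rewrite (_ : b = 6 - a)%N; [apply: (uptoP Sd)|]; lia.
Qed.
End Membership.

Arguments ideal_lin2 {R I p} q1 q2 {g1 g2}.
Arguments ideal_comb {R} n {I p} q1 q2 {g1 g2}.

(** * The covariants contained in an exceptional ideal *)

Section Exceptional.
Variable R : realType.
Local Notation C := R[i].
Local Notation S := {mpoly C[2]}.
Local Notation x := (vx R).
Local Notation y := (vy R).
Local Notation F6 := (f6 x y).
Local Notation F8 := (f8 x y).
Local Notation W5x := (w5x x y).
Local Notation W5y := (w5y x y).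
Local Notation R4xx := (r4xx x y).
Local Notation R4xy := (r4xy x y).
Local Notation R4yy := (r4yy x y).
Local Notation Uxx := (uxx x y).
Local Notation Uxy := (uxy x y).
Local Notation Uyy := (uyy x y).
Local Notation Kxx := (kxx x y).
Local Notation Kxy := (kxy x y).
Local Notation Kyy := (kyy x y).
Implicit Types (I J : set S) (p q g F G K : S) (h : 'M[C]_2).

Lemma W5x_mpow : mpow 5 W5x.
Proof.
rewrite /w5x -{2}(expr1 x).
by apply: (idealB (mpow_ideal R 5)); [exact: mpow_x|exact: mpow_nM].
Qed.
Lemma W5y_mpow : mpow 5 W5y.
Proof.
rewrite /w5y -{2}(expr1 y).
by apply: (idealB (mpow_ideal R 5)); [exact: mpow_y|exact: mpow_nM].
Qed.
Lemma R4_mpow : [/\ mpow 4 R4xx, mpow 4 R4xy & mpow 4 R4yy].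
Proof.
split; rewrite /r4xx /r4xy /r4yy.
- by rewrite -{1}(expr1 x); exact: mpow_nM.
- by apply: (idealB (mpow_ideal R 4)); [exact: mpow_x|exact: mpow_y].
- by rewrite -{1}(expr1 y); apply: (idealN (mpow_ideal R 4)); exact: mpow_nM.
Qed.
Lemma U_mpow : [/\ mpow 6 Uxx, mpow 6 Uxy & mpow 6 Uyy].
Proof.
split; rewrite /uxx /uxy /uyy.
- by apply: (idealB (mpow_ideal R 6)); [exact: mpow_x|exact: mpow_nM].
- apply: (idealN (mpow_ideal R 6)); apply: (idealM (mpow_ideal R 6)).
  rewrite -{1}(expr1 y) -{2}(expr1 x).
  by apply: (idealD (mpow_ideal R 6)); exact: mpow_mon.
- by apply: (idealB (mpow_ideal R 6)); [exact: mpow_y|exact: mpow_nM].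
Qed.
Lemma K_mpow : [/\ mpow 6 Kxx, mpow 6 Kxy & mpow 6 Kyy].
Proof.
split; rewrite /kxx /kxy /kyy.
- by apply: (idealD (mpow_ideal R 6)); [exact: mpow_y|exact: mpow_nM].
- by apply: (idealN (mpow_ideal R 6)); exact: mpow_nM.
- by apply: (idealD (mpow_ideal R 6)); [exact: mpow_x|exact: mpow_nM].
Qed.
Lemma F6_mpow : mpow 6 F6.
Proof.
rewrite /f6 -{2}(expr1 x) -{1}(expr1 y).
by apply: (idealB (mpow_ideal R 6)); exact: mpow_mon.
Qed.
Lemma F8_mpow : mpow 8 F8.
Proof.
apply: (idealD (mpow_ideal R 8)); last exact: mpow_y.
by apply: (idealD (mpow_ideal R 8)); [exact: mpow_x|exact: mpow_nM].
Qed.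

Lemma F6_nideal : nideal R F6.
Proof.
apply: sub_ideal_gen; rewrite /= poly_actE; split; first exact: f6_inv.
by apply/mpow1P; apply: sub_mpow F6_mpow.
Qed.
Lemma F8_nideal : nideal R F8.
Proof.
apply: sub_ideal_gen; rewrite /= poly_actE; split; first exact: f8_inv.
by apply/mpow1P; apply: sub_mpow F8_mpow.
Qed.

Lemma equiv2E F G h : equiv2 F G -> H R h -> equiv2_at F G h.
Proof.
move=> e Hh; split.
  have := e h Hh (\col_i (i == 0)%:R).
  by rewrite /cov2 !mulmx_col2 !mxE /= mpolyC1 mpolyC0 mul1r mul0r addr0 !mulr0 !addr0 !mulr1 => <-.
have := e h Hh (\col_i (i == 1)%:R).
by rewrite /cov2 !mulmx_col2 !mxE /= mpolyC1 mpolyC0 mul1r mul0r add0r !mulr0 !add0r !mulr1 => <-.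
Qed.

Lemma cov3_split F K G a b c : cov3 F K G (mx22 a b 0 c) = a%:MP * F + b%:MP * K + c%:MP * G.
Proof. by rewrite /cov3 !mxE /= addr0. Qed.

Lemma equiv3E F K G h : equiv3 F K G -> H R h -> equiv3_at F K G h.
Proof.
move=> e Hh; split.
- have := e h Hh (mx22 1 0 0 0); rewrite cov3_split mpolyC1 mpolyC0 mul1r !mul0r !addr0 => <-.
  rewrite /cov3 !mulmx_col2 !mxE /=; congr (_%:MP * _ + _%:MP * _ + _%:MP * _); ring.
- have := e h Hh (mx22 0 1 0 0); rewrite cov3_split mpolyC1 mpolyC0 mul1r !mul0r !addr0 add0r => <-.
  rewrite /cov3 !mulmx_col2 !mxE /=; congr (_%:MP * _ + _%:MP * _ + _%:MP * _); ring.
- have := e h Hh (mx22 0 0 0 1); rewrite cov3_split mpolyC1 mpolyC0 mul1r !mul0r !add0r => <-.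
  rewrite /cov3 !mulmx_col2 !mxE /=; congr (_%:MP * _ + _%:MP * _ + _%:MP * _); ring.
Qed.

(** Frobenius reciprocity for the regular representation: an equivariant map
    into it is determined by a linear functional. *)
Lemma regular_functional I : Y R I -> exists lam : S -> C,
  [/\ forall a p, lam (a%:MP * p) = a * lam p, forall p q, lam (p + q) = lam p + lam q
    & forall p, I p <-> forall h, H R h -> lam (act h p) = 0].
Proof.
move=> [idI st [F []]]; rewrite poly_actE => Flin Fact Fsurj Fker.
have F0 : F 0 1%:M = 0 by apply Fker; [exact: ideal0|exact: H1].
exists (fun p => F p 1%:M); split.
- by move=> a p; rewrite mul_mpolyC -[X in F X _]addr0 Flin ?F0 ?addr0 //; exact: H1.
- by move=> p q; rewrite -{1}[p]scale1r Flin ?mul1r //; exact: H1.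
- move=> p; split=> [Ip h Hh|hp].
    by move: (stable_act st Hh Ip) => /Fker; apply; exact: H1.
  apply/Fker => g Hg; rewrite -{1}(actVK p (H_unit Hg)) Fact // mulVmx ?H_unit //.
  by apply: hp; exact: HV.
Qed.

Lemma lin_dep m n (M : 'M[C]_(m, n)) : (n < m)%N -> exists2 u : 'rV_m, u != 0 & u *m M = 0.
Proof.
move=> nm; exists (nz_row (kermx M)); last exact/sub_kermxP/nz_row_sub.
rewrite nz_row_eq0 -mxrank_eq0 mxrank_ker -lt0n subn_gt0.
exact: leq_ltn_trans (rank_leq_col M) nm.
Qed.

(** With more covariants of one type than the type has coordinates, some
    combination is killed by the functional and all its translates. *)
Lemma covariant_mem n m (T : 'M[C]_2 -> 'M[C]_m) I (F : 'I_n -> 'I_m -> S) :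
  Y R I -> (m < n)%N ->
  (forall h k j, H R h -> act h (F k j) = \sum_i (T h i j)%:MP * F k i) ->
  exists2 u : 'rV[C]_n, u != 0 & forall j, I (\sum_k (u 0 k)%:MP * F k j).
Proof.
move=> YI mn FE; have [lam [lamZ lamD lamI]] := regular_functional YI.
have [u u0 uM] := lin_dep (\matrix_(k, j) lam (F k j)) mn.
have lam0 : lam 0 = 0 by rewrite -(mul0r (0 : S)) -mpolyC0 lamZ mul0r.
have lam_sum (K : finType) (p : K -> S) : lam (\sum_k p k) = \sum_k lam (p k).
  exact: (big_morph lam lamD lam0).
exists u => // j; apply/lamI => h Hh; rewrite act_sum.
rewrite (eq_bigr (fun k => \sum_i (u 0 k * T h i j)%:MP * F k i)); last first.
  move=> k _; rewrite actM actC FE // mulr_sumr.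
  by apply: eq_bigr => i _; rewrite mpolyCM mulrA.
rewrite exchange_big lam_sum big1 // => i _; rewrite lam_sum.
have /rowP/(_ i) := uM; rewrite !mxE => e0.
transitivity (T h i j * 0); last by rewrite mulr0.
rewrite -[X in _ = _ * X]e0 mulr_sumr.
by apply: eq_bigr => k _; rewrite lamZ !mxE mulrCA mulrA.
Qed.

Lemma covariant2_mem I (F G : 'I_3 -> S) : Y R I -> (forall k, equiv2 (F k) (G k)) ->
  exists a b c : C, [/\ ~ [/\ a = 0, b = 0 & c = 0],
    I (a%:MP * F 0 + b%:MP * F 1 + c%:MP * F 2%:R) &
    I (a%:MP * G 0 + b%:MP * G 1 + c%:MP * G 2%:R)].
Proof.
move=> YI eFG.
have sum2 (V : zmodType) (p : 'I_2 -> V) : \sum_i p i = p 0 + p 1.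
  by rewrite !big_ord_recl big_ord0 addr0; congr (_ + p _); exact: val_inj.
have sum3 (p : 'I_3 -> S) : \sum_k p k = p 0 + p 1 + p 2%:R.
  by rewrite !big_ord_recl big_ord0 addr0 addrA; congr (_ + p _ + p _); exact: val_inj.
have [|u u0 uI] := covariant_mem (T := id) (F := fun k j => if j == 0 then F k else G k) YI isT.
  move=> h k j Hh; have [eF eG] := equiv2E (eFG k) Hh; rewrite sum2 /=.
  by case: j => -[|[|//]] hj /=; rewrite ?eF ?eG; congr ((h _ _)%:MP * _ + (h _ _)%:MP * _); exact: val_inj.
exists (u 0 0), (u 0 1), (u 0 2%:R).
split; [|by have := uI 0; rewrite sum3|by have := uI 1; rewrite sum3].
move=> [z0 z1 z2]; move/eqP: u0; apply; apply/rowP => k; rewrite [RHS]mxE.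
have : [\/ k = 0, k = 1 | k = 2%:R].
  by case: k => -[|[|[|//]]] hk; [apply: Or31|apply: Or32|apply: Or33]; exact: val_inj.
by case=> ->.
Qed.

(** The matrix of the action on the symmetric square. *)
Definition sym_square (h : 'M[C]_2) : 'M[C]_3 := \matrix_(i, j)
  nth 0 (nth [::] [:: [:: h 0 0 ^+ 2; h 0 0 * h 0 1; h 0 1 ^+ 2];
    [:: 2 * (h 0 0 * h 1 0); h 0 0 * h 1 1 + h 1 0 * h 0 1; 2 * (h 0 1 * h 1 1)];
    [:: h 1 0 ^+ 2; h 1 0 * h 1 1; h 1 1 ^+ 2]] i) j.

Lemma covariant3_mem I (F K G : 'I_4 -> S) : Y R I -> (forall k, equiv3 (F k) (K k) (G k)) ->
  exists a b c d : C, [/\ ~ [/\ a = 0, b = 0, c = 0 & d = 0],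
    I (a%:MP * F 0 + b%:MP * F 1 + c%:MP * F 2%:R + d%:MP * F 3%:R),
    I (a%:MP * K 0 + b%:MP * K 1 + c%:MP * K 2%:R + d%:MP * K 3%:R) &
    I (a%:MP * G 0 + b%:MP * G 1 + c%:MP * G 2%:R + d%:MP * G 3%:R)].
Proof.
move=> YI eFG.
have sum4 (p : 'I_4 -> S) : \sum_k p k = p 0 + p 1 + p 2%:R + p 3%:R.
  by rewrite !big_ord_recl big_ord0 addr0 !addrA; congr (_ + p _ + p _ + p _); exact: val_inj.
have [|u u0 uI] := covariant_mem (T := sym_square)
    (F := fun k (j : 'I_3) => nth 0 [:: F k; K k; G k] j) YI isT.
  move=> h k j Hh; have [eF eK eG] := equiv3E (eFG k) Hh.
  rewrite !big_ord_recl big_ord0 addr0 !mxE /=.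
  by case: j => -[|[|[|//]]] hj /=; rewrite ?eF ?eK ?eG addrA.
exists (u 0 0), (u 0 1), (u 0 2%:R), (u 0 3%:R).
split; [|by have := uI 0; rewrite sum4|by have := uI 1; rewrite sum4|by have := uI 2%:R; rewrite sum4].
move=> [z0 z1 z2 z3]; move/eqP: u0; apply; apply/rowP => k; rewrite [RHS]mxE.
have : [\/ k = 0, k = 1, k = 2%:R | k = 3%:R].
  by case: k => -[|[|[|[|//]]]] hk; [apply: Or41|apply: Or42|apply: Or43|apply: Or44]; exact: val_inj.
by case=> ->.
Qed.
End Exceptional.

(** * Classification of the exceptional ideals *)

Section Classification.
Variable R : realType.
Local Notation C := R[i].
Local Notation S := {mpoly C[2]}.
Local Notation tau := (tau R).
Local Notation x := (vx R).
Local Notation y := (vy R).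
Local Notation M a b := (x ^+ a * y ^+ b).
Local Notation F6 := (f6 x y).
Local Notation F8 := (f8 x y).
Local Notation W5x := (w5x x y).
Local Notation W5y := (w5y x y).
Local Notation W7x := (w7x x y).
Local Notation W7y := (w7y x y).
Local Notation R4xx := (r4xx x y).
Local Notation R4xy := (r4xy x y).
Local Notation R4yy := (r4yy x y).
Local Notation Uxx := (uxx x y).
Local Notation Uxy := (uxy x y).
Local Notation Uyy := (uyy x y).
Local Notation Kxx := (kxx x y).
Local Notation Kxy := (kxy x y).
Local Notation Kyy := (kyy x y).
Implicit Types (I J : set S) (p q g F G K : S) (h : 'M[C]_2).

Lemma ideal_head I p q : is_ideal I -> I (p + q) -> I q -> I p.
Proof. by move=> idI Ipq Iq; rewrite -(addrK q p); exact: (idealB idI). Qed.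

(** An exceptional ideal contains no covariant of too low a degree: it would
    contain all forms of degree six, and have codimension at most 21. *)
Lemma no_degree1 I (a b c : C) : exceptional R I ->
  I (a%:MP * x + b%:MP * W5x + c%:MP * W7x) -> I (a%:MP * y + b%:MP * W5y + c%:MP * W7y) ->
  a = 0.
Proof.
move=> excI Ix Iy; apply: contrapT => /eqP a0; apply: (exceptional_mpow6 excI).
have idI := exceptional_ideal excI; have nI := exceptional_nideal excI.
apply: subset_trans (@sub_mpow R 6 1 isT) _.
apply: (mpow_sub_ideal idI (mpow13_sub idI (nI _ (@F6_nideal R)) (nI _ (@F8_nideal R)))).
set K := ideal_add I (mpow 2).
have idK : is_ideal K by apply: ideal_add_ideal => //; exact: mpow_ideal.
have IK : I `<=` K by apply: sub_ideal_addl; exact: mpow_ideal.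
have mK : mpow 2 `<=` K := sub_ideal_addr idI.
have m5K : mpow 5 `<=` K by apply: subset_trans mK; exact: sub_mpow.
have m7K : mpow 7 `<=` K by apply: subset_trans mK; exact: sub_mpow.
have Kx : K x.
  apply: (idealZK idK a0); rewrite -mul_mpolyC.
  apply: (ideal_head idK (q := b%:MP * W5x + c%:MP * W7x)); first by rewrite addrA; exact: IK.
  apply: (idealD idK); apply: (idealM idK).
    by apply: m5K; exact: W5x_mpow.
  by apply: m7K; exact: W7x_mpow.
have Ky : K y.
  apply: (idealZK idK a0); rewrite -mul_mpolyC.
  apply: (ideal_head idK (q := b%:MP * W5y + c%:MP * W7y)); first by rewrite addrA; exact: IK.
  apply: (idealD idK); apply: (idealM idK).
    by apply: m5K; exact: W5y_mpow.
  by apply: m7K; exact: W7y_mpow.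
case=> [_|[_|a' h]]; last by exfalso; lia.
  by rewrite expr0 mul1r subn0 expr1.
by rewrite subnn expr0 mulr1 expr1.
Qed.

(** Likewise in degrees two and four: the leading form of the combination would
    give all forms of degree two, or of degree five. *)
Lemma no_degree24 I (a b c d : C) : exceptional R I ->
  I (a%:MP * x ^+ 2 + b%:MP * R4xx + c%:MP * Uxx + d%:MP * Kxx) ->
  I (a%:MP * (x * y) + b%:MP * R4xy + c%:MP * Uxy + d%:MP * Kxy) ->
  I (a%:MP * y ^+ 2 + b%:MP * R4yy + c%:MP * Uyy + d%:MP * Kyy) ->
  a = 0 /\ b = 0.
Proof.
move=> excI Ixx Ixy Iyy.
have idI := exceptional_ideal excI; have nI := exceptional_nideal excI.
have I13 := mpow13_sub idI (nI _ (@F6_nideal R)) (nI _ (@F8_nideal R)).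
have [m4_xx m4_xy m4_yy] := R4_mpow R; have [u_xx u_xy u_yy] := U_mpow R; have [k_xx k_xy k_yy] := K_mpow R.
have cut k K F G Q (a' b' c' d' : C) : I (a'%:MP * F + b'%:MP * G + c'%:MP * K + d'%:MP * Q) ->
    mpow k (b'%:MP * G) -> mpow k K -> mpow k Q -> a' != 0 -> ideal_add I (mpow k) F.
  move=> IF mG mK mQ a0.
  have idA : is_ideal (ideal_add I (mpow k)) by apply: ideal_add_ideal => //; exact: mpow_ideal.
  apply: (idealZK idA a0); rewrite -mul_mpolyC.
  apply: (ideal_head idA (q := b'%:MP * G + (c'%:MP * K + d'%:MP * Q))).
    by rewrite !addrA; exact: (sub_ideal_addl (mpow_ideal R k) IF).
  apply: (sub_ideal_addr idI); apply: (idealD (mpow_ideal R k)) => //.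
  by apply: (idealD (mpow_ideal R k)); apply: (idealM (mpow_ideal R k)).
have a0 : a = 0.
  apply: contrapT => /eqP a0; apply: (exceptional_mpow6 excI).
  apply: subset_trans (@sub_mpow R 6 2 isT) _; apply: (mpow_sub_ideal idI I13).
  have m63 := @sub_mpow R 6 3 isT; have m43 := @sub_mpow R 4 3 isT.
  have idm := mpow_ideal R 3.
  have hxx := cut 3%N _ _ _ _ _ _ _ _ Ixx (idealM idm _ (m43 _ m4_xx)) (m63 _ u_xx) (m63 _ k_xx) a0.
  have hxy := cut 3%N _ _ _ _ _ _ _ _ Ixy (idealM idm _ (m43 _ m4_xy)) (m63 _ u_xy) (m63 _ k_xy) a0.
  have hyy := cut 3%N _ _ _ _ _ _ _ _ Iyy (idealM idm _ (m43 _ m4_yy)) (m63 _ u_yy) (m63 _ k_yy) a0.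
  case=> [_|[_|[_|a' h]]]; last by exfalso; lia.
  - by rewrite expr0 mul1r subn0.
  - by rewrite expr1 (_ : 2 - 1 = 1)%N // expr1.
  - by rewrite subnn expr0 mulr1.
split=> //; apply: contrapT => /eqP b0; apply: (exceptional_mpow6 excI).
apply: subset_trans (@sub_mpow R 6 5 isT) _; apply: (mpow_sub_ideal idI I13).
have idm := mpow_ideal R 6.
have sw F G K Q : I (a%:MP * F + b%:MP * G + c%:MP * K + d%:MP * Q) ->
    I (b%:MP * G + 0%:MP * 0 + c%:MP * K + d%:MP * Q).
  by rewrite a0 mpolyC0 !mul0r add0r addr0.
have z6 : mpow 6 ((0 : C)%:MP * 0 : S) by rewrite mulr0; exact: ideal0.
have hxx := cut 6%N _ _ _ _ _ _ _ _ (sw _ _ _ _ Ixx) z6 u_xx k_xx b0.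
have hxy := cut 6%N _ _ _ _ _ _ _ _ (sw _ _ _ _ Ixy) z6 u_xy k_xy b0.
have hyy := cut 6%N _ _ _ _ _ _ _ _ (sw _ _ _ _ Iyy) z6 u_yy k_yy b0.
set K := ideal_add I (mpow 6) in hxx hxy hyy *.
have idK : is_ideal K by apply: ideal_add_ideal => //; exact: mpow_ideal.
have m14 : K (M 1 4)
  by apply: (ideal_comb 3 y 0 idK hxx hxx); ring_forms.
have m23 : K (M 2 3)
  by apply: (ideal_comb 3 x 0 idK hxx hxx); ring_forms.
have m41 : K (M 4 1)
  by apply: (ideal_comb 3 (- x) 0 idK hyy hxx); ring_forms.
have m32 : K (M 3 2)
  by apply: (ideal_comb 3 (- y) 0 idK hyy hxx); ring_forms.
have m50 : K (M 5 0)
  by apply: (ideal_lin2 x 1 idK hxy m14); ring_forms.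
have m05 : K (M 0 5)
  by apply: (ideal_lin2 (- y) 1 idK hxy m41); ring_forms.
have Sd : upto (fun a => K (M a (5 - a))) 5
  := (conj (conj (conj (conj (conj m05 m14) m23) m32) m41) m50).
exact: (uptoP Sd).
Qed.

(** The products of [W5x], [W5y] by [x], [y] include the triple [U]; with the
    triple [K] they span the forms of degree six, using [F6]. *)
Lemma has_w5_r6 I c a b : is_ideal I -> I F6 -> I F8 -> has_w5 I c -> has_r6 I a b -> b != 0 ->
  mpow 6 `<=` I.
Proof.
move=> idI I6 I8 Ic [Ixx Ixy Iyy] b0; have I13 := mpow13_sub idI I6 I8.
have [hxx hxy] := typeA_mul idI I6 I8 Ic (mpow1_x R).
have [hyx hyy] := typeA_mul idI I6 I8 Ic (mpow1_y R).
have u_xx : I Uxx by rewrite (_ : Uxx = x * W5x); [exact: hxx|rewrite /uxx /w5x; ring].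
have u_yy : I Uyy by rewrite (_ : Uyy = y * W5y); [exact: hyy|rewrite /uyy /w5y; ring].
have u_xy : I Uxy.
  apply: (ideal_natK idI (n := 1)).
  by apply: (ideal_lin2 1 1 idI hxy hyx); rewrite /uxy /w5x /w5y; ring.
have kI F K : I F -> I (a%:MP * F + b%:MP * K) -> I K.
  move=> IF IK; apply: (idealZK idI b0); rewrite -mul_mpolyC -(addKr (a%:MP * F) (b%:MP * K)).
  by apply: (idealD idI) => //; apply: (idealN idI); exact: (idealM idI).
have k_xx := kI _ _ u_xx Ixx; have k_xy := kI _ _ u_xy Ixy; have k_yy := kI _ _ u_yy Iyy.
apply: (mpow_sub_ideal idI I13).
have m24 : I (M 2 4)
  by apply: (ideal_comb 7 1 (-1) idI k_yy u_xx); ring_forms.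
have m42 : I (M 4 2)
  by apply: (ideal_comb 7 1 (-1) idI k_xx u_yy); ring_forms.
have m60 : I (M 6 0)
  by apply: (ideal_lin2 1 5 idI u_xx m24); ring_forms.
have m06 : I (M 0 6)
  by apply: (ideal_lin2 1 5 idI u_yy m42); ring_forms.
have m33 : I (M 3 3)
  by apply: (ideal_comb 3 (-1) 0 idI k_xy I6); ring_forms.
have m51 : I (M 5 1)
  by apply: (ideal_comb 3 2 (-1) idI I6 u_xy); ring_forms.
have m15 : I (M 1 5)
  by apply: (ideal_comb 3 (- 2) (-1) idI I6 u_xy); ring_forms.
have Sd : upto (fun a => I (M a (6 - a))) 6
  := (conj (conj (conj (conj (conj (conj m06 m15) m24) m33) m42) m51) m60).
by move=> a' ha; apply: (sub_ideal_addl (mpow_ideal R 7)); exact: (uptoP Sd).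
Qed.

Lemma has_r6_scale I (c a b : C) : is_ideal I -> c != 0 -> has_r6 I (c * a) (c * b) -> has_r6 I a b.
Proof.
move=> idI c0 [Ixx Ixy Iyy].
have sc F K : I ((c * a)%:MP * F + (c * b)%:MP * K) -> I (a%:MP * F + b%:MP * K).
  by move=> h; apply: (idealZK idI c0); rewrite -mul_mpolyC mulrDr !mulrA -!mpolyCM.
by split; apply: sc.
Qed.

Lemma exceptional_w I : exceptional R I -> has_w7 I \/ exists c, has_w5 I c.
Proof.
move=> excI; have idI := exceptional_ideal excI.
pose F (k : 'I_3) := nth 0 [:: x; W5x; W7x] k; pose G (k : 'I_3) := nth 0 [:: y; W5y; W7y] k.
have eFG k : equiv2 (F k) (G k).
  case: k => -[|[|[|//]]] hk; rewrite /F /G /=; [exact: w1_equiv|exact: w5_equiv|exact: w7_equiv].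
have [a [b [c []]]] := covariant2_mem excI.1 eFG.
rewrite /F /G /= => nz Ix Iy.
have a0 := no_degree1 excI Ix Iy.
have [b0|b0] := eqVneq b 0.
  have c0 : c != 0 by apply/eqP => c0; exact: nz.
  have drop F1 F2 F3 : I (a%:MP * F1 + b%:MP * F2 + c%:MP * F3) -> I F3.
    by rewrite a0 b0 mpolyC0 !mul0r !add0r mul_mpolyC => /(idealZK idI c0).
  by left; split; [exact: drop Ix|exact: drop Iy].
have scale F1 F2 F3 : I (a%:MP * F1 + b%:MP * F2 + c%:MP * F3) -> I (F2 + (b^-1 * c)%:MP * F3).
  rewrite a0 mpolyC0 mul0r add0r => h; apply: (idealZK idI b0).
  by rewrite -mul_mpolyC mulrDr mulrA -mpolyCM mulrA mulfV // mul1r.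
by right; exists (b^-1 * c); split; [exact: scale Ix|exact: scale Iy].
Qed.

Lemma exceptional_r I : exceptional R I ->
  has_r6 I 1 0 \/ exists a b, b != 0 /\ has_r6 I a b.
Proof.
move=> excI; have idI := exceptional_ideal excI.
pose F (k : 'I_4) := nth 0 [:: x ^+ 2; R4xx; Uxx; Kxx] k.
pose K (k : 'I_4) := nth 0 [:: x * y; R4xy; Uxy; Kxy] k.
pose G (k : 'I_4) := nth 0 [:: y ^+ 2; R4yy; Uyy; Kyy] k.
have eFG k : equiv3 (F k) (K k) (G k).
  case: k => -[|[|[|[|//]]]] hk; rewrite /F /G /K /=.
  - exact: r2_equiv. - exact: r4_equiv. - exact: u_equiv. - exact: k_equiv.
have [a [b [c [d []]]]] := covariant3_mem excI.1 eFG.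
rewrite /F /G /K /= => nz Ixx Ixy Iyy.
have [a0 b0] := no_degree24 excI Ixx Ixy Iyy.
have Icd : has_r6 I c d.
  have drop F1 F2 F3 F4 : I (a%:MP * F1 + b%:MP * F2 + c%:MP * F3 + d%:MP * F4) ->
      I (c%:MP * F3 + d%:MP * F4) by rewrite a0 b0 mpolyC0 !mul0r !add0r.
  by split; [exact: drop Ixx|exact: drop Ixy|exact: drop Iyy].
have [d0|d0] := eqVneq d 0; last by right; exists c, d.
left; have c0 : c != 0 by apply/eqP => c0; exact: nz.
by apply: (has_r6_scale idI c0); rewrite mulr1 mulr0 -d0.
Qed.

(** The two families of exceptional ideals. *)
Definition typeAB I := (exists c, has_w5 I c) \/ (has_w7 I /\ has_r6 I 1 0).
Definition typeC I := exists a b, b != 0 /\ has_r6 I a b.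

Lemma exceptional_type I : exceptional R I -> typeAB I \/ typeC I.
Proof.
move=> excI; case: (exceptional_w excI) => [w7|w5]; last by left; left.
by case: (exceptional_r excI) => r; [left; right|right].
Qed.

Lemma typeC_w5 I c : exceptional R I -> typeC I -> ~ has_w5 I c.
Proof.
move=> excI [a [b [b0 Ir]]] Ic; have nI := exceptional_nideal excI.
apply: (exceptional_mpow6 excI).
exact: (has_w5_r6 (exceptional_ideal excI) (nI _ (@F6_nideal R)) (nI _ (@F8_nideal R)) Ic Ir b0).
Qed.

Lemma exceptional_sub I J : exceptional R I -> is_ideal J -> J `<=` I -> codim_le J 24 -> I `<=` J.
Proof. by move=> [[_ _ regI] _] idJ JI J24; exact: (codim24_sub regI JI J24). Qed.

Lemma exceptional_eq I J : exceptional R I -> exceptional R J -> codim_le (I `&` J) 24 -> I = J.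
Proof.
move=> excI excJ IJ24.
have idIJ := setI_ideal (exceptional_ideal excI) (exceptional_ideal excJ).
apply/seteqP; split.
  by move=> p /(exceptional_sub excI idIJ (@subIsetl _ _ _) IJ24) [].
by move=> p /(exceptional_sub excJ idIJ (@subIsetr _ _ _) IJ24) [].
Qed.

Section Unique.
Variables I J : set S.
Hypotheses (excI : exceptional R I) (excJ : exceptional R J).
Let idIJ := setI_ideal (exceptional_ideal excI) (exceptional_ideal excJ).
Let IJ6 : (I `&` J) F6 := conj (exceptional_nideal excI (@F6_nideal R)) (exceptional_nideal excJ (@F6_nideal R)).
Let IJ8 : (I `&` J) F8 := conj (exceptional_nideal excI (@F8_nideal R)) (exceptional_nideal excJ (@F8_nideal R)).

Lemma has_w5_unique c : has_w5 I c -> has_w5 J c -> I = J.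
Proof.
move=> [I1 I2] [J1 J2]; apply: exceptional_eq => //.
by apply: (typeA_codim (c := c) idIJ IJ6 IJ8); split; split.
Qed.

Lemma has_r6_10_unique : has_w7 I -> has_r6 I 1 0 -> has_w7 J -> has_r6 J 1 0 -> I = J.
Proof.
move=> [I1 I2] [I3 I4 I5] [J1 J2] [J3 J4 J5]; apply: exceptional_eq => //.
by apply: (typeB_codim idIJ IJ6 IJ8); split; split.
Qed.

Lemma has_r6_01_unique : has_r6 I 0 1 -> has_r6 J 0 1 -> I = J.
Proof.
move=> [I3 I4 I5] [J3 J4 J5]; apply: exceptional_eq => //.
by apply: (typeC_codim idIJ IJ6 IJ8); split; split.
Qed.
End Unique.

(** * The involution on the two families *)

Let e : S := (eps R)%:MP.
Let e4 : e ^+ 4 = -1.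
Proof. by rewrite /e -rmorphXn /= eps4 rmorphN rmorph1. Qed.

Lemma act_taux : act tau x = e ^+ 7 * y.
Proof. by rewrite actx tauE !mxE /= mpolyC0 mul0r add0r /e rmorphXn. Qed.
Lemma act_tauy : act tau y = e * x.
Proof. by rewrite acty tauE !mxE /= mpolyC0 mul0r addr0. Qed.

Lemma has_w5_tau I c : is_ideal I -> has_w5 I c -> has_w5 (tau_ideal I) c.
Proof.
move=> idI [Ix Iy]; split; rewrite tau_idealP actD actM actC act_forms act_forms act_taux act_tauy.
  rewrite (_ : _ + _ = e ^+ 3 * (W5y + c%:MP * W7y)); first exact: (idealM idI).
  by rewrite /w5x /w7x /w5y /w7y; ring: e4.
rewrite (_ : _ + _ = e ^+ 5 * (W5x + c%:MP * W7x)); first exact: (idealM idI).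
by rewrite /w5x /w7x /w5y /w7y; ring: e4.
Qed.

Lemma has_w7_tau I : is_ideal I -> has_w7 I -> has_w7 (tau_ideal I).
Proof.
move=> idI [Ix Iy]; split; rewrite tau_idealP act_forms act_taux act_tauy.
  rewrite (_ : w7x _ _ = e ^+ 3 * W7y); first exact: (idealM idI).
  by rewrite /w7x /w7y; ring: e4.
rewrite (_ : w7y _ _ = e ^+ 5 * W7x); first exact: (idealM idI).
by rewrite /w7x /w7y; ring: e4.
Qed.

(** The involution acts on the two sextic triples with opposite signs. This is
    what separates the two families. *)
Lemma has_r6_tau I a b : is_ideal I -> has_r6 I a b -> has_r6 (tau_ideal I) a (- b).
Proof.
move=> idI [Ixx Ixy Iyy]; split; rewrite tau_idealP actD !actM !actC !act_forms act_taux act_tauy mpolyCN.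
- rewrite (_ : _ + _ = e ^+ 2 * (a%:MP * Uyy + b%:MP * Kyy)); first exact: (idealM idI).
  by rewrite /uxx /uyy /kxx /kyy; ring: e4.
- rewrite (_ : _ + _ = - (a%:MP * Uxy + b%:MP * Kxy)); first exact: (idealN idI).
  by rewrite /uxy /kxy; ring: e4.
- rewrite (_ : _ + _ = - (e ^+ 2) * (a%:MP * Uxx + b%:MP * Kxx)); first exact: (idealM idI).
  by rewrite /uxx /uyy /kxx /kyy; ring: e4.
Qed.

Lemma typeAB_fixed I : exceptional R I -> typeAB I -> tau_ideal I = I.
Proof.
move=> excI; have excT := exceptional_tau excI; have idI := exceptional_ideal excI.
case=> [[c Ic]|[I7 Ir]].
  by apply: (has_w5_unique excT excI (c := c)) => //; exact: has_w5_tau.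
apply: (has_r6_10_unique excT excI) => //; first exact: has_w7_tau.
by rewrite -oppr0; exact: has_r6_tau.
Qed.

(** A fixed ideal of the second family contains the two eigenvectors of the
    involution that make up its sixth degree covariant. *)
Lemma typeC_fixed I : exceptional R I -> typeC I -> tau_ideal I = I -> has_r6 I 0 1.
Proof.
move=> excI [a [b [b0 Ir]]] tI; have idI := exceptional_ideal excI.
have := has_r6_tau idI Ir; rewrite tI; move: Ir => [Ixx Ixy Iyy] [Jxx Jxy Jyy].
have b20 : b *+ 2 != 0 by rewrite -mulr_natr mulf_neq0 // pnatr_eq0.
have sub F G : I (a%:MP * F + b%:MP * G) -> I (a%:MP * F + (- b)%:MP * G) -> I (0%:MP * F + 1%:MP * G).
  move=> h1 h2; apply: (idealZK idI b20); have := idealB idI h1 h2.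
  rewrite (_ : _ - _ = b *+ 2 *: (0%:MP * F + 1%:MP * G)) //.
  rewrite mpolyC0 mpolyC1 mpolyCN mul0r add0r mul1r -mul_mpolyC mpolyCMn; ring.
by split; apply: sub.
Qed.

End Classification.

(** * Invariants and covariants of low degree *)

Section LowDegree.
Variable R : realType.
Local Notation C := R[i].
Local Notation S := {mpoly C[2]}.
Local Notation x := (vx R).
Local Notation y := (vy R).
Local Notation iota := ('i%C : C).
Local Notation us := (us R).
Local Notation F6 := (f6 x y).
Implicit Types (I J : set S) (p q F G K : S) (h g : 'M[C]_2).

(** Identities between homogeneous components are read off at a few points. *)
Definition plane_pt (a b : C) : 'I_2 -> C := fun j => if j == 0 then a else b.

Lemma meval_act_plane g p a b :
  (act g p).@[plane_pt a b] = p.@[plane_pt (g 0 0 * a + g 1 0 * b) (g 0 1 * a + g 1 1 * b)].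
Proof.
rewrite act_meval; apply: meval_eq => j; rewrite !big_ord_recl big_ord0 addr0.
rewrite (_ : lift _ _ = 1); last exact: val_inj.
rewrite /plane_pt /=; case: ifP => [/eqP -> //|/negbT j0].
by rewrite (_ : j = 1) //; case: j j0 => -[|[|//]] hj // _; exact: val_inj.
Qed.

Lemma meval_hcomp d p a b :
  (hcomp d p).@[plane_pt a b] = \sum_(k < d.+1) cf k (d - k) p * (a ^+ k * b ^+ (d - k)).
Proof.
rewrite hcompE raddf_sum; apply: eq_bigr => k _.
rewrite /= mevalM mevalC mevalM !rmorphXn /= vxE vyE !mevalXU.
by rewrite /plane_pt.
Qed.

Lemma act_i_mon a b : act (qmx R qgen_i) (x ^+ a * y ^+ b) =
  (iota ^+ a * (- iota) ^+ b)%:MP * (x ^+ a * y ^+ b).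
Proof.
rewrite act_monomial act_ix act_iy -mulNr !exprMn -mpolyCN -!rmorphXn /= mpolyCM.
by rewrite mulrACA.
Qed.

Lemma cf_act_i a b p : cf a b (act (qmx R qgen_i) p) = iota ^+ a * (- iota) ^+ b * cf a b p.
Proof.
rewrite {1 2}[p]mpolyE act_sum !cf_sum mulr_sumr; apply: eq_bigr => m _.
rewrite actZ (mnm2_eta m) mpolyX_xy act_i_mon !cfZ cf_C cf_mon.
by case: eqP => [->|]; case: eqP => [->|] /=; rewrite ?mulr0 // !mulr1 mulrC.
Qed.

Lemma cf_act_iE a b (c : C) p : act (qmx R qgen_i) p = c%:MP * p ->
  iota ^+ a * (- iota) ^+ b != c -> cf a b p = 0.
Proof.
move=> e ne; have := cf_act_i a b p; rewrite e cf_C => /eqP.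
by rewrite -subr_eq0 -mulrBl mulf_eq0 subr_eq0 eq_sym (negPf ne) => /eqP.
Qed.

Lemma m1_neq1 : (-1 : C) != 1.
Proof. by rewrite -subr_eq0 -opprD oppr_eq0 -mulr2n pnatr_eq0. Qed.

Lemma iota_prim : 4.-primitive_root iota.
Proof.
have i2 := sqr_iota R.
have i1 : iota != 1 by apply: contraNneq m1_neq1 => i1; rewrite -i2 i1 expr1n.
have i3 : iota ^+ 3 != 1.
  have e : iota ^+ 2 = (iota ^+ 3) ^+ 2.
    by rewrite -exprM (exprD _ 2 4) (exprM _ 2 2) i2 sqrrN expr1n mulr1.
  by apply: contraNneq m1_neq1 => h; rewrite -i2 e h expr1n.
apply/andP; split=> //; apply/forallP => -[[|[|[|[|//]]]] hk]; rewrite /= unity_rootE.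
- by rewrite expr1 (negPf i1).
- by rewrite i2 (negPf m1_neq1).
- by rewrite (negPf i3).
- by rewrite (exprM _ 2 2) i2 sqrrN expr1n !eqxx.
Qed.

(** Equivariance under the diagonal generator singles out the exponents of a
    fixed weight modulo four. *)
Lemma cf_weight a b w p : act (qmx R qgen_i) p = (iota ^+ w)%:MP * p ->
  (w < 4)%N -> ((a + 3 * b) %% 4 != w)%N -> cf a b p = 0.
Proof.
move=> e w4; apply: contraNeq => h.
have := eq_prim_root_expr iota_prim (a + 3 * b) w; rewrite (modn_small w4) => <-.
have -> : iota ^+ (a + 3 * b) = iota ^+ a * (- iota) ^+ b.
  by rewrite exprD exprM (exprS _ 2) sqr_iota mulrN1.
by apply: contraNT h => ne; apply/eqP; exact: cf_act_iE e ne.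
Qed.

Lemma us_pow : [/\ us ^+ 3 = - iota / 2 * us, us ^+ 4 = - 4^-1, us ^+ 5 = - 4^-1 * us & us ^+ 7 = iota / 8 * us].
Proof. by rewrite us.unlock; split; field: (sqr_iota R). Qed.

Lemma s_point1 p : (act (qmx R qgen_s) p).@[plane_pt 1 0] = p.@[plane_pt us us].
Proof. by rewrite meval_act_plane qmx_s !mxE /= !mulr1 !mulr0 !addr0. Qed.

Lemma s_point2 p : (act (qmx R qgen_s) p).@[plane_pt 1 1] = p.@[plane_pt (- iota) 1].
Proof.
rewrite meval_act_plane qmx_s !mxE /= !mulr1.
by congr (p.@[plane_pt _ _]); rewrite us.unlock; field: (sqr_iota R).
Qed.

Lemma j_point p a b : (act (qmx R qgen_j) p).@[plane_pt a b] = p.@[plane_pt (- b) a].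
Proof.
rewrite meval_act_plane qmx_j !mxE /=.
by congr (p.@[plane_pt _ _]); rewrite ?mul0r ?mul1r ?mulN1r ?add0r ?addr0.
Qed.

Lemma hcomp_fixed g d p : act g p = p -> act g (hcomp d p) = hcomp d p.
Proof. by move=> e; rewrite -hcomp_act e. Qed.

Lemma two_neq0 : (2 : C) != 0. Proof. by rewrite pnatr_eq0. Qed.

(** The equation [c = 0] as a multiple of a known relation; the multipliers used
    below solve the linear systems satisfied by the coefficients. *)
Lemma eq_scale (k m c l r : C) : k != 0 -> l = r -> k * c = m * (l - r) -> c = 0.
Proof. by move=> k0 -> /eqP; rewrite subrr mulr0 mulf_eq0 (negPf k0) => /eqP. Qed.

(** The diagonal generator leaves few monomials below degree eight; invariance
    under the two other generators, evaluated at points of the plane, relates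
    their coefficients. *)
Lemma invariant_low p : (forall h, H R h -> act h p = p) -> p.@[fun=> 0] = 0 ->
  exists c : C, mpow 8 (p - c%:MP * F6).
Proof.
move=> inv /mpow1P p1.
have Hi := inv _ (H_qmx R (isT : qgen_i \in hurwitz)).
have Hj := inv _ (H_qmx R (isT : qgen_j \in hurwitz)).
have Hs := inv _ (H_qmx R (isT : qgen_s \in hurwitz)).
have Hi0 : act (qmx R qgen_i) p = (iota ^+ 0)%:MP * p by rewrite expr0 mpolyC1 mul1r.
have z a b : ((a + 3 * b) %% 4 != 0)%N -> cf a b p = 0 by exact: cf_weight Hi0 isT.
have pj d a b : (hcomp d p).@[plane_pt (- b) a] = (hcomp d p).@[plane_pt a b].
  by rewrite -[in RHS](hcomp_fixed d Hj) j_point.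
have ps1 d : (hcomp d p).@[plane_pt us us] = (hcomp d p).@[plane_pt 1 0].
  by rewrite -[in RHS](hcomp_fixed d Hs) s_point1.
have ps2 d : (hcomp d p).@[plane_pt (- iota) 1] = (hcomp d p).@[plane_pt 1 1].
  by rewrite -[in RHS](hcomp_fixed d Hs) s_point2.
have E2 a b : (hcomp 2 p).@[plane_pt a b] = cf 1 1 p * (a * b).
  by rewrite meval_hcomp !big_ord_recl big_ord0 /= (z 0 2)%N // (z 2 0)%N //; ring.
have E4 a b : (hcomp 4 p).@[plane_pt a b] = cf 0 4 p * b ^+ 4 + cf 2 2 p * (a ^+ 2 * b ^+ 2) + cf 4 0 p * a ^+ 4.
  by rewrite meval_hcomp !big_ord_recl big_ord0 /= (z 1 3)%N // (z 3 1)%N //; ring.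
have E6 a b : (hcomp 6 p).@[plane_pt a b] =
    cf 1 5 p * (a * b ^+ 5) + cf 3 3 p * (a ^+ 3 * b ^+ 3) + cf 5 1 p * (a ^+ 5 * b).
  by rewrite meval_hcomp !big_ord_recl big_ord0 /= (z 0 6)%N // (z 2 4)%N // (z 4 2)%N // (z 6 0)%N //; ring.
have c11 : cf 1 1 p = 0.
  by have := pj 2 1 1; rewrite !E2 => /(eq_scale two_neq0 (m := -1)); apply; ring.
have [c22 c40 c04] : [/\ cf 2 2 p = 0, cf 4 0 p = 0 & cf 0 4 p = 0].
  have e1 := pj 4%N 1 0; have e2 := ps1 4%N; have e3 := ps2 4%N.
  rewrite !E4 in e1 e2 e3.
  have c04 : cf 0 4 p = cf 4 0 p.
    by apply/eqP; rewrite -subr_eq0; apply/eqP; apply: (eq_scale (oner_neq0 _) (m := 1) e1); ring.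
  have c22 : cf 2 2 p = 0.
    by apply: (eq_scale two_neq0 (m := -1) e3); ring: (sqr_iota R).
  have c40 : cf 4 0 p = 0.
    apply: (eq_scale (k := - 6) (m := 4) _ e2); first by rewrite oppr_eq0 pnatr_eq0.
    by have [_ u4 _ _] := us_pow; rewrite c04 c22 u4; field.
  by split=> //; rewrite c04.
have [c33 c15] : cf 3 3 p = 0 /\ cf 1 5 p = - cf 5 1 p.
  have e1 := pj 6%N 1 1; have e2 := pj 6%N 1 2; rewrite !E6 in e1 e2.
  have S0 : cf 1 5 p + cf 3 3 p + cf 5 1 p = 0.
    by apply: (eq_scale two_neq0 (m := -1) e1); ring.
  have cE : cf 1 5 p = - cf 3 3 p - cf 5 1 p by apply/eqP; rewrite -subr_eq0 -S0; apply/eqP; ring.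
  have c33 : cf 3 3 p = 0.
    apply: (eq_scale (k := 18) (m := 1) _ e2); first by rewrite pnatr_eq0.
    by rewrite cE; ring.
  by rewrite cE c33 oppr0 add0r.
have c00 : cf 0 0 p = 0 by exact: p1.
exists (cf 5 1 p) => a b ab.
have cF6 : cf a b F6 = ((5 == a) && (1 == b))%:R - ((1 == a) && (5 == b))%:R :> C.
  by rewrite /f6 -{2}(expr1 x) -{1}(expr1 y) cfB !cf_mon.
rewrite cfB cf_C cF6.
have [h|h] := boolP ((a + 3 * b) %% 4 == 0)%N; last first.
  rewrite z // (_ : (5 == a) && (1 == b) = false); last by lia.
  by rewrite (_ : (1 == a) && (5 == b) = false); [rewrite subrr mulr0 subrr|lia].
have : [|| (a, b) == (0, 0), (a, b) == (1, 1), (a, b) == (2, 2), (a, b) == (3, 3),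
   (a, b) == (0, 4), (a, b) == (4, 0), (a, b) == (1, 5) | (a, b) == (5, 1)]%N.
  by rewrite !xpair_eqE; lia.
case/or4P=> [/eqP[-> ->]|/eqP[-> ->]|/eqP[-> ->]|]; rewrite ?(c00, c11, c22) /= ?subrr ?mulr0 ?subrr //.
case/or4P=> [/eqP[-> ->]|/eqP[-> ->]|/eqP[-> ->]|]; rewrite ?(c33, c04, c40) /= ?subrr ?mulr0 ?subrr //.
case/orP=> /eqP[-> ->]; rewrite ?c15 /=; ring.
Qed.

End LowDegree.

Section NaturalCovariants.
Variable R : realType.
Local Notation C := R[i].
Local Notation S := {mpoly C[2]}.
Local Notation x := (vx R).
Local Notation y := (vy R).
Local Notation M a b := (x ^+ a * y ^+ b).
Local Notation iota := ('i%C : C).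
Local Notation us := (us R).
Local Notation F6 := (f6 x y).
Local Notation F8 := (f8 x y).
Local Notation W5x := (w5x x y).
Local Notation W5y := (w5y x y).
Local Notation W7x := (w7x x y).
Local Notation W7y := (w7y x y).
Implicit Types (I J : set S) (p q F G K : S) (h g : 'M[C]_2).

Lemma us_1i : us * (1 + iota) = 1.
Proof. by rewrite us.unlock; field: (sqr_iota R). Qed.

(** The same method for covariants: the first component determines the second,
    and its coefficients in degrees three, five and seven satisfy linear
    relations. *)
Lemma covariant_low F G : equiv2 F G -> exists a b c d : C,
  mpow 9 (F - (a%:MP * x + b%:MP * W5x + c%:MP * W7x + d%:MP * (x * F6))) /\
  mpow 9 (G - (a%:MP * y + b%:MP * W5y + c%:MP * W7y + d%:MP * (y * F6))).
Proof.
move=> eFG.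
have Hi : H R (qmx R qgen_i) by apply: H_qmx.
have Hj : H R (qmx R qgen_j) by apply: H_qmx.
have Hs : H R (qmx R qgen_s) by apply: H_qmx.
have jE p q : equiv2 p q -> q = - act (qmx R qgen_j) p.
  move=> /equiv2E/(_ Hj)[-> _]; rewrite qmx_j !mxE /= mpolyC0 mpolyCN mpolyC1; ring.
have iF : act (qmx R qgen_i) F = (iota ^+ 1)%:MP * F.
  by rewrite (equiv2E eFG Hi).1 qmx_i !mxE /= mpolyC0 mul0r addr0 expr1.
have sF : act (qmx R qgen_s) F = us%:MP * F + (iota * us)%:MP * act (qmx R qgen_j) F.
  rewrite (equiv2E eFG Hs).1 {1}(jE _ _ eFG) qmx_s !mxE /= mulNr mpolyCN; ring.
have z a b : ((a + 3 * b) %% 4 != 1)%N -> cf a b F = 0 by exact: cf_weight iF isT.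
have sd d (a b : C) : (act (qmx R qgen_s) (hcomp d F)).@[plane_pt a b] =
    us * ((hcomp d F).@[plane_pt a b] + iota * (hcomp d F).@[plane_pt (- b) a]).
  rewrite -hcomp_act sF hcompD !mul_mpolyC !hcompZ mevalD !mevalZ hcomp_act j_point; ring.
have s1 d : (hcomp d F).@[plane_pt us us] = us * ((hcomp d F).@[plane_pt 1 0] + iota * (hcomp d F).@[plane_pt (- 0) 1]).
  by rewrite -sd s_point1.
have s2 d : (hcomp d F).@[plane_pt (- iota) 1] = us * ((hcomp d F).@[plane_pt 1 1] + iota * (hcomp d F).@[plane_pt (- 1) 1]).
  by rewrite -sd s_point2.
have E3 (a b : C) : (hcomp 3 F).@[plane_pt a b] = cf 0 3 F * b ^+ 3 + cf 2 1 F * (a ^+ 2 * b).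
  by rewrite meval_hcomp !big_ord_recl big_ord0 /= (z 1 2)%N // (z 3 0)%N //; ring.
have E5 (a b : C) : (hcomp 5 F).@[plane_pt a b] = cf 1 4 F * (a * b ^+ 4) + cf 3 2 F * (a ^+ 3 * b ^+ 2) + cf 5 0 F * a ^+ 5.
  by rewrite meval_hcomp !big_ord_recl big_ord0 /= (z 0 5)%N // (z 2 3)%N // (z 4 1)%N //; ring.
have E7 (a b : C) : (hcomp 7 F).@[plane_pt a b] = cf 0 7 F * b ^+ 7 + cf 2 5 F * (a ^+ 2 * b ^+ 5)
    + cf 4 3 F * (a ^+ 4 * b ^+ 3) + cf 6 1 F * (a ^+ 6 * b).
  by rewrite meval_hcomp !big_ord_recl big_ord0 /= (z 1 6)%N // (z 3 4)%N // (z 5 2)%N // (z 7 0)%N //; ring.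
have [u3 _ u5 u7] := us_pow R.
have i2 := sqr_iota R; have u1 := us_1i.
have [c03 c21] : cf 0 3 F = 0 /\ cf 2 1 F = 0.
  have e1 := s1 3%N; have e2 := s2 3%N; rewrite !E3 in e1 e2.
  have c21 : cf 2 1 F = 0.
    by apply: (eq_scale (two_neq0 R) (m := -1) e2); rewrite us.unlock; field: i2.
  split=> //; apply: (eq_scale (k := 3) (m := 2 * iota * (1 + iota)) _ e1).
    by rewrite pnatr_eq0.
  by rewrite c21 us.unlock; field: i2.
have [c32 c14] : cf 3 2 F = 0 /\ cf 1 4 F = - 5 * cf 5 0 F.
  have e1 := s1 5%N; have e2 := s2 5%N; rewrite !E5 in e1 e2.
  have c32 : cf 3 2 F = 0.
    by apply: (eq_scale (two_neq0 R) (m := - iota) e2); rewrite us.unlock; field: i2.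
  split=> //; apply/eqP; rewrite -subr_eq0; apply/eqP.
  apply: (eq_scale (oner_neq0 _) (m := - 4 * (1 + iota)) e1).
  by rewrite c32 us.unlock; field: i2.
have [c25 c43] : cf 2 5 F = - cf 6 1 F /\ cf 4 3 F = 7 * cf 0 7 F.
  have e1 := s1 7%N; have e2 := s2 7%N; rewrite !E7 in e1 e2.
  have c25 : cf 2 5 F = - cf 6 1 F.
    apply/eqP; rewrite -subr_eq0; apply/eqP.
    by apply: (eq_scale (two_neq0 R) (m := -1) e2); rewrite us.unlock; field: i2.
  split=> //; apply/eqP; rewrite -subr_eq0; apply/eqP.
  apply: (eq_scale (oner_neq0 _) (m := - 8 * iota * (1 + iota)) e1).
  by rewrite c25 us.unlock; field: i2.
have gen (k : 'M[C]_2) (a b c d : C) T v w5 w7 f T' v' w5' w7' : T' = - act k T ->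
    v' = - act k v -> w5' = - act k w5 -> w7' = - act k w7 -> act k f = f ->
    T' - (a%:MP * v' + b%:MP * w5' + c%:MP * w7' + d%:MP * (v' * f)) =
    - act k (T - (a%:MP * v + b%:MP * w5 + c%:MP * w7 + d%:MP * (v * f))).
  by move=> -> -> -> -> kf; rewrite actB !actD !actM !actC kf; ring.
have {}gen := gen _ (cf 1 0 F) (cf 5 0 F) (cf 0 7 F) (cf 6 1 F) _ _ _ _ _ _ _ _ _ (jE _ _ eFG)
  (jE _ _ (@w1_equiv R)) (jE _ _ (@w5_equiv R)) (jE _ _ (@w7_equiv R)) (f6_inv Hj).
exists (cf 1 0 F), (cf 5 0 F), (cf 0 7 F), (cf 6 1 F).
set D := F - _; have m9 : mpow 9 D.
  move=> a b ab; rewrite /D.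
  have cW5 : cf a b W5x = ((5 == a) && (0 == b))%:R - 5 * ((1 == a) && (4 == b))%:R.
    rewrite (_ : W5x = x ^+ 5 * y ^+ 0 - 5%:MP * (M 1 4)); last by rewrite /w5x; ring.
    by rewrite cfB cf_mon cf_C cf_mon.
  have cW7 : cf a b W7x = ((0 == a) && (7 == b))%:R + 7 * ((4 == a) && (3 == b))%:R.
    rewrite (_ : W7x = x ^+ 0 * y ^+ 7 + 7%:MP * (M 4 3)); last by rewrite /w7x; ring.
    by rewrite cfD cf_mon cf_C cf_mon.
  have cxF6 : cf a b (x * F6) = ((6 == a) && (1 == b))%:R - ((2 == a) && (5 == b))%:R.
    by rewrite (_ : x * F6 = x ^+ 6 * y ^+ 1 - x ^+ 2 * y ^+ 5) ?cfB ?cf_mon // /f6; ring.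
  rewrite cfB !cfD !cf_C cf_x cW5 cW7 cxF6 {cW5 cW7 cxF6}.
  have [h|h] := boolP ((a + 3 * b) %% 4 == 1)%N; last first.
    rewrite z // (_ : (1 == a) && (0 == b) = false); last by lia.
    rewrite (_ : (5 == a) && (0 == b) = false); last by lia.
    rewrite (_ : (1 == a) && (4 == b) = false); last by lia.
    rewrite (_ : (0 == a) && (7 == b) = false); last by lia.
    rewrite (_ : (4 == a) && (3 == b) = false); last by lia.
    rewrite (_ : (6 == a) && (1 == b) = false); last by lia.
    by rewrite (_ : (2 == a) && (5 == b) = false); [rewrite /=; ring|lia].
  have : [|| (a, b) == (1, 0), (a, b) == (0, 3), (a, b) == (2, 1), (a, b) == (5, 0),
     (a, b) == (3, 2), (a, b) == (1, 4), (a, b) == (0, 7), (a, b) == (2, 5), (a, b) == (4, 3) | (a, b) == (6, 1)]%N.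
    by rewrite !xpair_eqE; lia.
  case/or4P=> [/eqP[-> ->]|/eqP[-> ->]|/eqP[-> ->]|]; rewrite ?(c03, c21) /=; try ring.
  case/or4P=> [/eqP[-> ->]|/eqP[-> ->]|/eqP[-> ->]|]; rewrite ?(c32, c14) /=; try ring.
  by case/or4P=> [/eqP[-> ->]|/eqP[-> ->]|/eqP[-> ->]|/eqP[-> ->]]; rewrite ?(c25, c43) /=; ring.
split; first exact: m9.
rewrite gen; apply: (idealN (mpow_ideal R 9)); apply: mpow_act; exact: m9.
Qed.

(** * Ideals described by their leading forms *)

(** The polynomials that agree with an element of [V] to order [k]. *)
Definition lead_ideal k (V : set S) : set S := [set p | exists2 g, V g & mpow k.+1 (p - g)].

Lemma lead_ideal_ideal k (V : set S) : V `<=` mpow k -> V 0 ->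
  (forall (a : C) p q, V p -> V q -> V (a%:MP * p + q)) -> is_ideal (lead_ideal k V).
Proof.
move=> Vk V0 Vl; have idk := mpow_ideal R k.+1; split.
- by exists 0 => //; rewrite subrr; exact: ideal0.
- move=> p q [g Vg pg] [g' Vg' qg']; exists (1%:MP * g + g'); first exact: Vl.
  by rewrite mpolyC1 mul1r opprD addrACA; exact: (idealD idk).
- move=> f p [g Vg pg]; exists ((cf 0 0 f)%:MP * g + 0); first exact: Vl.
  rewrite addr0 (_ : _ - _ = f * (p - g) + (f - (cf 0 0 f)%:MP) * g); last by ring.
  apply: (idealD idk); first exact: (idealM idk).
  rewrite -add1n; apply: mpowM; last exact: Vk.
  move=> [|a] [|b] // _; rewrite cfB -[_%:MP]mulr1 cf_C.
  by have := cf_mon R 0 0 0 0; rewrite !expr0 mulr1 => ->; rewrite mulr1 subrr.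
Qed.

Definition F6_line : set S := [set c%:MP * F6 | c in [set: C]].

Lemma F6_line_ideal : is_ideal (lead_ideal 6 F6_line).
Proof.
apply: lead_ideal_ideal.
- by move=> _ [c _ <-]; apply: (idealM (mpow_ideal R 6)); exact: F6_mpow.
- by exists 0 => //; rewrite mpolyC0 mul0r.
- by move=> a _ _ [c _ <-] [d _ <-]; exists (a * c + d) => //; rewrite mpolyCD mpolyCM; ring.
Qed.

Lemma nideal_lead : nideal R `<=` lead_ideal 6 F6_line.
Proof.
apply: ideal_gen_min; first exact: F6_line_ideal.
move=> p []; rewrite poly_actE => inv p0; have [c hc] := invariant_low inv p0.
by exists (c%:MP * F6); [exists c|apply: sub_mpow hc].
Qed.

Lemma nideal_mpow6 : nideal R `<=` mpow 6.
Proof.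
move=> p /nideal_lead[_ [c _ <-]] h; rewrite -(subrK (c%:MP * F6) p).
apply: (idealD (mpow_ideal R 6)); first exact: sub_mpow h.
by apply: (idealM (mpow_ideal R 6)); exact: F6_mpow.
Qed.

(** * Ideals of the second family have no covariant of the natural type *)

Lemma mIn_subset I : exceptional R I -> mIn I `<=` I.
Proof.
move=> excI; apply: mIn_sub; [exact: exceptional_ideal| |exact: exceptional_nideal].
by move=> p q _ Iq; apply: idealM => //; exact: exceptional_ideal.
Qed.

Lemma has_w7_mpow9 (K : set S) : is_ideal K -> K F6 -> K F8 -> has_w7 K -> mpow 9 `<=` K.
Proof.
move=> idK K6 K8 [hx hy]; apply: (mpow_sub_ideal idK (mpow13_sub idK K6 K8)).
have m45 : K (M 4 5)
  by apply: (ideal_comb 7 (- (x * y)) (- x ^+ 3) idK hy K6); ring_forms.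
have m81 : K (M 8 1)
  by apply: (ideal_lin2 1 (x ^+ 3) idK m45 K6); ring_forms.
have m09 : K (M 0 9)
  by apply: (ideal_lin2 (y ^+ 2) (- 7) idK hx m45); ring_forms.
have m54 : K (M 5 4)
  by apply: (ideal_comb 7 (x * y) (y ^+ 3) idK hx K6); ring_forms.
have m18 : K (M 1 8)
  by apply: (ideal_lin2 1 (- y ^+ 3) idK m54 K6); ring_forms.
have m90 : K (M 9 0)
  by apply: (ideal_lin2 (- x ^+ 2) (- 7) idK hy m54); ring_forms.
have m36 : K (M 3 6)
  by apply: (ideal_comb 7 (- y ^+ 2) (- (x ^+ 2 * y)) idK hy K6); ring_forms.
have m72 : K (M 7 2)
  by apply: (ideal_lin2 1 (x ^+ 2 * y) idK m36 K6); ring_forms.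
have m63 : K (M 6 3)
  by apply: (ideal_comb 7 (x ^+ 2) (x * y ^+ 2) idK hx K6); ring_forms.
have m27 : K (M 2 7)
  by apply: (ideal_lin2 1 (- (x * y ^+ 2)) idK m63 K6); ring_forms.
have Sd : upto (fun a => K (M a (9 - a))) 9
  := (conj (conj (conj (conj (conj (conj (conj (conj (conj m09 m18) m27) m36) m45) m54) m63) m72) m81) m90).
by move=> a ha; apply: (sub_ideal_addl (mpow_ideal R 10)); exact: (uptoP Sd).
Qed.

(** Modulo [F6], [y (a Uxx + b Kxx) + x (a Uxy + b Kxy)] is [b W7x]. *)
Lemma typeC_w7 I : exceptional R I -> typeC I -> has_w7 (mIn I).
Proof.
move=> excI [a [b [b0 [Ixx Ixy Iyy]]]]; have idm := mIn_ideal I.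
have m6 := mIn_nideal I (@F6_nideal R).
have hyxx := mIn_mul (mpow1_y R) Ixx; have hxxy := mIn_mul (mpow1_x R) Ixy.
have hxyy := mIn_mul (mpow1_x R) Iyy; have hyxy := mIn_mul (mpow1_y R) Ixy.
split; apply: (idealZK idm b0); rewrite -mul_mpolyC.
  apply: (ideal_lin3 (q1 := 1) (q2 := -1) (q3 := (- 3 * a)%:MP * x) idm hyxx hxxy m6).
  by rewrite /w7x /uxx /uxy /kxx /kxy /f6; ring.
apply: (ideal_lin3 (q1 := -1) (q2 := 1) (q3 := (- 3 * a)%:MP * y) idm hxyy hyxy m6).
by rewrite /w7y /uyy /uxy /kyy /kxy /f6; ring.
Qed.

(** In [covariant_low] the terms in [x] and [W5x] must vanish on [typeC] ideals,
    and all others belong to [m I + n]. *)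
Lemma typeC_covariant I F G : exceptional R I -> typeC I -> equiv2 F G -> I F -> I G ->
  mIn I F /\ mIn I G.
Proof.
move=> excI tC eFG IF IG; have idm := mIn_ideal I; have idI := exceptional_ideal excI.
have mI := mIn_subset excI.
have m6 := mIn_nideal I (@F6_nideal R); have m8 := mIn_nideal I (@F8_nideal R).
have m7 := typeC_w7 excI tC; have m9 := has_w7_mpow9 idm m6 m8 m7.
have [a [b [c [d [hF hG]]]]] := covariant_low eFG.
have red T v w5 w7 : mpow 9 (T - (a%:MP * v + b%:MP * w5 + c%:MP * w7 + d%:MP * (v * F6))) ->
    mIn I w7 -> mIn I (T - (a%:MP * v + b%:MP * w5)).
  move=> /m9 h h7; rewrite (_ : _ - _ = (T - (a%:MP * v + b%:MP * w5 + c%:MP * w7 + d%:MP * (v * F6)))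
    + (c%:MP * w7 + d%:MP * v * F6)); last by ring.
  by apply: (idealD idm) => //; apply: (idealD idm); exact: (idealM idm).
have rF := red _ _ _ _ hF m7.1; have rG := red _ _ _ _ hG m7.2.
have inI T p : I T -> mIn I (T - p) -> I p.
  by move=> IT /mI h; rewrite -(subKr T p); exact: (idealB idI).
have lx := inI _ _ IF rF; have ly := inI _ _ IG rG.
have tail0 p w7 : I p -> I (p + 0%:MP * w7) by rewrite mpolyC0 mul0r addr0.
have a0 := no_degree1 excI (tail0 _ W7x lx) (tail0 _ W7y ly).
have b0 : b = 0.
  apply: contrapT => /eqP b0; apply: (typeC_w5 (c := 0) excI tC).
  have sc v w5 w7 : I (a%:MP * v + b%:MP * w5) -> I (w5 + 0%:MP * w7).
    rewrite a0 !mpolyC0 !mul0r add0r addr0 => h; apply: (idealZK idI b0).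
    by rewrite -mul_mpolyC.
  by split; [exact: sc lx|exact: sc ly].
have fin T v w5 : mIn I (T - (a%:MP * v + b%:MP * w5)) -> mIn I T.
  by rewrite a0 b0 mpolyC0 !mul0r addr0 subr0.
by split; [exact: fin rF|exact: fin rG].
Qed.

(** * Averaging over the group *)

(** The average over [H] of a map equivariant modulo [J] agrees with it modulo
    [J]. *)
Lemma average_equivariant I J (f : 'cV[C]_2 -> S) : is_ideal I -> is_ideal J -> H_stable I ->
  (forall h p, H R h -> J p -> J (act h p)) -> linear f -> (forall v, I (f v)) ->
  (forall h v, H R h -> J (f (h *m v) - act h (f v))) ->
  exists F G, [/\ equiv2 F G, I F, I G & forall v, J (cov2 F G v - f v)].
Proof.
move=> idI idJ stI stJ flin fI fJ.
have hsH h : h \in hurwitz_mx R -> H R h by move/HP.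
pose s v := \sum_(h <- hurwitz_mx R) act (invmx h) (f (h *m v)).
pose av v := (24%:R^-1 : C) *: s v.
have n24 : (24%:R : C) != 0 by rewrite pnatr_eq0.
have avlin a u v : av (a *: u + v) = a *: av u + av v.
  rewrite /av (_ : s (a *: u + v) = a *: s u + s v); first by rewrite scalerDr !scalerA mulrC.
  rewrite /s scaler_sumr -big_split; apply: eq_bigr => h _ /=.
  by rewrite mulmxDr -scalemxAr flin actD actZ.
have avI v : I (av v).
  apply: (idealZ idI); rewrite /s big_seq; apply: (ideal_sum idI) => h /hsH Hh.
  by apply: stable_act => //; exact: HV.
have avJ v : J (av v - f v).
  rewrite (_ : f v = 24%:R^-1 *: (\sum_(h <- hurwitz_mx R) f v)); last first.
    rewrite big_const_seq count_predT size_map iter_addr_0.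
    by rewrite -[f v *+ _]scaler_nat scalerA mulVf ?scale1r.
  rewrite -scalerBr -sumrB; apply: (idealZ idJ); rewrite big_seq.
  apply: (ideal_sum idJ) => h /hsH Hh.
  rewrite -(actK (f v) (H_unit Hh)) -actB; apply: stJ; first exact: HV.
  exact: fJ.
have avH k v : H R k -> av (k *m v) = act k (av v).
  move=> Hk; rewrite /av actZ; congr (_ *: _); rewrite /s act_sum.
  have inj : injective (fun h : 'M[C]_2 => h *m k).
    by move=> g h /(congr1 (fun m => m *m invmx k)); rewrite !mulmxK ?H_unit.
  have pe : perm_eq (map (fun h => h *m k) (hurwitz_mx R)) (hurwitz_mx R).
    apply: uniq_perm; [by rewrite map_inj_uniq ?hurwitz_mx_uniq|exact: hurwitz_mx_uniq|].
    move=> h; apply/mapP/idP => [[g gh ->]|hh].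
      by apply: hurwitz_mxM => //; exact/HP.
    exists (h *m invmx k); last by rewrite mulmxKV ?H_unit.
    by apply: hurwitz_mxM => //; apply/HP; exact: HV.
  rewrite -[in RHS](perm_big _ pe) [RHS]big_map big_seq [RHS]big_seq; apply: eq_bigr => h /hsH Hh.
  rewrite -act_mul mulmxA; congr (act _ _).
  have u := H_unit (HM Hh Hk).
  by rewrite -[LHS]mulmx1 -(mulmxV u) mulmxA mulmxA mulVmx ?H_unit // mul1mx.
pose e0 : 'cV[C]_2 := \col_i (i == 0)%:R; pose e1 : 'cV[C]_2 := \col_i (i == 1)%:R.
have avE v : av v = cov2 (av e0) (av e1) v.
  have -> : v = v 0 0 *: e0 + (v 1 0 *: e1 + 0).
    apply/colP => i; rewrite !mxE addr0.
    by case: i => -[|[|//]] hi /=; rewrite ?mulr1 ?mulr0 ?addr0 ?add0r; congr (v _ _); exact: val_inj.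
  have av0 : av 0 = 0 by have := avlin (-1) 0 0; rewrite scaler0 addr0 scaleN1r addNr.
  rewrite !avlin av0 addr0 /cov2 !mxE /= !mulr1 !mulr0 !addr0 !add0r.
  by rewrite -!mul_mpolyC.
exists (av e0), (av e1); split=> //.
  by move=> h Hh v; rewrite -!avE avH.
by move=> v; rewrite -avE.
Qed.

End NaturalCovariants.

(** * Natural and adjoint representations in the McKay graph *)

Section Components.
Variable R : realType.
Local Notation C := R[i].
Local Notation S := {mpoly C[2]}.
Local Notation x := (vx R).
Local Notation y := (vy R).
Local Notation F6 := (f6 x y).
Local Notation W5x := (w5x x y).
Local Notation W5y := (w5y x y).
Local Notation W7x := (w7x x y).
Local Notation W7y := (w7y x y).
Local Notation Uxx := (uxx x y).
Local Notation Uxy := (uxy x y).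
Local Notation Uyy := (uyy x y).
Implicit Types (I J : set S) (p q F G K : S) (h g : 'M[C]_2).

(** The tensor product of column vectors as a space of matrices. *)
Definition unvec m (v : 'cV[C]_(m * 2)) : 'M[C]_(m, 2) :=
  \matrix_(k, l) v (mxtens_index (k, l)) 0.

Lemma unvec_tens m (A : 'M[C]_m) (B : 'M[C]_2) (v : 'cV[C]_(m * 2)) :
  unvec ((A *t B) *m v) = A *m unvec v *m B^T.
Proof.
apply/matrixP => k l; rewrite [LHS]mxE [LHS]mxE [RHS]mxE.
rewrite (reindex (@mxtens_index m 2)) /=; last first.
  by exists (@mxtens_unindex m 2) => ? _; [exact: mxtens_indexK|exact: mxtens_unindexK].
pose F a b := (A *t B) (mxtens_index (k, l)) (mxtens_index (a, b)) * v (mxtens_index (a, b)) 0.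
transitivity (\sum_p F p.1 p.2); first by apply: eq_bigr => -[].
rewrite -(pair_bigA _ F) exchange_big /=; apply: eq_bigr => b _.
rewrite [X in X * _]mxE mulr_suml; apply: eq_bigr => a _.
by rewrite /F tensmxE !mxE mulrAC.
Qed.

Lemma unvec_inj m : injective (@unvec m).
Proof.
move=> u v /matrixP e; apply/colP => k; case: (mxtens_indexP k) => i j.
by have := e i j; rewrite !mxE.
Qed.

Lemma unvec_linear m : linear (@unvec m).
Proof. by move=> a u v; apply/matrixP => k l; rewrite !mxE. Qed.

(** An edge of the McKay graph in terms of matrices: [h] acts on the module of
    the tensor product by [V |-> r h V h^T]. *)
Lemma adjacent_map n m (r : 'M[C]_2 -> 'M[C]_n) (s : 'M[C]_2 -> 'M[C]_m) :
  mckay_adjacent r s -> exists P : 'cV[C]_m -> 'M[C]_(n, 2),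
    [/\ linear P, injective P & forall h v, H R h -> P (s h *m v) = r h *m P v *m h^T].
Proof.
move=> /rep_subP[M [L [LM MH]]]; exists (fun v => unvec (M *m v)); split.
- by move=> a u v; rewrite mulmxDr -scalemxAr unvec_linear.
- by move=> u v /unvec_inj/(congr1 (mulmx L)); rewrite !mulmxA LM !mul1mx.
- by move=> h v Hh; rewrite mulmxA -MH // -mulmxA unvec_tens.
Qed.

Lemma tens1 (B : 'M[C]_2) : (1%:M : 'M[C]_1) *t B = B :> 'M[C]_2.
Proof.
have E (k : 'I_1) (l : 'I_2) : mxtens_index (k, l) = l :> 'I_2.
  by apply: val_inj; rewrite /= (ord1 k).
apply/matrixP => k l; rewrite -{1}(E 0 k) -{1}(E 0 l).
by rewrite (tensmxE (1%:M : 'M[C]_1) B 0 k 0 l) mxE eqxx mul1r.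
Qed.

Section Vertices.
Variable rho : forall v, 'M[C]_2 -> 'M[C]_(mckay_dim v).
Hypothesis rhoP : mckay_labelling rho.

(** [rho2] is a constituent of the tensor product of the trivial and the natural
    representations, which has the dimension of [rho2]. *)
Lemma rho2_natural : rep_iso (rho rho2) (fun h : 'M[C]_2 => h).
Proof.
have [_ triv adj _ _] := rhoP.
have /rep_subP[M [L [LM MH]]] : mckay_adjacent (rho rho0) (rho rho2) by apply/adj.
exists (M : 'M[C]_2), (L : 'M[C]_2); split=> //; first exact: mulmx1C LM.
by move=> h Hh; have := MH h Hh; rewrite triv // tens1.
Qed.

Lemma E_rho2 I : E (rho rho2) I <-> E (fun h : 'M[C]_2 => h) I.
Proof.
split; first exact: E_iso rho2_natural.
apply: E_iso; have [M [N [MN NM Ms]]] := rho2_natural; exists N, M; split=> // h Hh.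
by rewrite -[RHS]mulmx1 -MN (mulmxA (N *m h)) -(mulmxA N) Ms // !mulmxA NM mul1mx.
Qed.

(** The antisymmetric elements of the image form an invariant subspace; they are
    not everything, because antisymmetric matrices have dimension one. *)
Lemma rho3_symmetric : exists P : 'cV[C]_3 -> 'M[C]_2,
  [/\ linear P, forall h v, H R h -> P (rho rho3 h *m v) = h *m P v *m h^T
    & forall v, P v + (P v)^T = 0 -> v = 0].
Proof.
have [[irr _] _ adj _ _] := rhoP.
have a23 : mckay_adjacent (fun h : 'M[C]_2 => h) (rho rho3).
  by apply: (adjacent_iso rho2_natural (rep_iso_refl (fun h _ => erefl))); apply/adj.
have [P [Plin Pinj PH]] := adjacent_map a23; exists P; split=> //.
have P0 : P 0 = 0 by have := Plin (-1) 0 0; rewrite scaler0 addr0 scaleN1r addNr.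
have [_ _ Pirr] := irr rho3.
pose W : set 'cV[C]_3 := [set v | P v + (P v)^T = 0].
have [] := Pirr W.
- by rewrite /W /= P0 trmx0 addr0.
- move=> a u v; rewrite /W /= Plin linearP /= addrACA -scalerDr => -> ->.
  by rewrite scaler0 addr0.
- move=> h v Hh; rewrite /W /= PH // !trmx_mul trmxK mulmxA => Wv.
  by rewrite -mulmxDl -mulmxDr Wv mulmx0 mul0mx.
- by move=> WE v Wv; have : W v by []; rewrite WE.
move=> WT; pose e (k : 'I_3) : 'cV[C]_3 := delta_mx k 0.
have [u u0 uM] := lin_dep (\matrix_(k < 3, l < 1) P (e k) 0 1) (isT : (1 < 3)%N).
case/eqP: u0; apply/trmx_inj; rewrite trmx0; apply: Pinj; rewrite P0.
have PE v : P v = (P v 0 1) *: mx22 0 1 (-1) 0.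
  have /matrixP Wv : P v + (P v)^T = 0 by have : W v by rewrite WT.
  have z k : P v k k = 0.
    by have /eqP := Wv k k; rewrite !mxE -mulr2n mulrn_eq0 /= => /eqP.
  have z01 := Wv 0 1; rewrite !mxE in z01.
  apply/matrixP => k l; rewrite !mxE.
  have [->|k1] : k = 0 \/ k = 1 by case: k => -[|[|//]] hk; [left|right]; exact: val_inj.
    have [->|->] : l = 0 \/ l = 1 by case: l => -[|[|//]] hl; [left|right]; exact: val_inj.
      by rewrite z /= mulr0.
    by rewrite /= mulr1.
  rewrite k1; have [->|->] : l = 0 \/ l = 1 by case: l => -[|[|//]] hl; [left|right]; exact: val_inj.
    by rewrite /= mulrN1; apply/eqP; rewrite -addr_eq0 addrC z01.
  by rewrite z /= mulr0.
rewrite PE; suff -> : P u^T 0 1 = 0 by rewrite scale0r.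
have Psum (r : seq 'I_3) (c : 'I_3 -> C) : P (\sum_(k <- r) c k *: e k) = \sum_(k <- r) c k *: P (e k).
  by elim: r => [|k r IH]; rewrite ?big_nil // !big_cons Plin IH.
have -> : u^T = \sum_k u 0 k *: e k.
  by apply/colP => k; rewrite summxE (bigD1 k) //= big1 => [|l lk]; rewrite !mxE ?eqxx ?mulr1 ?addr0 // eq_sym (negPf lk) mulr0.
rewrite Psum summxE; have /rowP/(_ 0) := uM; rewrite !mxE => eq0; rewrite -[RHS]eq0.
by apply: eq_bigr => k _; rewrite !mxE.
Qed.

End Vertices.

(** * The natural component is the first family *)

Lemma equiv2_add F G F' G' (c : C) : equiv2 F G -> equiv2 F' G' ->
  equiv2 (F + c%:MP * F') (G + c%:MP * G').
Proof.
move=> e e' h Hh v.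
have E u : cov2 (F + c%:MP * F') (G + c%:MP * G') u = cov2 F G u + c%:MP * cov2 F' G' u.
  by rewrite /cov2; ring.
by rewrite !E e // e' // actD actM actC.
Qed.

(** A covariant pair in [I] that is linearly independent modulo [m I + n] spans a
    copy of the natural representation in [V(I)]. *)
Lemma E_natural_intro I F G : exceptional R I -> equiv2 F G -> I F -> I G ->
  (forall v, mIn I (cov2 F G v) -> v = 0) -> E (fun h : 'M[C]_2 => h) I.
Proof.
move=> excI e IF IG inj; have idI := exceptional_ideal excI; split=> //.
apply: (@embeds_intro R 2 (fun h => h) I (mIn I) (cov2 F G)).
- exact: cov2_linear.
- by move=> v; apply: (idealD idI); exact: (idealM idI).
- by move=> h v Hh; rewrite e // subrr; exact: (ideal0 (mIn_ideal I)).
- exact: inj.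
Qed.

Lemma col2_eq0 (v : 'cV[C]_2) : v 0 0 = 0 -> v 1 0 = 0 -> v = 0.
Proof.
move=> v0 v1; apply/colP => k; rewrite mxE.
by case: k => -[|[|//]] hk; [rewrite -v0|rewrite -v1]; congr (v _ _); exact: val_inj.
Qed.

Lemma cf_lin4 a b (c1 c2 c3 c4 : C) (g1 g2 g3 g4 : S) :
  cf a b (c1%:MP * g1 + c2%:MP * g2 + c3%:MP * g3 + c4%:MP * g4) =
  c1 * cf a b g1 + c2 * cf a b g2 + c3 * cf a b g3 + c4 * cf a b g4.
Proof. by rewrite !cfD !cf_C. Qed.

Lemma cf_cov2_add k a b c F G F' G' (v : 'cV[C]_2) : mpow k F' -> mpow k G' -> (a + b < k)%N ->
  cf a b (cov2 (F + c%:MP * F') (G + c%:MP * G') v) = cf a b (cov2 F G v).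
Proof.
move=> hF hG ab; rewrite /cov2 !cfD !cf_C !cfD !cf_C (hF _ _ ab) (hG _ _ ab).
by rewrite !mulr0 !addr0.
Qed.

(** [I] lies in [m^5], hence [m I + n] in [m^6]. *)
Lemma E_typeA I c : exceptional R I -> has_w5 I c -> E (fun h : 'M[C]_2 => h) I.
Proof.
move=> excI w5; have idI := exceptional_ideal excI; have nI := exceptional_nideal excI.
have m5 := mpow_ideal R 5; have m6 := mpow_ideal R 6.
have w57 : has_w5 (mpow 5) c.
  have s57 := @sub_mpow R 7 5 isT.
  split; (apply: (idealD m5); [|apply: (idealM m5); apply: s57]).
  - exact: W5x_mpow. - exact: W7x_mpow.
  - exact: W5y_mpow. - exact: W7y_mpow.
have I5 : I `<=` I `&` mpow 5.
  apply: (exceptional_sub excI (setI_ideal idI m5) (@subIsetl _ _ _)).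
  apply: (typeA_codim (c := c) (setI_ideal idI m5)).
  - by split; [exact: nI (@F6_nideal R)|apply: (@sub_mpow R 6 5 isT); exact: F6_mpow].
  - by split; [exact: nI (@F8_nideal R)|apply: (@sub_mpow R 8 5 isT); exact: F8_mpow].
  - by split; split; [exact: w5.1|exact: w57.1|exact: w5.2|exact: w57.2].
have mI6 : mIn I `<=` mpow 6.
  apply: (mIn_sub m6 _ (@nideal_mpow6 R)) => p q p1 /I5[_ q5].
  exact: mpowM p1 q5.
apply: (E_natural_intro excI (equiv2_add c (@w5_equiv R) (@w7_equiv R)) w5.1 w5.2) => v /mI6 hv.
have E : cov2 W5x W5y v = (v 0 0)%:MP * (x ^+ 5 * y ^+ 0) - (5 * v 0 0)%:MP * (x ^+ 1 * y ^+ 4)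
    + (v 1 0)%:MP * (x ^+ 0 * y ^+ 5) - (5 * v 1 0)%:MP * (x ^+ 4 * y ^+ 1).
  by rewrite /cov2 /w5x /w5y !mpolyCM !mpolyC_nat; ring.
apply: col2_eq0.
  by have := hv 5%N 0%N isT; rewrite (@cf_cov2_add 7 5 0 c W5x W5y W7x W7y v (@W7x_mpow R) (@W7y_mpow R) isT) E !(cfD, cfN, cf_C, cf_mon) /=
    => h; apply: (eq_scale (oner_neq0 _) (m := 1) h); ring.
by have := hv 0%N 5%N isT; rewrite (@cf_cov2_add 7 0 5 c W5x W5y W7x W7y v (@W7x_mpow R) (@W7y_mpow R) isT) E !(cfD, cfN, cf_C, cf_mon) /=
    => h; apply: (eq_scale (oner_neq0 _) (m := 1) h); ring.
Qed.

(** The forms of degree six modulo which an ideal is described. *)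
Definition r6_span (b1 b2 b3 : S) : set S :=
  [set p | exists a b d c : C, p = a%:MP * b1 + b%:MP * b2 + d%:MP * b3 + c%:MP * F6].

Lemma r6_span_ideal b1 b2 b3 : mpow 6 b1 -> mpow 6 b2 -> mpow 6 b3 ->
  is_ideal (lead_ideal 6 (r6_span b1 b2 b3)).
Proof.
have m6 := mpow_ideal R 6; move=> h1 h2 h3; apply: lead_ideal_ideal.
- move=> p [a [b [d [c ->]]]]; apply: (idealD m6); last by apply: (idealM m6); exact: F6_mpow.
  by apply: (idealD m6); [apply: (idealD m6)|]; exact: (idealM m6).
- by exists 0, 0, 0, 0; rewrite mpolyC0 !mul0r !addr0.
- move=> t p q [a [b [d [c ->]]]] [a' [b' [d' [c' ->]]]].
  by exists (t * a + a'), (t * b + b'), (t * d + d'), (t * c + c'); rewrite !mpolyCD !mpolyCM; ring.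
Qed.

Lemma r6_span_mem b1 b2 b3 : let K := lead_ideal 6 (r6_span b1 b2 b3) in
  [/\ K b1, K b2, K b3 & K F6].
Proof.
have e p : mpow 7 (p - p) by rewrite subrr; exact: (ideal0 (mpow_ideal R 7)).
split; (eexists; last exact: e).
- by exists 1, 0, 0, 0; rewrite mpolyC0 mpolyC1 !mul0r !addr0 mul1r.
- by exists 0, 1, 0, 0; rewrite mpolyC0 mpolyC1 !mul0r !addr0 add0r mul1r.
- by exists 0, 0, 1, 0; rewrite mpolyC0 mpolyC1 !mul0r !addr0 !add0r mul1r.
- by exists 0, 0, 0, 1; rewrite mpolyC0 mpolyC1 !mul0r !add0r mul1r.
Qed.

Lemma r6_span_mpow7 b1 b2 b3 : mpow 7 `<=` lead_ideal 6 (r6_span b1 b2 b3).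
Proof.
move=> p hp; exists 0; last by rewrite subr0.
by exists 0, 0, 0, 0; rewrite mpolyC0 !mul0r !addr0.
Qed.

(** Multiplication by [f] on leading forms, to second order. *)
Lemma lead_mul k (f p g : S) : mpow k g -> mpow k.+1 (p - g) ->
  mpow k.+2 (f * p - ((cf 0 0 f)%:MP * p + ((cf 1 0 f)%:MP * x + (cf 0 1 f)%:MP * y) * g)).
Proof.
move=> hg hp; set L := _ + _ * y.
have L1 : mpow 1 L.
  by apply: (idealD (mpow_ideal R 1)); apply: (idealM (mpow_ideal R 1)); [exact: mpow1_x|exact: mpow1_y].
have f2 : mpow 2 (f - (cf 0 0 f)%:MP - L).
  move=> a b ab; rewrite -[(cf 0 0 f)%:MP]mulr1 /L.
  rewrite !(cfD, cfN) !cf_C cf_x cf_y cf_1.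
  by case: a b ab => [|[|a]] [|[|b]] // _ /=; ring.
have hpk : mpow k p.
  rewrite -(subrK g p); apply: (idealD (mpow_ideal R k)) => //; exact: (sub_mpow (leqnSn k)) hp.
rewrite (_ : _ - _ = (f - (cf 0 0 f)%:MP - L) * p + L * (p - g)); last by ring.
apply: (idealD (mpow_ideal R k.+2)); first by rewrite -add2n; exact: mpowM.
by rewrite -add1n; exact: mpowM.
Qed.

Definition annihilated7 p := 5 * cf 0 7 p + cf 4 3 p = 0 /\ 5 * cf 7 0 p + cf 3 4 p = 0.

Lemma annihilated7D p q : annihilated7 p -> annihilated7 q -> annihilated7 (p + q).
Proof.
move=> [p1 p2] [q1 q2]; split; rewrite !cfD mulrDr addrACA.
  by rewrite p1 q1 addr0.
by rewrite p2 q2 addr0.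
Qed.

Lemma annihilated7C (c : C) p : annihilated7 p -> annihilated7 (c%:MP * p).
Proof. by move=> [h1 h2]; split; rewrite !cf_C mulrCA -mulrDr ?h1 ?h2 mulr0. Qed.

Lemma annihilated7_mpow8 p q : mpow 8 (p - q) -> annihilated7 q -> annihilated7 p.
Proof.
move=> h; have e a b : (a + b = 7)%N -> cf a b p = cf a b q.
  by move=> ab; apply/eqP; rewrite -subr_eq0 -cfB h // ab.
by rewrite /annihilated7 !e.
Qed.

(** The functionals vanish on the multiples of [Uxx], [Uxy], [Uyy] and [F6] in
    degree seven, but not on [W7x] and [W7y]. *)
Lemma annihilated7_U (k l a b d c : C) :
  annihilated7 ((k%:MP * x + l%:MP * y) * (a%:MP * Uxx + b%:MP * Uxy + d%:MP * Uyy + c%:MP * F6)).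
Proof.
pose cs := [:: l * d; - 2 * l * b + k * d - l * c; - 5 * l * a - 2 * k * b - k * c; - 5 * k * a;
  - 5 * l * d; - 2 * l * b - 5 * k * d + l * c; l * a - 2 * k * b + k * c; k * a].
rewrite (_ : _ * _ = bform 7 cs); last first.
  rewrite /bform !big_ord_recl big_ord0 /= /uxx /uxy /uyy /f6.
  by rewrite !(mpolyCD, mpolyCN, mpolyCM, mpolyC_nat); ring.
by split; rewrite !cf_bform /cs /=; ring.
Qed.

(** When the leading forms of [I] are combinations of [Uxx], [Uxy], [Uyy] and
    [F6], this ideal contains [m I + n]. *)
Definition nat_test : set S := [set p | lead_ideal 6 (@F6_line R) p /\ annihilated7 p].

Lemma lin_zero3 (p q r s : S) : s = 0%:MP * p + 0%:MP * q + 0%:MP * r + s.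
Proof. by rewrite mpolyC0; ring. Qed.

Lemma F6_lineE (c k l : C) : annihilated7 ((k%:MP * x + l%:MP * y) * (c%:MP * F6)).
Proof.
rewrite [c%:MP * F6](lin_zero3 Uxx Uxy Uyy); exact: annihilated7_U.
Qed.

Lemma F6_annihilated7 (c : C) : annihilated7 (c%:MP * F6).
Proof.
apply: annihilated7C; rewrite (_ : F6 = x ^+ 5 * y ^+ 1 - x ^+ 1 * y ^+ 5).
  by split; rewrite !cfB !cf_mon /= subr0 mulr0 addr0.
by rewrite /f6 !expr1.
Qed.

Lemma nat_test_ideal : is_ideal nat_test.
Proof.
have idL := F6_line_ideal R; split.
- by split; [exact: (ideal0 idL)|split; rewrite !cf0 mulr0 addr0].
- by move=> p q [lp ap] [lq aq]; split; [exact: (idealD idL)|exact: annihilated7D].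
- move=> f p [lp ap]; split; first exact: (idealM idL).
  have [g [c _ gE] hg] := lp.
  have g6 : mpow 6 g by rewrite -gE; apply: (idealM (mpow_ideal R 6)); exact: F6_mpow.
  apply: (annihilated7_mpow8 (lead_mul f g6 hg)); apply: annihilated7D.
    exact: annihilated7C.
  by rewrite -gE; exact: F6_lineE.
Qed.

Lemma nideal_nat_test : nideal R `<=` nat_test.
Proof.
apply: ideal_gen_min; first exact: nat_test_ideal.
move=> p []; rewrite poly_actE => inv p0; have [c hc] := invariant_low inv p0; split.
  by exists (c%:MP * F6); [exists c|exact: (@sub_mpow R 8 7 isT) hc].
exact: annihilated7_mpow8 hc (F6_annihilated7 c).
Qed.

(** To order six, [I] agrees with the span of the triple [U] and of [F6]. *)
Lemma E_typeB I : exceptional R I -> has_w7 I -> has_r6 I 1 0 -> E (fun h : 'M[C]_2 => h) I.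
Proof.
move=> excI w7 r6; have idI := exceptional_ideal excI; have nI := exceptional_nideal excI.
have [uxx6 uxy6 uyy6] := U_mpow R.
pose K := lead_ideal 6 (r6_span Uxx Uxy Uyy).
have idK : is_ideal K by exact: r6_span_ideal.
have K7 : mpow 7 `<=` K by exact: r6_span_mpow7.
have [Kxx' Kxy' Kyy' K6] := r6_span_mem Uxx Uxy Uyy.
have rK : has_r6 K 1 0 := (has_r6_10 K).2 (And3 Kxx' Kxy' Kyy').
have IK : I `<=` I `&` K.
  apply: (exceptional_sub excI (setI_ideal idI idK) (@subIsetl _ _ _)).
  apply: (typeB_codim (setI_ideal idI idK)).
  - by split; [exact: nI (@F6_nideal R)|exact: K6].
  - by split; [exact: nI (@F8_nideal R)|apply: K7; apply: (@sub_mpow R 8 7 isT); exact: F8_mpow].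
  - by split; split; [exact: w7.1|apply: K7; exact: W7x_mpow|exact: w7.2|apply: K7; exact: W7y_mpow].
  - by case: r6 rK => [r1 r2 r3] [s1 s2 s3]; split; split.
have mIT : mIn I `<=` nat_test.
  apply: (mIn_sub nat_test_ideal _ nideal_nat_test) => p q p1 /IK[_ [g [a [b [d [c gE]]]] hg]].
  have g6 : mpow 6 g.
    rewrite gE; apply: (idealD (mpow_ideal R 6)); last by apply: (idealM (mpow_ideal R 6)); exact: F6_mpow.
    by apply: (idealD (mpow_ideal R 6)); [apply: (idealD (mpow_ideal R 6))|]; exact: (idealM (mpow_ideal R 6)).
  have := lead_mul p g6 hg; rewrite (p1 0%N 0%N isT) mpolyC0 mul0r add0r => h8; split.
    exists 0; first by exists 0 => //; rewrite mpolyC0 mul0r.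
    rewrite subr0 -(subrK (((cf 1 0 p)%:MP * x + (cf 0 1 p)%:MP * y) * g) (p * q)).
    apply: (idealD (mpow_ideal R 7)); first exact: (@sub_mpow R 8 7 isT) h8.
    rewrite -(add1n 6); apply: mpowM => //.
    by apply: (idealD (mpow_ideal R 1)); apply: (idealM (mpow_ideal R 1)); [exact: mpow1_x|exact: mpow1_y].
  by apply: (annihilated7_mpow8 h8); rewrite gE; exact: annihilated7_U.
apply: (E_natural_intro excI (@w7_equiv R) w7.1 w7.2) => v /mIT[_ [a1 a2]].
have E : cov2 W7x W7y v = (v 0 0)%:MP * (x ^+ 0 * y ^+ 7) + (7 * v 0 0)%:MP * (x ^+ 4 * y ^+ 3)
    + (- v 1 0)%:MP * (x ^+ 7 * y ^+ 0) + (- 7 * v 1 0)%:MP * (x ^+ 3 * y ^+ 4).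
  by rewrite /cov2 /w7x /w7y !(mpolyCN, mpolyCM) !mpolyC_nat; ring.
have cE m n : cf m n (cov2 W7x W7y v) = v 0 0 * ((0 == m) && (7 == n))%N%:R
    + 7 * v 0 0 * ((4 == m) && (3 == n))%N%:R + - v 1 0 * ((7 == m) && (0 == n))%N%:R
    + - 7 * v 1 0 * ((3 == m) && (4 == n))%N%:R.
  by rewrite E cf_lin4 !cf_mon.
rewrite !cE /= in a1 a2.
have n12 : (12 : C) != 0 by rewrite pnatr_eq0.
apply: col2_eq0.
  by apply: (eq_scale n12 (m := 1) a1); ring.
by apply: (eq_scale n12 (m := -1) a2); ring.
Qed.

Lemma E_typeAB I : exceptional R I -> typeAB I -> E (fun h : 'M[C]_2 => h) I.
Proof. by move=> excI [[c]|[]]; [exact: E_typeA|exact: E_typeB]. Qed.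

(** By averaging, an embedding of the natural representation in [V(I)] comes from
    a covariant in [I]; those vanish in [V(I)] by [typeC_covariant]. *)
Lemma E_not_typeC I : E (fun h : 'M[C]_2 => h) I -> ~ typeC I.
Proof.
move=> [excI [f [fI fH fJ]]] tC; rewrite poly_actE in fH.
have idI := exceptional_ideal excI; have idm := mIn_ideal I.
have stJ h p : H R h -> mIn I p -> mIn I (act h p) by apply: mIn_H; exact: exceptional_stable.
have flin : linear f by move=> a u v; rewrite linearP.
have [F [G [e IF IG avJ]]] := average_equivariant idI idm (exceptional_stable excI) stJ flin fI fH.
have [mF mG] := typeC_covariant excI tC e IF IG.
have : (const_mx 1 : 'cV[C]_2) = 0.
  apply: fJ; rewrite -(subKr (cov2 F G (const_mx 1)) (f _)).
  apply: (idealB idm); last exact: avJ.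
  by apply: (idealD idm); exact: (idealM idm).
by move/colP/(_ 0); rewrite !mxE => /eqP; rewrite oner_eq0.
Qed.

End Components.

(** * The fixed ideal *)

Section FixedIdeal.
Variable R : realType.
Local Notation C := R[i].
Local Notation S := {mpoly C[2]}.
Local Notation x := (vx R).
Local Notation y := (vy R).
Local Notation F6 := (f6 x y).
Local Notation F8 := (f8 x y).
Local Notation Kxx := (kxx x y).
Local Notation Kxy := (kxy x y).
Local Notation Kyy := (kyy x y).
Implicit Types (I J : set S) (p q F G K : S) (h g : 'M[C]_2).

Local Notation fixed := (fixed_ideal R).
Local Notation omega := (omega R).

Lemma p1E : p1 R = x ^+ 2 - y ^+ 2. Proof. by rewrite vxE vyE. Qed.
Lemma p2E : p2 R = x ^+ 2 + y ^+ 2. Proof. by rewrite vxE vyE. Qed.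
Lemma p3E : p3 R = x * y. Proof. by rewrite vxE vyE. Qed.

Lemma omega_units : [/\ 1 - omega ^+ 2 != 0, omega ^+ 2 - omega != 0 & 1 - omega != 0].
Proof.
have w2 := omega_sqr R; have n3 : (3 : C) != 0 by rewrite pnatr_eq0.
split; apply: contraNneq n3 => e; apply/eqP.
- by rewrite -(mulr0 (1 - omega)) -e; ring: w2.
- by rewrite -(mulr0 (omega - omega ^+ 2)) -e; ring: w2.
- by rewrite -(mulr0 (1 - omega ^+ 2)) -e; ring: w2.
Qed.

(** The relation [omega^2 + omega + 1 = 0] turns the first factor into a multiple
    of [p1^2], and [p1^3 = Kyy - Kxx]; the two other generators are multiples of
    [p3^3] and [p2^3] in the same way. *)
Lemma fixed_gen1 : p1 R * (- omega ^+ 2 *: phi R + psi R) = (1 - omega ^+ 2)%:MP * (Kyy - Kxx).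
Proof.
have w2 : omega%:MP ^+ 2 = - 1 - omega%:MP :> S.
  by rewrite -rmorphXn /= omega_sqr mpolyCB mpolyCN mpolyC1.
rewrite /phi /psi p1E p2E p3E -!mul_mpolyC mpolyCN !mpolyCM mpolyCB mpolyC1 !mpolyC_nat !rmorphXn /=.
by rewrite /kyy /kxx; ring: w2.
Qed.

Lemma fixed_gen2 : p3 R * (- phi R + psi R) = (- (omega ^+ 2 - omega))%:MP * Kxy.
Proof.
rewrite /phi /psi p2E p3E -!mul_mpolyC expr2 mpolyCN mpolyCB !mpolyCM !mpolyC_nat.
by rewrite /kxy; ring.
Qed.

Lemma fixed_gen3 : p2 R * (- omega *: phi R + psi R) = (1 - omega)%:MP * (Kyy + Kxx).
Proof.
have w2 : omega%:MP ^+ 2 = - 1 - omega%:MP :> S.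
  by rewrite -rmorphXn /= omega_sqr mpolyCB mpolyCN mpolyC1.
rewrite /phi /psi p2E p3E -!mul_mpolyC mpolyCN !mpolyCM mpolyCB mpolyC1 !mpolyC_nat ?rmorphXn /=.
by rewrite /kyy /kxx; ring: w2.
Qed.

Lemma fixed_is_ideal : is_ideal fixed.
Proof. exact: ideal_gen_ideal. Qed.

Lemma fixed_nideal : nideal R `<=` fixed.
Proof. by move=> p np; apply: sub_ideal_gen; left. Qed.

Lemma fixed_r6 : has_r6 fixed 0 1.
Proof.
have idF := fixed_is_ideal; have [u1 u2 u3] := omega_units.
have g1 : fixed (Kyy - Kxx).
  apply: (idealZK idF u1); rewrite -mul_mpolyC -fixed_gen1.
  by apply: sub_ideal_gen; right; left; left.
have g2 : fixed Kxy.
  apply: (idealZK idF (c := - (omega ^+ 2 - omega))); first by rewrite oppr_eq0.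
  by rewrite -mul_mpolyC -fixed_gen2; apply: sub_ideal_gen; right; left; right.
have g3 : fixed (Kyy + Kxx).
  apply: (idealZK idF u3); rewrite -mul_mpolyC -fixed_gen3.
  by apply: sub_ideal_gen; right; right.
have half (a b : S) : fixed (a - b) -> fixed (a + b) -> fixed a /\ fixed b.
  move=> hB hD; split; apply: (ideal_natK idF (n := 1)).
    by rewrite (_ : 2 * a = (a - b) + (a + b)); [exact: (idealD idF)|ring].
  by rewrite (_ : 2 * b = (a + b) - (a - b)); [exact: (idealB idF)|ring].
have [hyy hxx] := half _ _ g1 g3.
exact: (has_r6_01 fixed).2 (And3 hxx g2 hyy).
Qed.

Lemma fixed_gens_span p : [set p1 R * (- omega ^+ 2 *: phi R + psi R); p3 R * (- phi R + psi R);
    p2 R * (- omega *: phi R + psi R)] p ->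
  exists a b d : C, p = a%:MP * Kxx + b%:MP * Kxy + d%:MP * Kyy.
Proof.
have e (c a b d : C) (q f1 f2 f3 : S) : q = a%:MP * f1 + b%:MP * f2 + d%:MP * f3 ->
    c%:MP * q = (c * a)%:MP * f1 + (c * b)%:MP * f2 + (c * d)%:MP * f3.
  by move=> ->; rewrite !mpolyCM; ring.
have e1 (f1 f2 f3 : S) : f3 - f1 = (-1)%:MP * f1 + 0%:MP * f2 + 1%:MP * f3.
  by rewrite mpolyCN mpolyC0 mpolyC1; ring.
have e2 (f1 f2 f3 : S) : f2 = 0%:MP * f1 + 1%:MP * f2 + 0%:MP * f3.
  by rewrite mpolyC0 mpolyC1; ring.
have e3 (f1 f2 f3 : S) : f3 + f1 = 1%:MP * f1 + 0%:MP * f2 + 1%:MP * f3.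
  by rewrite mpolyC0 mpolyC1; ring.
move=> [[->|->]|->].
- by rewrite fixed_gen1; do 3 eexists; exact: e (e1 Kxx Kxy Kyy).
- by rewrite fixed_gen2; do 3 eexists; exact: e (e2 Kxx Kxy Kyy).
- by rewrite fixed_gen3; do 3 eexists; exact: e (e3 Kxx Kxy Kyy).
Qed.

Local Notation Klead := (lead_ideal 6 (r6_span Kxx Kxy Kyy)).

Lemma Klead_ideal : is_ideal Klead.
Proof. by have [h1 h2 h3] := K_mpow R; exact: r6_span_ideal. Qed.

Lemma fixed_lead : fixed `<=` Klead.
Proof.
apply: ideal_gen_min; first exact: Klead_ideal.
move=> p [/nideal_lead[_ [c _ <-] hp]|/fixed_gens_span[a [b [d ->]]]].
  exists (c%:MP * F6) => //; exists 0, 0, 0, c; exact: lin_zero3.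
exists (a%:MP * Kxx + b%:MP * Kxy + d%:MP * Kyy); last by rewrite subrr; exact: (ideal0 (mpow_ideal R 7)).
by exists a, b, d, 0; rewrite mpolyC0 mul0r addr0.
Qed.

Lemma fixed_mpow6 : fixed `<=` mpow 6.
Proof.
move=> p /fixed_lead[_ [a [b [d [c ->]]]] hp]; have m6 := mpow_ideal R 6.
have [h1 h2 h3] := K_mpow R.
apply: (ideal_congr m6 (@sub_mpow R 7 6 isT _ hp)).
by apply: (idealD m6); [apply: (idealD m6); [apply: (idealD m6)|]|]; apply: (idealM m6) => //; exact: F6_mpow.
Qed.

Lemma fixed_F6 : fixed F6. Proof. exact: fixed_nideal (@F6_nideal R). Qed.
Lemma fixed_F8 : fixed F8. Proof. exact: fixed_nideal (@F8_nideal R). Qed.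

Lemma fixed_K : [/\ fixed Kxx, fixed Kxy & fixed Kyy].
Proof.
exact: (has_r6_01 fixed).1 fixed_r6.
Qed.

Lemma fixed_act h p : H R h -> fixed p -> fixed (act h p).
Proof.
move=> Hh; have idF := fixed_is_ideal; apply: (ideal_gen_act idF) => {}p [np|].
  by apply: fixed_nideal; exact: nideal_H.
have [h1 h2 h3] := fixed_K.
have lin (a b c : C) : fixed (a%:MP * Kxx + b%:MP * Kxy + c%:MP * Kyy).
  by apply: (idealD idF); [apply: (idealD idF)|]; exact: (idealM idF).
move=> /fixed_gens_span[a [b [d ->]]].
have [exx exy eyy] := equiv3E (@k_equiv R) Hh.
have act_lin3 (f1 f2 f3 : S) : act h (a%:MP * f1 + b%:MP * f2 + d%:MP * f3) =
    a%:MP * act h f1 + b%:MP * act h f2 + d%:MP * act h f3.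
  by rewrite !actD !actM !actC.
have fxx : fixed (act h Kxx) by rewrite exx; exact: lin.
have fxy : fixed (act h Kxy) by rewrite exy; exact: lin.
have fyy : fixed (act h Kyy) by rewrite eyy; exact: lin.
by rewrite act_lin3; apply: (idealD idF); [apply: (idealD idF)|]; exact: (idealM idF).
Qed.

(** * The regular representation on the quotient by the fixed ideal *)

(** A functional that kills the forms [Kxx], [Kxy], [Kyy] and [F6], and whose
    values on the translates of [dual_pt] by [H] are [24] and zeros: this makes
    the quotient by the fixed ideal a regular representation. *)
Definition lam_wt : seq ((nat * nat) * C) :=
  [:: ((0, 0)%N, 1); ((1, 0)%N, 2); ((1, 1)%N, 3); ((0, 3)%N, 4); ((4, 0)%N, 1); ((0, 4)%N, 1);
      ((1, 3)%N, 3); ((0, 5)%N, 6); ((4, 1)%N, - 6 / 5); ((0, 6)%N, 3); ((4, 2)%N, -1)].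

Definition lam p : C := \sum_(t <- lam_wt) t.2 * cf t.1.1 t.1.2 p.

Definition dual_pt : S :=
  1 + x + x * y + y ^+ 3 + (x ^+ 4 + y ^+ 4 + x * y ^+ 3) + y ^+ 5 + y ^+ 6.

Lemma lamD p q : lam (p + q) = lam p + lam q.
Proof. by rewrite /lam -big_split; apply: eq_bigr => t _; rewrite cfD mulrDr. Qed.

Lemma lamZ (c : C) p : lam (c *: p) = c * lam p.
Proof. by rewrite /lam mulr_sumr; apply: eq_bigr => t _; rewrite cfZ mulrCA. Qed.

Lemma lamC (c : C) p : lam (c%:MP * p) = c * lam p.
Proof. by rewrite mul_mpolyC lamZ. Qed.

Lemma lam0 : lam 0 = 0.
Proof. by rewrite -(scale0r (0 : S)) lamZ mul0r. Qed.

Lemma lam_sum (T : Type) (r : seq T) (F : T -> S) : lam (\sum_(t <- r) F t) = \sum_(t <- r) lam (F t).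
Proof. exact: (big_morph lam lamD lam0). Qed.

Lemma lam_bformE d cs : lam (bform d cs) =
  \sum_(t <- lam_wt) t.2 * (if (t.1.1 + t.1.2 == d)%N then cs`_(t.1.1) else 0).
Proof. by apply: eq_bigr => t _; rewrite cf_bform. Qed.

Lemma lam_bform cs : [/\ lam (bform 0 cs) = cs`_0, lam (bform 1 cs) = 2 * cs`_1,
  lam (bform 2 cs) = 3 * cs`_1 & lam (bform 3 cs) = 4 * cs`_0].
Proof. by split; rewrite lam_bformE unlock /=; ring. Qed.

Lemma lam_bform456 cs : [/\ lam (bform 4 cs) = cs`_4 + cs`_0 + 3 * cs`_1,
  lam (bform 5 cs) = 6 * cs`_0 - 6 / 5 * cs`_4 & lam (bform 6 cs) = 3 * cs`_0 - cs`_4].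
Proof. by split; rewrite lam_bformE unlock /=; ring. Qed.

Lemma lam_Klead p : Klead p -> lam p = 0.
Proof.
move=> [_ [a [b [d [c ->]]]] hp]; rewrite -(subrK (a%:MP * Kxx + b%:MP * Kxy + d%:MP * Kyy + c%:MP * F6) p).
have lam7 q : mpow 7 q -> lam q = 0.
  by move=> q7; rewrite /lam unlock /= !q7 //; ring.
have kxxE : Kxx = bform 6 [:: 1; 0; 0; 0; 3; 0; 0].
  by rewrite /bform !big_ord_recl big_ord0 /= /kxx !(mpolyC0, mpolyC1, mpolyC_nat); ring.
have kyyE : Kyy = bform 6 [:: 0; 0; 3; 0; 0; 0; 1].
  by rewrite /bform !big_ord_recl big_ord0 /= /kyy !(mpolyC0, mpolyC1, mpolyC_nat); ring.
have kxyE : Kxy = bform 6 [:: 0; 0; 0; - 4; 0; 0; 0].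
  by rewrite /bform !big_ord_recl big_ord0 /= /kxy !(mpolyC0, mpolyC1, mpolyCN, mpolyC_nat); ring.
have f6E : F6 = bform 6 [:: 0; -1; 0; 0; 0; 1; 0].
  by rewrite /bform !big_ord_recl big_ord0 /= /f6 !(mpolyC0, mpolyC1, mpolyCN, mpolyC_nat); ring.
have gen (g : S) cs : g = bform 6 cs -> 3 * cs`_0 - cs`_4 = 0 -> lam g = 0.
  by move=> -> <-; have [_ _] := lam_bform456 cs.
have lam4 (g1 g2 g3 g4 : S) : lam g1 = 0 -> lam g2 = 0 -> lam g3 = 0 -> lam g4 = 0 ->
    lam (a%:MP * g1 + b%:MP * g2 + d%:MP * g3 + c%:MP * g4) = 0.
  by move=> h1 h2 h3 h4; rewrite !lamD !lamC h1 h2 h3 h4 !mulr0 !addr0.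
rewrite lamD (lam7 _ hp) add0r; apply: lam4.
- by apply: gen kxxE _ => /=; ring.
- by apply: gen kxyE _ => /=; ring.
- by apply: gen kyyE _ => /=; ring.
- by apply: gen f6E _ => /=; ring.
Qed.

Definition lam_val (al be ga de : C) : C :=
  1 + 2 * al + 3 * (al * de + ga * be) + 4 * de ^+ 3 + (al ^+ 4 + be ^+ 4 + al * be ^+ 3)
  + (ga ^+ 4 + de ^+ 4 + ga * de ^+ 3)
  + 3 * (4 * al * ga ^+ 3 + 4 * be * de ^+ 3 + al * de ^+ 3 + 3 * ga * be * de ^+ 2)
  + 6 * de ^+ 5 - 6 * be ^+ 4 * de + 3 * de ^+ 6 - 15 * be ^+ 4 * de ^+ 2.

Lemma lam_act h : lam (act h dual_pt) = lam_val (h 0 0) (h 0 1) (h 1 0) (h 1 1).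
Proof.
have -> : act h dual_pt = 1 + act h x + act h x * act h y + act h y ^+ 3
    + (act h x ^+ 4 + act h y ^+ 4 + act h x * act h y ^+ 3) + act h y ^+ 5 + act h y ^+ 6.
  by rewrite /dual_pt; ring.
have EX := actx h; have EY := acty h.
move: (act h x) (act h y) (h 0 0) (h 0 1) (h 1 0) (h 1 1) EX EY => X Y al be ga de EX EY.
have add7 (q0 q1 q2 q3 q4 q5 q6 : S) : lam (q0 + q1 + q2 + q3 + q4 + q5 + q6) =
    lam q0 + lam q1 + lam q2 + lam q3 + lam q4 + lam q5 + lam q6 by rewrite !lamD.
have val (q q' : S) (c c' : C) : q = q' -> lam q' = c' -> c' = c -> lam q = c.
  by move=> -> -> ->.
have l0 : lam 1 = 1.
  have [e _ _ _] := lam_bform [:: 1].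
  apply: (val _ _ _ _ _ e); first by rewrite /bform big_ord_recl big_ord0 /= mpolyC1; ring.
  by rewrite /=; ring.
have l1 : lam X = 2 * al.
  have [_ e _ _] := lam_bform [:: ga; al].
  apply: (val _ _ _ _ _ e); first by rewrite /bform !big_ord_recl big_ord0 /= EX; ring.
  by rewrite /=; ring.
have l2 : lam (X * Y) = 3 * (al * de + ga * be).
  have [_ _ e _] := lam_bform [:: ga * de; al * de + ga * be; al * be].
  apply: (val _ _ _ _ _ e).
    by rewrite /bform !big_ord_recl big_ord0 /= !(mpolyCD, mpolyCM) EX EY; ring.
  by rewrite /=; ring.
have l3 : lam (Y ^+ 3) = 4 * de ^+ 3.
  have [_ _ _ e] := lam_bform [:: de ^+ 3; 3 * be * de ^+ 2; 3 * be ^+ 2 * de; be ^+ 3].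
  apply: (val _ _ _ _ _ e).
    by rewrite /bform !big_ord_recl big_ord0 /= !(mpolyCM, rmorphXn, mpolyC_nat) /= EY; ring.
  by rewrite /=; ring.
have l4 : lam (X ^+ 4 + Y ^+ 4 + X * Y ^+ 3) = (al ^+ 4 + be ^+ 4 + al * be ^+ 3)
    + (ga ^+ 4 + de ^+ 4 + ga * de ^+ 3)
    + 3 * (4 * al * ga ^+ 3 + 4 * be * de ^+ 3 + al * de ^+ 3 + 3 * ga * be * de ^+ 2).
  have [e _ _] := lam_bform456 [:: ga ^+ 4 + de ^+ 4 + ga * de ^+ 3;
    4 * al * ga ^+ 3 + 4 * be * de ^+ 3 + al * de ^+ 3 + 3 * ga * be * de ^+ 2;
    6 * al ^+ 2 * ga ^+ 2 + 6 * be ^+ 2 * de ^+ 2 + 3 * al * be * de ^+ 2 + 3 * ga * be ^+ 2 * de;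
    4 * al ^+ 3 * ga + 4 * be ^+ 3 * de + 3 * al * be ^+ 2 * de + ga * be ^+ 3;
    al ^+ 4 + be ^+ 4 + al * be ^+ 3].
  apply: (val _ _ _ _ _ e).
    by rewrite /bform !big_ord_recl big_ord0 /= !(mpolyCD, mpolyCM, rmorphXn, mpolyC_nat) /= EX EY; ring.
  by rewrite /=; ring.
have l5 : lam (Y ^+ 5) = 6 * de ^+ 5 - 6 * be ^+ 4 * de.
  have [_ e _] := lam_bform456 [:: de ^+ 5; 5 * be * de ^+ 4; 10 * be ^+ 2 * de ^+ 3;
      10 * be ^+ 3 * de ^+ 2; 5 * be ^+ 4 * de; be ^+ 5].
  apply: (val _ _ _ _ _ e).
    by rewrite /bform !big_ord_recl big_ord0 /= !(mpolyCM, rmorphXn, mpolyC_nat) /= EY; ring.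
  by rewrite /=; field.
have l6 : lam (Y ^+ 6) = 3 * de ^+ 6 - 15 * be ^+ 4 * de ^+ 2.
  have [_ _ e] := lam_bform456 [:: de ^+ 6; 6 * be * de ^+ 5; 15 * be ^+ 2 * de ^+ 4;
      20 * be ^+ 3 * de ^+ 3; 15 * be ^+ 4 * de ^+ 2; 6 * be ^+ 5 * de; be ^+ 6].
  apply: (val _ _ _ _ _ e).
    by rewrite /bform !big_ord_recl big_ord0 /= !(mpolyCM, rmorphXn, mpolyC_nat) /= EY; ring.
  by rewrite /=; ring.
by rewrite add7 l0 l1 l2 l3 l4 l5 l6 /lam_val; ring.
Qed.

(** The values at the 24 Hurwitz units are checked one by one. *)
Lemma lam_val_hurwitz (q : quad) : q \in hurwitz ->
  lam_val (qmx R q 0 0) (qmx R q 0 1) (qmx R q 1 0) (qmx R q 1 1) = 24 * (q == qone)%:R.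
Proof.
pose P (q : quad) := lam_val (qmx R q 0 0) (qmx R q 0 1) (qmx R q 1 0) (qmx R q 1 1) = 24 * (q == qone)%:R.
have memP (s : seq quad) : foldr (fun (r : quad) A => P r /\ A) True s -> forall r : quad, r \in s -> P r.
  elim: s => //= r s IH [Pr Ps] u; rewrite inE => /orP[/eqP ->//|]; exact: IH.
apply: memP; have i2 := sqr_iota R; rewrite /= /P /lam_val.
by do 24! (split; first by rewrite !mxE /=; field: i2).
Qed.

Lemma lam_dual h : H R h -> lam (act h dual_pt) = 24 * (h == 1%:M)%:R.
Proof.
move=> /HP/mapP[q hq ->]; rewrite lam_act lam_val_hurwitz // -(qmx_one R).
by rewrite (inj_eq (@qmx_inj R)).
Qed.

Definition lam_kernel : set S := [set p | forall h, H R h -> lam (act h p) = 0].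

Lemma invmx_mulV h g : H R h -> H R g -> invmx (invmx h *m g) = invmx g *m h.
Proof.
move=> Hh Hg; have u := H_unit (HM (HV Hh) Hg).
have e : (invmx h *m g) *m (invmx g *m h) = 1%:M.
  by rewrite -mulmxA (mulmxA g) mulmxV ?H_unit // mul1mx mulVmx ?H_unit.
by rewrite -[RHS](mulKmx u) e mulmx1.
Qed.

Lemma lam_kernel_regular : quotient_regular lam_kernel.
Proof.
exists (fun p g => lam (act (invmx g) p)); rewrite poly_actE; split.
- by move=> a p q g Hg; rewrite actD actZ lamD lamZ.
- by move=> h p g Hh Hg; rewrite -act_mul invmx_mulV.
- move=> u; exists (\sum_(h <- hurwitz_mx R) (24^-1 * u h) *: act h dual_pt) => g Hg.
  rewrite act_sum lam_sum (bigD1_seq g) ?hurwitz_mx_uniq //=; last exact/HP.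
  rewrite actZ lamZ actK ?H_unit //.
  have := lam_dual (H1 R); rewrite act_id eqxx mulr1 => ->.
  rewrite big1_seq ?addr0 => [|h /andP[hg /HP Hh]].
    by rewrite mulrC mulrA mulfV ?mul1r // pnatr_eq0.
  rewrite actZ lamZ -act_mul lam_dual; last by apply: HM => //; exact: HV.
  suff /negPf -> : invmx g *m h != 1%:M by rewrite !mulr0.
  apply: contraNneq hg => e; rewrite -[h]mul1mx -(mulmxV (H_unit Hg)) -mulmxA e mulmx1.
  exact: eqxx.
- move=> p; split=> hp g Hg; first by apply: hp; exact: HV.
  by have := hp _ (HV Hg); rewrite invmxK.
Qed.

(** Both ideals have codimension 24. *)
Lemma fixed_kernel : fixed = lam_kernel.
Proof.
have sub : fixed `<=` lam_kernel.
  by move=> p fp h Hh; apply: lam_Klead; apply: fixed_lead; exact: fixed_act.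
apply/seteqP; split=> //; apply: (codim24_sub lam_kernel_regular sub) => //.
exact: (typeC_codim fixed_is_ideal fixed_F6 fixed_F8 fixed_r6).
Qed.

Lemma fixed_exceptional : exceptional R fixed.
Proof.
have idF := fixed_is_ideal; split; first split=> //.
- by apply: stable_intro => h p; exact: fixed_act.
- by rewrite fixed_kernel; exact: lam_kernel_regular.
move=> v; split=> [h j|v0 f ff]; last first.
  rewrite (_ : f.@[v] = f.@[fun=> 0]); first by apply/mpow1P; exact: (@sub_mpow R 6 1 isT) (fixed_mpow6 ff).
  by apply: meval_eq => j; rewrite v0.
have m7 := typeC_mpow7 idF fixed_F6 fixed_F8 fixed_r6.
have z a b : (7 <= a + b)%N -> v 0 ^+ a * v 1 ^+ b = 0.
  move=> ab; have := h _ (m7 _ (mpow_mon R ab)).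
  by rewrite mevalM !rmorphXn /= vxE vyE !mevalXU.
have v0 : v 0 = 0.
  by have /eqP := z 7%N 0%N isT; rewrite expr0 mulr1 expf_eq0 /= => /eqP.
have v1 : v 1 = 0.
  by have /eqP := z 0%N 7%N isT; rewrite expr0 mul1r expf_eq0 /= => /eqP.
by case: j => -[|[|//]] hj; [rewrite -v0|rewrite -v1]; congr (v _); exact: val_inj.
Qed.

Lemma fixed_tau : tau_ideal fixed = fixed.
Proof.
have excF := fixed_exceptional; have excT := exceptional_tau excF; symmetry.
apply: (has_r6_01_unique excF excT fixed_r6).
apply: (has_r6_scale (c := -1) (exceptional_ideal excT)); first by rewrite oppr_eq0 oner_eq0.
by rewrite mulr0 mulr1; exact: (has_r6_tau fixed_is_ideal fixed_r6).
Qed.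

Lemma typeC_fixed_ideal I : exceptional R I -> typeC I -> tau_ideal I = I -> I = fixed.
Proof.
move=> excI tC tI; exact: (has_r6_01_unique excI fixed_exceptional (typeC_fixed excI tC tI) fixed_r6).
Qed.

Lemma fixed_typeC : typeC fixed.
Proof. by exists 0, 1; split; [exact: oner_neq0|exact: fixed_r6]. Qed.

(** The triple [K] is independent modulo [m I + n], whose leading forms in degree
    six are multiples of [F6]. *)
Lemma fixed_E_rho3 (rho : forall v, 'M[C]_2 -> 'M[C]_(mckay_dim v)) :
  mckay_labelling rho -> E (rho rho3) fixed.
Proof.
move=> rhoP; have [P [Plin PH Pinj]] := rho3_symmetric rhoP.
have idF := fixed_is_ideal; have [hxx hxy hyy] := fixed_K.
split; first exact: fixed_exceptional.
apply: (@embeds_intro R 3 (rho rho3) fixed (mIn fixed) (fun v => cov3 Kxx Kxy Kyy (P v))).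
- by move=> a u v; rewrite Plin cov3_linear.
- by move=> v; apply: (idealD idF); [apply: (idealD idF)|]; exact: (idealM idF).
- by move=> h v Hh; rewrite PH // (@k_equiv R h Hh) subrr; exact: (ideal0 (mIn_ideal fixed)).
have mL : mIn fixed `<=` lead_ideal 6 (@F6_line R).
  apply: (mIn_sub (F6_line_ideal R) _ (@nideal_lead R)) => p q p1 /fixed_mpow6 q6.
  exists 0; first by exists 0 => //; rewrite mpolyC0 mul0r.
  by rewrite subr0 -(add1n 6); exact: mpowM.
move=> v /mL[_ [c _ <-] h7]; apply: Pinj.
have E : cov3 Kxx Kxy Kyy (P v) - c%:MP * F6 =
   bform 6 [:: P v 0 0; c; 3 * P v 1 1; - 4 * (P v 0 1 + P v 1 0); 3 * P v 0 0; - c; P v 1 1].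
  rewrite /bform !big_ord_recl big_ord0 /= /cov3 /kxx /kxy /kyy /f6 !mpolyCM !mpolyCN mpolyCD !mpolyC_nat.
  ring.
rewrite E in h7.
have := h7 0%N 6%N isT; rewrite cf_bform /= => z0.
have := h7 6%N 0%N isT; rewrite cf_bform /= => z6.
have := h7 3%N 3%N isT; rewrite cf_bform /= => /eqP.
rewrite mulf_eq0 oppr_eq0 pnatr_eq0 /= => /eqP z3.
have two (k : 'I_2) : k = 0 \/ k = 1 by case: k => -[|[|//]] hk; [left|right]; exact: val_inj.
apply/matrixP => k l; rewrite !mxE.
case: (two k) => ->; case: (two l) => ->; rewrite ?z0 ?z6 ?addr0 //.
by rewrite addrC.
Qed.

End FixedIdeal.

(** * The two branches of the McKay graph are exchanged *)

Section Branches.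
Variable R : realType.
Local Notation C := R[i].
Local Notation S := {mpoly C[2]}.
Local Notation x := (vx R).
Local Notation y := (vy R).
Local Notation iota := ('i%C : C).
Implicit Types (I J : set S) (p q F G K : S) (h g : 'M[C]_2).

Variable rho : forall v, 'M[C]_2 -> 'M[C]_(mckay_dim v).
Hypothesis rhoP : mckay_labelling rho.
Local Notation tau := (tau R).
Local Notation e := (eps R).

Lemma act_tau_quadrics : act tau (x ^+ 2 + y ^+ 2) = iota%:MP * (x ^+ 2 - y ^+ 2) /\
  act tau (x * y) = x * y.
Proof.
have ex : act tau x = (e ^+ 7)%:MP * y by rewrite act_taux rmorphXn.
have ey : act tau y = e%:MP * x by rewrite act_tauy.
split.
  rewrite actD !actX ex ey !exprMn -!rmorphXn /= -exprM.
  have -> : e ^+ (7 * 2) = - iota by rewrite (exprM e 2 7) eps_sqr; ring: (sqr_iota R).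
  by rewrite eps_sqr mpolyCN; ring.
rewrite actM ex ey mulrACA -mpolyCM -exprSr eps8 mpolyC1 mul1r; exact: mulrC.
Qed.

(** [phi] and [psi] are the cases [a = omega] and [a = omega^2]. *)
Lemma act_tau_conic (a b : C) : a + b = -1 ->
  act tau ((x ^+ 2 + y ^+ 2) ^+ 2 + (4 * a)%:MP * (x * y) ^+ 2) =
  - ((x ^+ 2 + y ^+ 2) ^+ 2 + (4 * b)%:MP * (x * y) ^+ 2).
Proof.
move=> ab; have -> : b = - 1 - a by rewrite -ab; ring.
have [h2 h3] := act_tau_quadrics; rewrite actD actX actM actC actX h2 h3 exprMn -rmorphXn /= sqr_iota.
by rewrite !(mpolyCM, mpolyCN, mpolyCB, mpolyC1, mpolyC_nat); ring.
Qed.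

Lemma act_tau_phi : act tau (phi R) = (-1) *: psi R.
Proof.
rewrite /phi /psi p2E p3E scaleN1r -!mul_mpolyC; apply: act_tau_conic.
by rewrite omega_sqr; ring.
Qed.

Lemma act_tau_psi : act tau (psi R) = (-1) *: phi R.
Proof.
rewrite /phi /psi p2E p3E scaleN1r -!mul_mpolyC; apply: act_tau_conic.
by rewrite omega_sqr; ring.
Qed.

Lemma twists_rho1 : twists_to rho rho1' rho1'' /\ twists_to rho rho1'' rho1'.
Proof.
have [_ _ _ sphi spsi] := rhoP; have m1 : (-1 : C) != 0 by rewrite oppr_eq0 oner_eq0.
split; first exact: spans_copy_twist sphi spsi act_tau_phi m1.
exact: spans_copy_twist spsi sphi act_tau_psi m1.
Qed.

Lemma twists_rho2'' : twists_to rho rho2' rho2'' /\ twists_to rho rho2'' rho2'.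
Proof.
have [t1 t2] := twists_rho1; split.
  by have [w' [ww]] := twists_neighbour rhoP (w := rho2') t1 isT; case: w' ww.
by have [w' [ww]] := twists_neighbour rhoP (w := rho2'') t2 isT; case: w' ww.
Qed.

Lemma E_twists v w I : twists_to rho v w -> E (rho v) I -> E (rho w) (tau_ideal I).
Proof. by move=> vw /E_tau; exact: E_iso. Qed.

Lemma E_image v w : twists_to rho v w -> twists_to rho w v ->
  coset_act (sigma R) @` E (rho v) = E (rho w).
Proof.
move=> vw wv; apply/seteqP; split=> [_ [I EI <-]|J EJ].
  rewrite coset_act_sigma; first exact: E_twists vw EI.
  exact: exceptional_stable EI.1.
exists (tau_ideal J); first exact: E_twists wv EJ.
rewrite coset_act_sigma ?tau_idealK //.
exact: exceptional_stable (exceptional_tau EJ.1).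
Qed.

Lemma E_involution v : twists_to rho v v -> is_involution (E (rho v)) (coset_act (sigma R)).
Proof. by move=> vv; apply: involution_sigma => [I []//|I]; exact: E_twists. Qed.

Lemma E_rho2_typeAB I : E (rho rho2) I <-> exceptional R I /\ typeAB I.
Proof.
rewrite (E_rho2 rhoP); split=> [EI|[excI AB]]; last exact: E_typeAB.
split; first exact: EI.1.
by have [//|tC] := exceptional_type EI.1; case: (E_not_typeC EI tC).
Qed.

Lemma E_rho2_fixed : E (rho rho2) `<=` A_fixed R.
Proof.
move=> I /E_rho2_typeAB[excI AB]; apply/(A_fixedP (exceptional_stable excI)).
exact: typeAB_fixed.
Qed.

Lemma E_rho3_fixed : (E (rho rho3) `\` E (rho rho2)) `&` A_fixed R = [set fixed_ideal R].
Proof.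
have excF := fixed_exceptional R; have stF := exceptional_stable excF.
apply/seteqP; split=> [I [[[excI _] nE2] fI]|_ ->].
  have tI := (A_fixedP (exceptional_stable excI)).1 fI.
  have [AB|tC] := exceptional_type excI; first by case: nE2; apply/E_rho2_typeAB.
  exact: typeC_fixed_ideal tC tI.
split; last by apply/(A_fixedP stF); exact: fixed_tau.
split; first exact: fixed_E_rho3.
by move/(E_rho2 rhoP)/E_not_typeC; apply; exact: fixed_typeC.
Qed.

End Branches.


Theorem propositionA3p1 (R : realType)
    (rho : forall v : mckay_vertex, 'M[R[i]]_2 -> 'M[R[i]]_(mckay_dim v))
    (rhoP : mckay_labelling rho) :
  exists sigma : set 'M[R[i]]_2,
    [/\ A R = [set H R; sigma] /\ sigma <> H R,
        (* (a) *)
        [/\ coset_act sigma @` E (rho rho1') = E (rho rho1''),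
            coset_act sigma @` E (rho rho1'') = E (rho rho1'),
            coset_act sigma @` E (rho rho2') = E (rho rho2'')
          & coset_act sigma @` E (rho rho2'') = E (rho rho2')],
        (* (b) *)
        is_involution (E (rho rho2)) (coset_act sigma) /\
        is_involution (E (rho rho3)) (coset_act sigma)
      & (* (c) *)
        E (rho rho2) `<=` A_fixed R /\
        (E (rho rho3) `\` E (rho rho2)) `&` A_fixed R = [set fixed_ideal R]].
Proof.
have [t1 t1'] := twists_rho1 rhoP; have [t2 t2'] := twists_rho2'' rhoP.
exists (sigma R); split.
- by split; [exact: A_cosets|exact: sigma_neqH].
- by split; exact: E_image.
- by split; apply: E_involution; [exact: twists_rho2|exact: twists_rho3].
- by split; [exact: E_rho2_fixed|exact: E_rho3_fixed].
Qed.
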